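(* Let $a<b$ be real numbers and let $u_0,v_0\in H^1(\mathbb{R})$ be real-valued, with the support of $u_0$ contained in $(a,b)$. Let $\phi(x)=x-a$ and $$C=4\int_a^b \phi(x)\,u_0(x)^2\,v_0(x)\,dx,\qquad I_\infty=\int_0^{+\infty}\frac{dy}{\sqrt{y^3+1}}.$$ If $C>0$, then the solution $(u,v)$ of the initial value problem $$u_t=2uv,\qquad v_t=H(u^2),\qquad u(\cdot,0)=u_0,\quad v(\cdot,0)=v_0,\qquad x\in\mathbb{R},$$ must develop a finite time singularity in the $H^1$ norm no later than $$T^*=\left(\frac{4C}{3\pi(b-a)^2}\right)^{-1/3} I_\infty .$$
   Context: $H$ denotes the Hilbert transform on $\mathbb{R}$: $(Hf)(x)=\frac{1}{\pi}\,\mathrm{P.V.}\int_{-\infty}^{\infty}\frac{f(y)}{x-y}\,dy$; it acts in the spatial variable $x$. $H^1=H^1(\mathbb{R})$ is the usual Sobolev space. A solution on $[0,T)$ means a pair $(u,v)$ with $u,v\in C^1([0,T);H^1)$ satisfying the system and the initial conditions. For given $u_0,v_0\in H^1$ there is a unique solution on a maximal time interval $[0,T_{\max})$, $0<T_{\max}\le\infty$. ''Develops a finite time singularity in the $H^1$ norm no later than $T^*$'' means that $T_{\max}\le T^*$ and that $\|u(t)\|_{H^1}+\|v(t)\|_{H^1}$ is unbounded on $[0,T_{\max})$. *)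

(* Defs.v *)
From HB Require Import structures.
From mathcomp Require Import all_boot all_order all_algebra.
From mathcomp Require Import all_classical all_reals all_analysis.

Set Implicit Arguments.
Unset Strict Implicit.
Unset Printing Implicit Defensive.

Import Order.TTheory GRing.Theory Num.Theory.
Import numFieldNormedType.Exports.

Local Open Scope classical_set_scope.
Local Open Scope ring_scope.

Notation leb := lebesgue_measure.

(* Elements of L^2 and H^1 are represented by measurable functions [R -> R];
   they are identified when they agree almost everywhere. *)

(* Every point of the complement has a neighbourhood on which [f] vanishes
   almost everywhere, so this depends only on the class of [f]. *)
Definition ess_support (R : realType) (f : R -> R) : set R :=
  [set x | ~ exists2 V, nbhs x V & {ae leb, forall y, V y -> f y = 0}].

Definition C1c (R : realType) (phi : R -> R) : Prop :=
  [/\ forall x, derivable phi x 1,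
      continuous (derive1 phi) &
      exists2 K : set R, compact K & forall x, ~ K x -> phi x = 0].

(* The L^2 functions that are weak derivatives of [f], with C^1 test functions
   of compact support as in Brezis, "Functional Analysis, Sobolev Spaces and
   Partial Differential Equations", Section 8.2. *)
Definition weak_derivatives (R : realType) (f : R -> R) : set (R -> R) :=
  [set g | g \in Lfun leb 2%:E /\
    forall phi, C1c phi ->
      \int[leb]_x (f x * derive1 phi x) = - \int[leb]_x (g x * phi x)].

Definition H1 (R : realType) : set (R -> R) :=
  [set f | f \in Lfun leb 2%:E /\ weak_derivatives f !=set0].

(* Weak derivatives are unique up to a null set; this selects a representative
   (the value outside [H1] is irrelevant). *)
Definition weak_derivative (R : realType) (f : R -> R) : R -> R :=
  xget (cst 0) (weak_derivatives f).

(* Meaningful for [f] in [H1] only, where both L^2 norms are finite. *)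
Definition H1norm (R : realType) (f : R -> R) : R :=
  Num.sqrt (fine 'N[leb]_(2%:E)[EFin \o f] ^+ 2 +
            fine 'N[leb]_(2%:E)[EFin \o weak_derivative f] ^+ 2).

Definition hilbert (R : realType) (f : R -> R) (x : R) : R :=
  pi^-1 *
  lim (\int[leb]_(y in [set y | e < `|x - y|]) (f y / (x - y)) @[e --> 0^'+]).

(* The interval [0, T) with [T] possibly infinite. *)
Definition times (R : realType) (T : \bar R) : set R :=
  [set t | 0 <= t /\ (t%:E < T)%E].

(* [u] is in C^1([0, T); H^1), with derivative [du]. At t = 0 the derivative
   and the limits are one-sided. *)
Definition C1_H1 (R : realType) (T : \bar R) (u du : R -> R -> R) : Prop :=
  forall t, times T t ->
  [/\ H1 (u t), H1 (du t),
      H1norm (fun x => (u s x - u t x) / (s - t) - du t x)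
        @[s --> within (times T `\ t) (nbhs t)] --> (0 : R) &
      H1norm (fun x => du s x - du t x)
        @[s --> within (times T) (nbhs t)] --> (0 : R)].

(* The functions of time are only constrained on [0, T). *)
Definition is_solution (R : realType) (u0 v0 : R -> R) (T : \bar R)
    (u v : R -> R -> R) : Prop :=
  exists du dv : R -> R -> R,
  [/\ C1_H1 T u du /\ C1_H1 T v dv,
      forall t, times T t -> du t = (fun x => 2 * u t x * v t x) %[ae leb],
      forall t, times T t -> dv t = hilbert (fun x => u t x ^+ 2) %[ae leb],
      u 0 = u0 %[ae leb] &
      v 0 = v0 %[ae leb]].

Definition is_maximal_solution (R : realType) (u0 v0 : R -> R) (T : \bar R)
    (u v : R -> R -> R) : Prop :=
  [/\ (0 < T)%E,
      is_solution u0 v0 T u v &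
      forall (T' : \bar R) (u' v' : R -> R -> R),
        (T < T')%E -> is_solution u0 v0 T' u' v' ->
        ~ (forall t, times T t ->
             u' t = u t %[ae leb] /\ v' t = v t %[ae leb])].

(* Main.v *)
(** Let [w = u^2]. The support of [u] stays in [[a, b]], and antisymmetry of the Hilbert kernel
    gives [\int w Hw = 0] and [\int x w Hw = (\int w)^2 / (2 pi)]. Hence [G = \int phi w] and
    [C = 4 \int phi w v] satisfy [G' = C] and
    [C' = 16 \int phi u^2 v^2 + (2 / pi) (\int w)^2 >= (2 / (pi (b - a)^2)) G^2].
    Then [C^2 - k (G - G 0)^3], with [k = 4 / (3 pi (b - a)^2)], is nondecreasing, and separating
    variables in [G' >= sqrt (C 0 ^2 + k (G - G 0)^3)] bounds the lifespan by [T*].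
    The system reads [y' = B (y, y)] with [B] bounded and bilinear on [H^1 x H^1], so that its
    solutions are locally power series in time, on an interval which only depends on the norm of
    the data: a solution that is bounded on [[0, Tmax)] with [Tmax] finite could be continued.

    Without Fourier transform, the [L^2] theory of [H] rests on the identity
    [P_e * P_d - Q_e * Q_d = 2 pi P_(e+d)] between the kernels [Q_e s = s / (s^2 + e^2)] and
    [P_e s = e / (s^2 + e^2)]: with the energies [\int f (P_e * f)], it shows that [Q_e * f] is
    Cauchy in [L^2] as [e] tends to 0. *)

Require Import Defs.
From HB Require Import structures.
From mathcomp Require Import all_boot all_order all_algebra.
From mathcomp Require Import all_classical all_reals all_analysis.
From mathcomp Require Import measurable_realfun.
From mathcomp Require Import ring lra.
Import Order.TTheory GRing.Theory Num.Theory.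
Import numFieldNormedType.Exports.
Local Open Scope classical_set_scope.
Local Open Scope ring_scope.

Set Implicit Arguments.
Unset Strict Implicit.
Unset Printing Implicit Defensive.

(** * Integrals over the line *)

(** The comparison of [(\int w)^2] with [G^2] rests on [0 <= phi <= b - a] on the support.
    Multiplying the inequality for [C'] by [2 C > 0] produces the derivative of [C^2] on one side
    and dominates that of [k (G - G 0)^3] on the other, since [G' = C] and [0 <= G - G 0 <= G]. Two
    obstacles shape the development. Elements of [H^1] are functions rather than classes, while
    [hilbert] is a pointwise limit: curves and differential equations therefore live in seminormed
    spaces with a domain, and in the system [hilbert] is only applied to products of two [H^1]
    functions, which are integrable with integrable derivative, so that the principal value exists
    at every point. Also, the weight [phi] is unbounded; it is cut off to [[a, b]], which changes
    nothing because the equation [u_t = 2 v u] is linear in [u] with bounded coefficient and cannot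
    enlarge the support. The kernel identity makes the energy midpoint convex in [e]; being bounded
    it is monotone, hence convergent as [e] tends to 0, and its second differences control the
    distance between [Q_e * f] and [Q_d * f]. *)

HB.lock Definition Int {R : realType} (f : R -> R) : R := (\int[@lebesgue_measure R]_x f x)%R.

Section integrals.
Context {R : realType}.
Implicit Types (f g h : R -> R) (a b c : R).
Local Notation mu := (@lebesgue_measure R).

Definition L1 f := mu.-integrable setT (EFin \o f).
Lemma IntE f : Int f = \int[mu]_x f x.
Proof. by rewrite Int.unlock. Qed.

Lemma L1_meas f : L1 f -> measurable_fun setT f.
Proof. by move=> /measurable_int/measurable_EFinP. Qed.

Lemma L1_le g f : measurable_fun setT f -> L1 g ->
  (forall x, `|f x| <= g x) -> L1 f.
Proof.
move=> mf ig fg; apply: (le_integrable _ _ _ ig) => //.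
  exact/measurable_EFinP.
move=> x _ /=; rewrite lee_fin (le_trans (fg x))//; exact: ler_norm.
Qed.

Lemma L1D f g : L1 f -> L1 g -> L1 (fun x => f x + g x).
Proof. by move=> lf lg; apply: (integrableD _ lf lg). Qed.

Lemma L1Z c f : L1 f -> L1 (fun x => c * f x).
Proof. by move=> lf; apply: (integrableZl _ c lf). Qed.

Lemma L1N f : L1 f -> L1 (fun x => - f x).
Proof. by move=> lf; apply: (integrableN lf). Qed.

Lemma L1B f g : L1 f -> L1 g -> L1 (fun x => f x - g x).
Proof. by move=> lf lg; apply: (integrableB _ lf lg). Qed.

Lemma L1_norm f : L1 f -> L1 (fun x => `|f x|).
Proof. by move=> lf; apply: (integrable_norm lf). Qed.

Lemma L1_0 : L1 (fun=> 0).
Proof. exact: integrable0. Qed.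

Lemma L1_bdd c f g : measurable_fun setT f -> (forall x, `|f x| <= c) ->
  L1 g -> L1 (fun x => f x * g x).
Proof.
move=> mf fc lg; apply: (@L1_le (fun x => c * `|g x|)).
- apply: measurable_funM => //; exact: L1_meas.
- exact/L1Z/L1_norm.
- by move=> x; rewrite normrM ler_wpM2r.
Qed.

Lemma IntD f g : L1 f -> L1 g -> Int (fun x => f x + g x) = Int f + Int g.
Proof. by move=> lf lg; rewrite !IntE RintegralD. Qed.

Lemma IntB f g : L1 f -> L1 g -> Int (fun x => f x - g x) = Int f - Int g.
Proof. by move=> lf lg; rewrite !IntE RintegralB. Qed.

Lemma IntZ c f : L1 f -> Int (fun x => c * f x) = c * Int f.
Proof. by move=> lf; rewrite !IntE RintegralZl. Qed.

Lemma IntN f : L1 f -> Int (fun x => - f x) = - Int f.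
Proof.
by move=> lf; rewrite -mulN1r -IntZ//; congr Int; apply/funext => x; rewrite mulN1r.
Qed.

Lemma Int0 : Int (fun _ : R => 0 : R) = 0.
Proof. by rewrite !IntE /Rintegral integral0. Qed.

Lemma Int_le f g : L1 f -> L1 g -> (forall x, f x <= g x) -> Int f <= Int g.
Proof. by move=> lf lg fg; rewrite !IntE; apply: le_Rintegral. Qed.

Lemma Int_ge0 f : (forall x, 0 <= f x) -> 0 <= Int f.
Proof. by move=> f0; rewrite IntE; apply: Rintegral_ge0. Qed.

Lemma Int_norm f : L1 f -> `|Int f| <= Int (fun x => `|f x|).
Proof. by move=> lf; rewrite !IntE; apply: le_normr_Rintegral. Qed.

Lemma EFinInt f : L1 f -> (Int f)%:E = (\int[mu]_x (f x)%:E)%E.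
Proof. by move=> lf; rewrite !IntE /Rintegral fineK//; apply: integrable_fin_num lf. Qed.

Lemma L1_ge0 f : measurable_fun setT f -> (forall x, 0 <= f x) ->
  (\int[mu]_x (f x)%:E < +oo)%E -> L1 f.
Proof.
move=> mf f0 foo; apply/integrableP; split; first exact/measurable_EFinP.
by under eq_integral do rewrite /= ger0_norm//.
Qed.

Lemma ae_imp (P Q : R -> Prop) : (forall x, P x -> Q x) ->
  {ae mu, forall x, P x} -> {ae mu, forall x, Q x}.
Proof. exact: (@filterS _ _ (ae_filter_ringOfSetsType mu)). Qed.

Lemma ae_imp2 (P P' Q : R -> Prop) : (forall x, P x -> P' x -> Q x) ->
  {ae mu, forall x, P x} -> {ae mu, forall x, P' x} -> {ae mu, forall x, Q x}.
Proof. exact: (@filterS2 _ _ (ae_filter_ringOfSetsType mu)). Qed.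

(** The relation [%[ae mu]] carries a premise of membership in the whole line. This form drops it;
    [aeeqE] translates at the interface with the definitions. *)
Definition aeeq f g := {ae mu, forall x, f x = g x}.

Lemma aeeqE f g : (f = g %[ae mu]) <-> aeeq f g.
Proof. by split; apply: ae_imp => x; [apply|]. Qed.

Lemma aeeq_refl f : aeeq f f.
Proof. exact: aeW. Qed.

Lemma aeeq_sym f g : aeeq f g -> aeeq g f.
Proof. by apply: ae_imp => x ->. Qed.

Lemma aeeq_trans f g h : aeeq f g -> aeeq g h -> aeeq f h.
Proof. by apply: ae_imp2 => x -> ->. Qed.

Lemma aeeqD f f' g g' : aeeq f f' -> aeeq g g' ->
  aeeq (fun x => f x + g x) (fun x => f' x + g' x).
Proof. by apply: ae_imp2 => x -> ->. Qed.

Lemma aeeqM f f' g g' : aeeq f f' -> aeeq g g' ->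
  aeeq (fun x => f x * g x) (fun x => f' x * g' x).
Proof. by apply: ae_imp2 => x -> ->. Qed.

Lemma aeeqZ c f f' : aeeq f f' -> aeeq (fun x => c * f x) (fun x => c * f' x).
Proof. by apply: ae_imp => x ->. Qed.

Lemma L1_ae f g : measurable_fun setT g -> aeeq f g -> L1 f -> L1 g.
Proof.
move=> mg fg lf; apply/integrableP; split; first exact/measurable_EFinP.
move/integrableP : (lf) => [mf];
apply: le_lt_trans; rewrite le_eqVlt; apply/orP; left; apply/eqP.
apply: ae_eq_integral => //.
- by apply/measurable_EFinP; exact: measurableT_comp.
- exact: measurableT_comp.
- by move: fg; apply: ae_imp => x /= ->.
Qed.

Lemma Int_ae f g : measurable_fun setT f -> measurable_fun setT g ->
  aeeq f g -> Int f = Int g.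
Proof.
move=> mf mg fg; rewrite !IntE /Rintegral; congr fine; apply: ae_eq_integral => //.
- exact/measurable_EFinP.
- exact/measurable_EFinP.
- by move: fg; apply: ae_imp => x /= ->.
Qed.

Lemma Int_eq0 f : L1 f -> (forall x, 0 <= f x) -> Int f = 0 -> aeeq f (cst 0).
Proof.
move=> lf f0 If.
have : (\int[mu]_x `|(EFin \o f) x|)%E = 0%E.
  rewrite -[LHS]/(\int[mu]_x `|f x|%:E)%E -(EFinInt (L1_norm lf)).
  have -> : (fun x => `|f x|) = f by apply/funext => x; rewrite ger0_norm.
  by rewrite If.
move/(ae_eq_integral_abs mu measurableT (measurable_int _ lf)).
by apply: ae_imp => x /= H; exact/EFin_inj/H.
Qed.

Lemma Int_dct (F : nat -> R -> R) f g : (forall n, measurable_fun setT (F n)) ->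
  measurable_fun setT f -> L1 g ->
  {ae mu, forall x, F n x @[n --> \oo] --> f x} ->
  (forall n, {ae mu, forall x, `|F n x| <= g x}) ->
  L1 f /\ Int (F n) @[n --> \oo] --> Int f.
Proof.
move=> mF mf lg Ff Fg.
have Fg' : {ae mu, forall x n, setT x -> (`|(F n x)%:E| <= (g x)%:E)%E}.
  by move: Fg => /ae_foralln Fg; move: Fg; apply: ae_imp => x /= H n _; rewrite lee_fin.
have mF' n : measurable_fun setT (EFin \o F n) by exact/measurable_EFinP.
have mf' : measurable_fun setT (EFin \o f) by exact/measurable_EFinP.
have Ff' : {ae mu, forall x, setT x -> (EFin \o F n) x @[n --> \oo] --> (EFin \o f) x}.
  by move: Ff; apply: ae_imp => x /= H _; apply/cvg_EFin => //; exact: nearW.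
have [lf _ lim] := @dominated_convergence _ _ R mu setT measurableT
  (fun n => EFin \o F n) (EFin \o f) (EFin \o g) mF' mf' Ff' lg Fg'.
split => //.
have lFn n : L1 (F n).
  apply: (@L1_ae (fun x => if `|F n x| <= g x then F n x else 0)) => //.
  - by move: (Fg n); apply: ae_imp => x /= ->.
  - apply: (@L1_le (fun x => `|g x|)); last 2 first.
    + exact: L1_norm.
    + move=> x; case: ifPn => [/le_trans|_]; last by rewrite normr0.
      by apply; exact: ler_norm.
    apply: measurable_fun_ifT => //; apply: measurable_fun_ler => //.
    + exact: measurableT_comp.
    + exact: L1_meas lg.
under eq_fun do rewrite IntE.
rewrite IntE; apply: fine_cvg; rewrite fineK; first by move: lim; apply: cvg_trans.
exact: integrable_fin_num lf.
Qed.

(** An integrable extended-real function is finite almost everywhere, so [fine] changes it on a null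
    set only. This brings the partial integrals of Fubini's theorem and monotone limits back to real
    functions. *)
Lemma EFin_fine_Int (F : R -> R) (f : R -> \bar R) :
  mu.-integrable setT f -> F = fine \o f -> L1 F /\ (Int F)%:E = (\int[mu]_x f x)%E.
Proof.
move=> lf ->.
have mf : measurable_fun setT f := measurable_int _ lf.
have mff : measurable_fun setT (EFin \o (fine \o f)).
  by apply/measurable_EFinP; apply: measurableT_comp.
have ff : {ae mu, forall x, f x = (EFin \o (fine \o f)) x}.
  have := integrable_ae measurableT lf.
  by apply: ae_imp => x /(_ I) /= fx; rewrite fineK.
have eqf : (\int[mu]_x f x = \int[mu]_x (EFin \o (fine \o f)) x)%E.
  by apply: ae_eq_integral => //; move: ff; apply: ae_imp => x.
have lF : L1 (fine \o f).
  apply/integrableP; split => //.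
  have /integrableP[_] := lf; apply: le_lt_trans.
  rewrite le_eqVlt; apply/orP; left; apply/eqP.
  apply: ae_eq_integral => //; [exact: measurableT_comp..|].
  by move: ff; apply: ae_imp => x /= {2}->.
by split => //; rewrite EFinInt// eqf.
Qed.

(** Fubini with Tonelli's condition in the form in which convolution kernels satisfy it: control of
    every section in one variable by an integrable bound. Sections in the other variable are then
    integrable only almost everywhere. *)
Lemma Int_swap (k : R * R -> R) (b : R -> R) : measurable_fun setT k ->
  (forall y, L1 (fun x => k (x, y))) -> L1 b ->
  (forall y, Int (fun x => `|k (x, y)|) <= b y) ->
  [/\ Int (fun x => Int (fun y => k (x, y))) = Int (fun y => Int (fun x => k (x, y))),
      L1 (fun x => Int (fun y => k (x, y))),
      L1 (fun y => Int (fun x => k (x, y))) &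
      {ae mu, forall x, L1 (fun y => k (x, y))}].
Proof.
move=> mk lk lb kb.
have mk' : measurable_fun setT (EFin \o k) by exact/measurable_EFinP.
have lty : (\int[mu]_y \int[mu]_x `|(EFin \o k) (x, y)| < +oo)%E.
  have /integrableP[mb] := lb; apply: le_lt_trans.
  apply: ge0_le_integral => //.
  - by move=> y _; apply: integral_ge0.
  - apply: (@measurable_fun_fubini_tonelli_G _ _ _ _ R mu (abse \o (EFin \o k))).
      exact: measurableT_comp.
    by move=> x; exact: abse_ge0.
  - exact: measurableT_comp.
  - move=> y _; rewrite -[X in (X <= _)%E]/(\int[mu]_x `|k (x, y)|%:E)%E.
    rewrite -(EFinInt (L1_norm (lk y))) lee_fin (le_trans (kb y))//.
    exact: ler_norm.
have ik : (mu \x mu)%E.-integrable setT (EFin \o k) by apply/integrable21ltyP.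
have ik' : (mu \x mu)%E.-integrable setT (EFin \o (fun p => k (p.2, p.1))).
  apply/integrable12ltyP => //; apply/measurable_EFinP.
  apply: measurableT_comp => //.
  by apply/measurable_fun_pairP; split; [exact: measurable_snd|exact: measurable_fst].
have [l1 e1] := @EFin_fine_Int (fun x => Int (fun y => k (x, y))) _
  (integrable_fubini_F ik) ltac:(by apply/funext => x; rewrite IntE).
have [l2 e2] := @EFin_fine_Int (fun y => Int (fun x => k (x, y))) _
  (integrable_fubini_F ik') ltac:(by apply/funext => x; rewrite IntE).
split; [|exact: l1|exact: l2|exact: ae_integrable1 ik].
by apply: EFin_inj; rewrite e1 e2; exact: (Fubini ik).
Qed.

Lemma indicE (A : set R) x : \1_A x = (x \in A)%:R :> R.
Proof. by rewrite indicE. Qed.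

Lemma restrict_indic (A : set R) f : f \_ A = (fun x => \1_A x * f x).
Proof.
apply/funext => x; rewrite indicE /patch; case: ifPn => _; first by rewrite mul1r.
by rewrite mul0r.
Qed.

Lemma Int_indic (A : set R) f : Int (fun x => \1_A x * f x) = \int[mu]_(x in A) f x.
Proof. by rewrite IntE [RHS]Rintegral_mkcond restrict_indic. Qed.

Lemma L1_indicP (A : set R) f : measurable A ->
  L1 (fun x => \1_A x * f x) <-> mu.-integrable A (EFin \o f).
Proof.
move=> mA; rewrite /L1 -restrict_indic -restrict_EFin.
by split => h; apply/(@integrable_mkcond _ _ R mu A _ mA).
Qed.

(** Half-open intervals make consecutive pieces disjoint, so that their indicators add up at every
    point. The integral is not oriented: it is 0 as soon as [b <= a]. *)
Definition itg g a b := Int (fun x => \1_(`]a, b]) x * g x).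
Definition locL1 g := forall a b, L1 (fun x => \1_(`]a, b]) x * g x).

Lemma indic_oc a b x :
  \1_(`]a, b]) x = (if (a < x) && (x <= b) then 1 else 0) :> R.
Proof. by rewrite indicE mem_setE in_itv/=; case: ifP. Qed.

Lemma measurable_indic_oc a b : measurable_fun setT (\1_(`]a, b]) : R -> R).
Proof. by apply: measurable_indic; exact: measurable_itv. Qed.

Lemma indic_le1 (A : set R) x : `|\1_A x : R| <= 1.
Proof. by rewrite indicE; case: (_ \in _); rewrite ?normr1 ?normr0. Qed.

Lemma L1_loc g : L1 g -> locL1 g.
Proof.
move=> lg a b; apply: (@L1_bdd 1) => //; last by move=> x; exact: indic_le1.
Qed.

Lemma itgE g a b : itg g a b = \int[mu]_(x in `]a, b]) g x.
Proof. exact: Int_indic. Qed.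

Lemma locL1_cc g a b : locL1 g -> mu.-integrable `[a, b] (EFin \o g).
Proof.
move=> lg; apply: (@integrableS _ _ R mu `](a - 1), b]).
- exact: measurable_itv.
- exact: measurable_itv.
- by move=> x /=; rewrite !in_itv/= => /andP[ax ->]; rewrite andbT; lra.
- apply/L1_indicP; [exact: measurable_itv|exact: lg].
Qed.

Lemma itg_cc g a b : locL1 g -> itg g a b = \int[mu]_(x in `[a, b]) g x.
Proof.
move=> lg; rewrite itgE Rintegral_itv_obnd_cbnd//.
by apply/L1_indicP; [exact: measurable_itv|exact: lg].
Qed.

Lemma itg_split g a b c : locL1 g -> a <= b -> b <= c ->
  itg g a c = itg g a b + itg g b c.
Proof.
move=> lg ab bc; rewrite /itg -IntD//; congr Int; apply/funext => x.
rewrite -mulrDl; congr (_ * _); rewrite !indic_oc.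
case: (ltP a x) => ax; case: (leP x b) => xb; case: (leP x c) => xc; rewrite ?addr0 ?add0r//=.
all: lra.
Qed.

Lemma itg0 g a b : b <= a -> itg g a b = 0.
Proof.
move=> ba; rewrite -[RHS]Int0; congr Int; apply/funext => x; rewrite indic_oc.
case: (ltP a x) => ax; case: (leP x b) => xb; rewrite ?mul0r//=; lra.
Qed.

Lemma itg_le f g a b : locL1 f -> locL1 g ->
  (forall x, a < x -> x <= b -> f x <= g x) -> itg f a b <= itg g a b.
Proof.
move=> lf lg fg; apply: Int_le => // x; rewrite indic_oc.
by case: andP => [[ax xb]|_]; rewrite ?mul1r ?mul0r ?fg.
Qed.

(** Local absolute continuity, encoded by its outcome: [F] is an indefinite integral of a locally
    integrable [f]. Nothing is said about differentiability at points. *)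
Definition AC F f := locL1 f /\ forall a b, a <= b -> F b - F a = itg f a b.

Lemma locL1D f g : locL1 f -> locL1 g -> locL1 (fun x => f x + g x).
Proof.
move=> lf lg a b; rewrite (_ : (fun _ => _) =
   (fun x => \1_(`]a, b]) x * f x + \1_(`]a, b]) x * g x)); first exact: L1D.
by apply/funext => x; rewrite mulrDr.
Qed.

Lemma locL1Z c f : locL1 f -> locL1 (fun x => c * f x).
Proof.
move=> lf a b; rewrite (_ : (fun _ => _) = (fun x => c * (\1_(`]a, b]) x * f x))).
  exact: L1Z.
by apply/funext => x; rewrite mulrCA.
Qed.

Lemma locL1_cont f : continuous f -> locL1 f.
Proof.
move=> cf a b; apply/L1_indicP; first exact: measurable_itv.
apply: (@integrableS _ _ R mu `[a, b]).
- exact: measurable_itv.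
- exact: measurable_itv.
- exact: subset_itv_oc_cc.
- apply: continuous_compact_integrable; first exact: segment_compact.
  exact: continuous_subspaceT.
Qed.

Lemma AC_cont F f : AC F f -> continuous F.
Proof.
move=> [lf Ff] x.
have := @parameterized_integral_continuous R (x - 1) (x + 1) f ltac:(lra) (locL1_cc _ _ lf).
move/continuous_within_itvP => /(_ ltac:(lra)) [+ _ _].
move=> /(_ x); rewrite in_itv/= => /(_ ltac:(lra)) cx.
have -> : F = fun y => F y - F (x - 1) + F (x - 1) by apply/funext => y; rewrite subrK.
apply: cvgD; last exact: cvg_cst.
rewrite Ff ?itg_cc//; last by lra.
apply: cvg_trans cx; apply: near_eq_cvg.
near=> y; rewrite Ff ?itg_cc//; near: y.
have := @lt_nbhsr R (x - 1) x ltac:(lra); apply: filterS => z; exact: ltW.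
Unshelve. all: by end_near. Qed.

Lemma AC_FTC F f : continuous f -> (forall x : R, is_derive x (1 : R) F (f x)) -> AC F f.
Proof.
move=> cf dF; have lf := locL1_cont cf; split => // a b.
rewrite le_eqVlt => /predU1P[->|ab]; first by rewrite subrr itg0.
rewrite itg_cc// /Rintegral (@continuous_FTC2 R f F)//.
- exact: continuous_subspaceT.
- have cF x : {for x, continuous F}.
    by apply/differentiable_continuous/derivable1_diffP; have [] := dF x.
  split.
  + by move=> x _; have [] := dF x.
  + by apply: cvg_at_right_filter; exact: cF.
  + by apply: cvg_at_left_filter; exact: cF.
- by move=> x _; rewrite derive1E; have [_ ->] := dF x.
Qed.

Lemma continuous_meas f : continuous f -> measurable_fun setT f.
Proof. exact: continuous_measurable_fun. Qed.

Lemma AC_add F f G g : AC F f -> AC G g ->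
  AC (fun x => F x + G x) (fun x => f x + g x).
Proof.
move=> [lf Ff] [lg Gg]; split; first exact: locL1D.
move=> a b ab; rewrite opprD addrACA Ff// Gg// /itg -IntD//; congr Int.
by apply/funext => x; rewrite mulrDr.
Qed.

Lemma AC_scale c F f : AC F f -> AC (fun x => c * F x) (fun x => c * f x).
Proof.
move=> [lf Ff]; split; first exact: locL1Z.
move=> a b ab; rewrite -mulrBr Ff// /itg -IntZ//; congr Int.
by apply/funext => x; rewrite mulrCA.
Qed.

Lemma AC_cst c : AC (fun=> c) (fun=> 0).
Proof.
split; first by apply: locL1_cont => x; exact: cvg_cst.
move=> a b _; rewrite subrr -[LHS]Int0; congr Int.
by apply/funext => x; rewrite mulr0.
Qed.

End integrals.
Global Opaque L1.

(** * Products of absolutely continuous functions and improper integrals *)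

Section AC_product.
Context {R : realType}.
Implicit Types (f g h F G : R -> R) (a b c : R).
Local Notation mu := (@lebesgue_measure R).

Lemma Int_point c f : L1 f -> forall g, measurable_fun setT g ->
  (forall x, x != c -> f x = g x) -> Int f = Int g.
Proof.
move=> lf g mg fg; apply: Int_ae => //; first exact: L1_meas.
exists [set c]; split; first exact: measurable_set1.
  exact: lebesgue_measure_set1.
move=> x /= xfg; apply/eqP; apply: contra_notT xfg => xc; exact: fg.
Qed.

Lemma locL1_meas g : locL1 g -> measurable_fun setT g.
Proof.
move=> lg.
have ml n : measurable_fun setT (fun x : R => \1_(`](- n%:R), n%:R]) x * g x).
  exact: L1_meas.
apply: (measurable_fun_cvg ml) => x _.
apply: cvg_near_cst; near=> n.
rewrite indic_oc (_ : _ && _ = true) ?mul1r//.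
have h : `|x| < n%:R by near: n; exact: nbhs_infty_gtr.
have := ler_norm x; have := ler_norm (- x); rewrite normrN.
by move=> h1 h2; apply/andP; split; lra.
Unshelve. all: by end_near. Qed.

Lemma continuous_bdd_itv F a b : continuous F -> exists2 M, 0 <= M &
  forall x, a <= x <= b -> `|F x| <= M.
Proof.
move=> cF; have : compact (F @` `[a, b]).
  apply: continuous_compact; first exact: continuous_subspaceT.
  exact: segment_compact.
move/compact_bounded => [M [_ HM]]; exists `|M + 1|; first by [].
move=> x xab; apply: (HM `|M + 1|).
  by rewrite (lt_le_trans _ (ler_norm _))// ltrDl.
by exists x => //=; rewrite in_itv.
Qed.

Lemma locL1M f G : locL1 f -> continuous G -> locL1 (fun x => f x * G x).
Proof.
move=> lf cG a b.
have [M M0 GM] := continuous_bdd_itv a b cG.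
rewrite (_ : (fun _ => _) =
    (fun x => (\1_(`]a, b]) x * G x) * (\1_(`]a, b]) x * f x))); last first.
  by apply/funext => x; rewrite indic_oc; case: ifP => _; ring.
apply: (@L1_bdd R M) => //.
  apply: measurable_funM; first exact: measurable_indic_oc.
  exact: continuous_meas.
move=> x; rewrite indic_oc; case: andP => [[ax xb]|_].
  by rewrite mul1r GM// xb ltW.
by rewrite mul0r normr0.
Qed.

(** Integration by parts from Fubini: [\int f (G - G a)] and [\int g (F b - F)] over []a, b]] are
    the two iterated integrals of [f x * g y] over the triangle [a < y <= x <= b]. *)
Lemma AC_mul F f G g : AC F f -> AC G g ->
  AC (fun x => F x * G x) (fun x => f x * G x + F x * g x).
Proof.
move=> ACF ACG; have cF := AC_cont ACF; have cG := AC_cont ACG.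
case: ACF => lf Ff; case: ACG => lg Gg.
have lfG := locL1M lf cG.
have lFg : locL1 (fun x => F x * g x).
  by under eq_fun do rewrite mulrC; exact: locL1M.
split; first exact: locL1D.
move=> a b ab.
pose f1 x := \1_(`]a, b]) x * f x; pose g1 x := \1_(`]a, b]) x * g x.
have lf1 : L1 f1 by exact: lf.
have lg1 : L1 g1 by exact: lg.
pose k (p : R * R) := f1 p.1 * (g1 p.2 * (if p.2 <= p.1 then 1 else 0)).
have mk : measurable_fun setT k.
  apply: measurable_funM; first by apply: measurableT_comp; [exact: L1_meas|exact: measurable_fst].
  apply: measurable_funM; first by apply: measurableT_comp; [exact: L1_meas|exact: measurable_snd].
  by apply: measurable_fun_ifT => //; apply: measurable_fun_ler.
have lk y : L1 (fun x => k (x, y)).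
  rewrite (_ : (fun _ => _) = (fun x => (g1 y * (if y <= x then 1 else 0)) * f1 x)); last first.
    by apply/funext => x; rewrite /k/= mulrC.
  apply: (@L1_bdd R `|g1 y|) => //.
    apply: measurable_funM => //; apply: measurable_fun_ifT => //.
    exact: measurable_fun_ler.
  by move=> x; rewrite normrM; case: ifP => _; rewrite ?normr1 ?normr0 ?mulr1 ?mulr0.
have [||swap l1 l2 _] := @Int_swap R k (fun y => `|g1 y| * Int (fun x => `|f1 x|)) mk lk.
- under eq_fun do rewrite mulrC; exact/L1Z/L1_norm.
- move=> y; rewrite -IntZ; last exact: L1_norm.
  apply: Int_le; [exact/L1_norm/lk|exact/L1Z/L1_norm|move=> x; rewrite /k /= !normrM mulrCA].
  rewrite ler_wpM2l// ler_piMr//; case: ifP => _; rewrite ?normr1 ?normr0//.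
have e1 : Int (fun x => f1 x * (G x - G a)) = Int (fun x => Int (fun y => k (x, y))).
  congr Int; apply/funext => x; rewrite {1}/f1 indic_oc.
  case: andP => [[ax xb]|nx]; last first.
    rewrite !mul0r -[LHS]Int0; congr Int; apply/funext => y; rewrite /k/= /f1 indic_oc.
    by case: andP => [/nx[]|_]; rewrite !mul0r.
  rewrite mul1r Gg; last exact: ltW.
  rewrite /itg -IntZ; last exact: lg.
  congr Int; apply/funext => y; rewrite /k /= /f1 /g1 !indic_oc ax xb/= mul1r; congr (_ * _).
  case: (ltP a y) => ay; case: (leP y x) => yx; rewrite /= ?mulr0 ?mul0r ?mulr1//.
  by rewrite (le_trans yx xb).
have e2 : Int (fun y => g1 y * (F b - F y)) = Int (fun y => Int (fun x => k (x, y))).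
  congr Int; apply/funext => y; rewrite {1}/g1 indic_oc.
  case: andP => [[ay yb]|ny]; last first.
    rewrite !mul0r -[LHS]Int0; congr Int; apply/funext => x; rewrite /k/= /g1 indic_oc.
    by case: andP => [/ny[]|_]; rewrite !mul0r mulr0.
  rewrite mul1r Ff// /itg -IntZ; last exact: lf.
  (* The triangle contains the diagonal, while the interval []y, b]] that expresses [F b - F y]
     omits [y]; the integrands differ at this single point. *)
  apply: (@Int_point y); [exact/L1Z/lf|by apply: L1_meas; exact: lk|].
  move=> x xy; rewrite /k /= /f1 /g1 !indic_oc ay yb/=.
  have -> : (y < x) = (y <= x) by rewrite lt_neqAle eq_sym xy.
  case: (leP y x) => yx; last by rewrite /= !(mul0r, mulr0).
  by rewrite (lt_le_trans ay yx) /=; case: ifP => _; ring.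
have lfGa : L1 (fun x => f1 x * (G x - G a)).
  rewrite (_ : (fun _ => _) = (fun x => \1_(`]a, b]) x * (f x * G x) - G a * f1 x)).
    by apply: L1B; [exact: lfG|exact: L1Z].
  by apply/funext => x; rewrite /f1; ring.
have E : itg (fun x => f x * G x + F x * g x) a b =
  Int (fun x => f1 x * (G x - G a)) + G a * Int f1 +
  (F b * Int g1 - Int (fun y => g1 y * (F b - F y))).
  rewrite -!IntZ// -IntD//; last exact: L1Z.
  have lgF : L1 (fun y => g1 y * (F b - F y)).
    rewrite (_ : (fun _ => _) = (fun x => F b * g1 x - \1_(`]a, b]) x * (F x * g x))).
      by apply: L1B; [exact: L1Z|exact: lFg].
    by apply/funext => x; rewrite /g1; ring.
  rewrite -IntB//; last exact: L1Z.
  rewrite -IntD; [|apply: L1D => //; exact: L1Z|apply: L1B => //; exact: L1Z].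
  by congr Int; apply/funext => x; rewrite /f1 /g1; ring.
rewrite E e1 e2 swap.
have -> : Int f1 = F b - F a by rewrite Ff.
have -> : Int g1 = G b - G a by rewrite Gg.
by ring.
Qed.

Lemma cvg_indic_oc (u : nat -> R) x : u n @[n --> \oo] --> +oo ->
  \1_(`](- u n), (u n)]) x @[n --> \oo] --> (1 : R).
Proof.
move=> uoo; apply: cvg_near_cst; near=> n.
have h : `|x| < u n.
  by near: n; move/cvgryPgt : uoo; apply.
rewrite indic_oc (_ : _ && _ = true)//.
have := ler_norm x; have := ler_norm (- x); rewrite normrN.
by move=> h1 h2; apply/andP; split; lra.
Unshelve. all: by end_near. Qed.

Lemma itg_cvg f : L1 f -> itg f (- n%:R) n%:R @[n --> \oo] --> Int f.
Proof.
move=> lf.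
have [] := @Int_dct R (fun n x => \1_(`](- n%:R), n%:R]) x * f x) f (fun x => `|f x|) _ _ (L1_norm lf).
- move=> n; apply: measurable_funM; [exact: measurable_indic_oc|exact: L1_meas].
- exact: L1_meas.
- apply: aeW => x; rewrite -[X in _ --> X]mul1r; apply: cvgM; last exact: cvg_cst.
  by apply: cvg_indic_oc; exact: cvgr_idn.
- move=> n; apply: aeW => x; rewrite normrM -[leRHS]mul1r ler_wpM2r//; exact: indic_le1.
- by [].
Qed.

(** Monotone convergence in the form that yields the integrability of the limit as well, from a
    common bound on the integrals. *)
Lemma Int_mct (F : nat -> R -> R) f M : (forall n, L1 (F n)) ->
  (forall n x, 0 <= F n x) -> (forall x, {homo F^~ x : m n / (m <= n)%N >-> m <= n}) ->
  (forall x, F n x @[n --> \oo] --> f x) -> (forall n, Int (F n) <= M) ->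
  L1 f /\ Int f <= M.
Proof.
move=> lF F0 Fnd Ff FM.
have mF n : measurable_fun setT (F n) by exact: L1_meas.
have mf : measurable_fun setT f by exact: (measurable_fun_cvg mF (fun x _ => Ff x)).
have f0 x : 0 <= f x.
  rewrite -(cvg_lim _ (Ff x))//; apply: limr_ge; last exact: nearW.
  by apply/cvg_ex; exists (f x).
have mc := @cvg_monotone_convergence _ _ R mu setT measurableT (fun n x => (F n x)%:E).
have {mc} : (\int[mu]_x (F n x)%:E @[n --> \oo] --> \int[mu]_x (f x)%:E)%E.
  rewrite [X in _ --> X](_ : _ = (\int[mu]_x limn (fun n => (F n x)%:E))%E); last first.
    apply: eq_integral => x _; apply/esym/cvg_lim => //.
    by apply/cvg_EFin; [exact: nearW|exact: Ff].
  apply: mc.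
  - by move=> n; apply/measurable_EFinP; exact: mF.
  - by move=> n x _; rewrite lee_fin.
  - by move=> x _ m n mn; rewrite lee_fin; exact: Fnd.
move=> mc.
have le : (\int[mu]_x (f x)%:E <= M%:E)%E.
  rewrite -(cvg_lim _ mc)//; apply: lime_le; first by apply/cvg_ex; eexists; exact: mc.
  by apply: nearW => n; rewrite -EFinInt// lee_fin.
have lf : L1 f by apply: L1_ge0 => //; exact: le_lt_trans le (ltry _).
by split => //; rewrite -lee_fin EFinInt.
Qed.

(** The integral over []-n, n]] is the increment of [F], at most [2 * c]; monotone convergence does
    the rest. *)
Lemma L1_AC F f c : AC F f -> (forall x, 0 <= f x) -> (forall x, `|F x| <= c) ->
  L1 f /\ Int f <= 2 * c.
Proof.
move=> [lf Ff] f0 Fc.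
apply: (@Int_mct (fun n x => \1_(`](- n%:R), n%:R]) x * f x)).
- by move=> n; exact: lf.
- by move=> n x; rewrite mulr_ge0// indic_oc; case: ifP.
- move=> x m n mn; rewrite ler_wpM2r// !indic_oc.
  case: ifP => [/andP[mx xm]|_]; last by case: ifP.
  have : m%:R <= n%:R :> R by rewrite ler_nat.
  by move=> mnR; rewrite (_ : _ && _ = true)//; apply/andP; split; lra.
- move=> x; rewrite -[X in _ --> X]mul1r; apply: cvgM; last exact: cvg_cst.
  by apply: cvg_indic_oc; exact: cvgr_idn.
- move=> n; rewrite -/(itg f (- n%:R) n%:R) -Ff; last first.
    by have := ler0n R n; lra.
  have := Fc n%:R; have := Fc (- n%:R); have := ler_norm (F n%:R).
  have := ler_norm (- F (- n%:R)); rewrite normrN; lra.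
Qed.

Lemma Int_AC F f l l' : AC F f -> L1 f -> F x @[x --> +oo] --> l ->
  F x @[x --> -oo] --> l' -> Int f = l - l'.
Proof.
move=> [lf Ff] l1f Fl Fl'.
have h : itg f (- n%:R) n%:R @[n --> \oo] --> l - l'.
  rewrite (_ : (fun _ => _) = fun n : nat => F n%:R - F (- n%:R)); last first.
    by apply/funext => n; rewrite Ff//; have := ler0n R n; lra.
  apply: cvgB.
    by apply: (cvg_comp _ _ _ Fl); exact: cvgr_idn.
  apply: (cvg_comp _ _ _ Fl'); apply/cvgNry.
  rewrite (_ : - _ = fun n : nat => n%:R); first exact: cvgr_idn.
  by apply/funext => n; rewrite !fctE opprK.
exact: (cvg_unique _ (itg_cvg l1f) h).
Qed.

End AC_product.

(** * Seminormed spaces *)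

(** The spaces are sets of functions inside the module of all functions, with norms that vanish on
    null functions. Hence a domain predicate and a seminorm whose laws are only required on the
    domain; outside it [nrm] is arbitrary. *)
Record seminormed (R : realType) (V : lmodType R) := Seminormed {
  dom : V -> Prop;
  nrm : V -> R;
  dom0 : dom 0;
  domD : forall x y, dom x -> dom y -> dom (x + y);
  domZ : forall c x, dom x -> dom (c *: x);
  nrmD : forall x y, dom x -> dom y -> nrm (x + y) <= nrm x + nrm y;
  nrmZ : forall c x, dom x -> nrm (c *: x) = `|c| * nrm x }.

Section seminormed_theory.
Context {R : realType} {V : lmodType R} (E : seminormed V).
Implicit Types x y : V.

Lemma domN x : dom E x -> dom E (- x).
Proof. by move=> ?; rewrite -scaleN1r; exact: domZ. Qed.

Lemma domB x y : dom E x -> dom E y -> dom E (x - y).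
Proof. by move=> ? ?; apply: domD => //; exact: domN. Qed.

Lemma dom_sum (I : Type) (r : seq I) (P : pred I) (F : I -> V) :
  (forall i, dom E (F i)) -> dom E (\sum_(i <- r | P i) F i).
Proof. by move=> h; apply: big_ind => //; [exact: dom0|exact: domD]. Qed.

Lemma nrm0 : nrm E 0 = 0.
Proof. by rewrite -(scale0r 0) nrmZ ?normr0 ?mul0r//; exact: dom0. Qed.

Lemma nrmN x : dom E x -> nrm E (- x) = nrm E x.
Proof. by move=> ?; rewrite -scaleN1r nrmZ// normrN1 mul1r. Qed.

Lemma nrmB x y : dom E x -> dom E y -> nrm E (x - y) <= nrm E x + nrm E y.
Proof. by move=> ? ?; rewrite -(nrmN (x := y))//; apply: nrmD => //; exact: domN. Qed.

Lemma nrm_ge0 x : dom E x -> 0 <= nrm E x.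
Proof.
move=> dx; have := nrmB dx dx; rewrite subrr nrm0; lra.
Qed.

Lemma nrm_distC x y : dom E x -> dom E y -> nrm E (x - y) = nrm E (y - x).
Proof. by move=> ? ?; rewrite -opprB nrmN//; exact: domB. Qed.

Lemma nrm_trans x y z : dom E x -> dom E y -> dom E z ->
  nrm E (x - z) <= nrm E (x - y) + nrm E (y - z).
Proof.
move=> ? ? ?; rewrite (_ : x - z = (x - y) + (y - z)).
  by apply: nrmD; exact: domB.
by rewrite addrA subrK.
Qed.

Lemma nrm_dist x y : dom E x -> dom E y -> `|nrm E x - nrm E y| <= nrm E (x - y).
Proof.
move=> dx dy.
have h1 : nrm E x <= nrm E (x - y) + nrm E y.
  by rewrite -[in leLHS](subrK y x); apply: nrmD => //; exact: domB.
have h2 : nrm E y <= nrm E (x - y) + nrm E x.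
  rewrite nrm_distC// -[in leLHS](subrK x y); apply: nrmD => //; exact: domB.
by rewrite ler_norml; apply/andP; split; lra.
Qed.

Lemma nrm_sum (I : Type) (r : seq I) (P : pred I) (F : I -> V) :
  (forall i, dom E (F i)) ->
  nrm E (\sum_(i <- r | P i) F i) <= \sum_(i <- r | P i) nrm E (F i).
Proof.
move=> h; elim: r => [|i r IH]; first by rewrite !big_nil nrm0.
rewrite !big_cons; case: ifP => // _.
apply: le_trans (nrmD (h i) _) _; first exact: dom_sum.
by rewrite lerD2l.
Qed.

End seminormed_theory.

(* Completeness is only needed for geometrically convergent series. *)
Definition geom_complete (R : realType) (V : lmodType R) (E : seminormed V) :=
  forall (C : R) (x : nat -> V), 0 <= C -> (forall n, dom E (x n)) ->
  (forall n, nrm E (x n) <= C * 2^-1 ^+ n) ->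
  exists2 y, dom E y & nrm E (y - \sum_(i < n) x i) @[n --> \oo] --> (0 : R).

HB.lock Definition sip_nrm {R : realType} {V : lmodType R} (b : V -> V -> R) (x : V) : R :=
  Num.sqrt (b x x).

Section semi_inner_product.
Context {R : realType} {V : lmodType R} (S : V -> Prop) (b : V -> V -> R).
Hypotheses (S0 : S 0) (SD : forall x y, S x -> S y -> S (x + y))
  (SZ : forall c x, S x -> S (c *: x))
  (bC : forall x y, S x -> S y -> b x y = b y x)
  (bD : forall x y z, S x -> S y -> S z -> b (x + y) z = b x z + b y z)
  (bZ : forall c x z, S x -> S z -> b (c *: x) z = c * b x z)
  (b_ge0 : forall x, S x -> 0 <= b x x).

Lemma cauchy_schwarz x y : S x -> S y -> b x y ^+ 2 <= b x x * b y y.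
Proof.
move=> Sx Sy.
have h (s t : R) : 0 <= s ^+ 2 * b x x + 2 * s * t * b x y + t ^+ 2 * b y y.
  have := b_ge0 (SD (SZ s Sx) (SZ t Sy)).
  rewrite bD ?bZ//; try (by repeat (first [apply: SD | apply: SZ])).
  rewrite ![b _ (_ + _)]bC ?bD ?bZ//; try (by repeat (first [apply: SD | apply: SZ])).
  rewrite (bC Sy Sx).
  by congr (_ <= _); ring.
have [bxx|bxx] := ltP 0 (b x x); last first.
  have bx0 : b x x = 0 by apply/eqP; rewrite eq_le bxx b_ge0.
  rewrite bx0 mul0r.
  have [->|B0] := eqVneq (b x y) 0; first by rewrite expr0n.
  (* The form may be degenerate. When [b x x = 0] the expression is affine in [s], and this value of
     [s] makes it equal to -1. *)
  have := h (- (b y y + 1) / (2 * b x y)) 1; rewrite bx0 mulr0 add0r expr1n mul1r mulr1.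
  rewrite (_ : 2 * _ * _ = - (b y y + 1)); last by field.
  by lra.
have := h (- b x y) (b x x) => h1.
have : 0 <= b x x * (b x x * b y y - b x y ^+ 2) by nra.
by rewrite pmulr_rge0// subr_ge0.
Qed.

Local Notation sip_nrm := (sip_nrm b).

Lemma sip_nrmE x : sip_nrm x = Num.sqrt (b x x).
Proof. by rewrite sip_nrm.unlock. Qed.

Lemma sip_nrm_ge0 x : 0 <= sip_nrm x.
Proof. by rewrite sip_nrmE sqrtr_ge0. Qed.

Lemma cauchy_schwarz_nrm x y : S x -> S y -> `|b x y| <= sip_nrm x * sip_nrm y.
Proof.
move=> Sx Sy; rewrite !sip_nrmE -sqrtrM ?b_ge0// -sqrtr_sqr.
by apply: ler_wsqrtr; exact: cauchy_schwarz.
Qed.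

Lemma sip_nrmZ c x : S x -> sip_nrm (c *: x) = `|c| * sip_nrm x.
Proof.
move=> Sx; rewrite !sip_nrmE bZ//; last exact: SZ.
rewrite bC//; last exact: SZ.
by rewrite bZ// mulrA -expr2 sqrtrM ?sqr_ge0// sqrtr_sqr.
Qed.

Lemma sip_nrmD x y : S x -> S y -> sip_nrm (x + y) <= sip_nrm x + sip_nrm y.
Proof.
move=> Sx Sy; have Sxy := SD Sx Sy.
have n0 z : 0 <= sip_nrm z by exact: sip_nrm_ge0.
rewrite -(@ler_pXn2r _ 2)// ?nnegrE ?addr_ge0//.
have sq z : S z -> sip_nrm z ^+ 2 = b z z by move=> Sz; rewrite sip_nrmE sqr_sqrtr// b_ge0.
rewrite sqrrD !sq// bD// [b x _]bC// [b y _]bC// !bD// (bC Sy Sx).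
have := cauchy_schwarz_nrm Sx Sy; have := ler_norm (b x y); lra.
Qed.

Definition sip_seminormed :=
  Seminormed S0 SD SZ sip_nrmD sip_nrmZ.

End semi_inner_product.

(** * The space of square integrable functions *)

Section L2.
Context {R : realType}.
Implicit Types (f g h : R -> R) (c : R).
Local Notation mu := (@lebesgue_measure R).

Definition L2 f := f \in Lfun mu 2%:E.

Lemma L2P f : L2 f <-> measurable_fun setT f /\ L1 (fun x => f x ^+ 2).
Proof.
split=> [f2|[mf lf]].
  split; last exact: Lfun2_integrable_sqr.
  by move: f2; rewrite /L2 inE => /andP[]; rewrite inE.
rewrite /L2 inE; apply/andP; split; rewrite inE//= /finite_norm.
rewrite (@lty_poweRy _ _ 2)//.
rewrite powR_Lnorm//.
have /integrableP[_] := lf; apply: le_lt_trans.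
rewrite le_eqVlt; apply/orP; left; apply/eqP.
by apply: eq_integral => x _ /=; rewrite powR_mulrn// normrX.
Qed.

Lemma L2_meas f : L2 f -> measurable_fun setT f.
Proof. by move=> /L2P[]. Qed.

Lemma L2_L1sq f : L2 f -> L1 (fun x => f x ^+ 2).
Proof. by move=> /L2P[]. Qed.

Lemma L2_le f g : measurable_fun setT f -> L2 g -> (forall x, `|f x| <= `|g x|) -> L2 f.
Proof.
move=> mf lg fg; apply/L2P; split => //.
apply: (L1_le _ (L2_L1sq lg)); first exact: measurable_funX.
by move=> x; rewrite normrX -(real_normK (num_real (g x))) lerXn2r ?nnegrE.
Qed.

Lemma L2_L1 f g : L2 f -> L2 g -> L1 (fun x => f x * g x).
Proof.
move=> lf lg; apply: (@L1_le _ (fun x => f x ^+ 2 + g x ^+ 2)).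
- by apply: measurable_funM; exact: L2_meas.
- by apply: L1D; exact: L2_L1sq.
- move=> x; rewrite normrM -(real_normK (num_real (g x))) -(real_normK (num_real (f x))).
  have := normr_ge0 (f x); have := normr_ge0 (g x); nra.
Qed.

Lemma L2_0 : L2 0.
Proof.
apply/L2P; split; first exact: measurable_cst.
by rewrite (_ : (fun _ => _) = fun=> 0) ?expr0n//; [exact: L1_0|apply/funext => x; rewrite expr0n].
Qed.

Lemma L2Z c f : L2 f -> L2 (c *: f).
Proof.
move=> lf; apply/L2P; split; first by apply: measurable_funM => //; exact: L2_meas.
rewrite (_ : (fun _ => _) = fun x => c ^+ 2 * f x ^+ 2); first exact/L1Z/L2_L1sq.
by apply/funext => x; rewrite -exprMn.
Qed.

Lemma L2D f g : L2 f -> L2 g -> L2 (f + g).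
Proof.
move=> lf lg; apply/L2P; split; first by apply: measurable_funD; exact: L2_meas.
rewrite (_ : (fun _ => _) = fun x => f x ^+ 2 + g x ^+ 2 + 2 * (f x * g x)).
  by apply: L1D; [apply: L1D; exact: L2_L1sq|exact/L1Z/L2_L1].
by apply/funext => x; rewrite fctE; ring.
Qed.

Lemma L2B f g : L2 f -> L2 g -> L2 (f - g).
Proof. by move=> lf lg; rewrite -scaleN1r; apply: L2D => //; exact: L2Z. Qed.

Definition ip f g := Int (fun x => f x * g x).

Lemma ipC f g : ip f g = ip g f.
Proof. by congr Int; apply/funext => x; rewrite mulrC. Qed.

Lemma ipDl f g h : L2 f -> L2 g -> L2 h -> ip (f + g) h = ip f h + ip g h.
Proof.
move=> lf lg lh; rewrite /ip -IntD; [|exact: L2_L1|exact: L2_L1].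
by congr Int; apply/funext => x; rewrite mulrDl.
Qed.

Lemma ipBl f g h : L2 f -> L2 g -> L2 h -> ip (f - g) h = ip f h - ip g h.
Proof.
move=> lf lg lh; rewrite /ip -IntB; [|exact: L2_L1|exact: L2_L1].
by congr Int; apply/funext => x; rewrite mulrBl.
Qed.

Lemma ipZl c f h : L2 f -> L2 h -> ip (c *: f) h = c * ip f h.
Proof.
move=> lf lh; rewrite /ip -IntZ; last exact: L2_L1.
by congr Int; apply/funext => x; rewrite mulrA.
Qed.

Lemma ip_ge0 f : L2 f -> 0 <= ip f f.
Proof. by move=> _; apply: Int_ge0 => x; rewrite -expr2 sqr_ge0. Qed.

Definition L2s : seminormed (R -> R) :=
  sip_seminormed L2_0 L2D L2Z (fun f g _ _ => ipC f g) ipDl ipZl ip_ge0.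

Lemma nrm2E f : nrm L2s f = Num.sqrt (ip f f).
Proof. exact: sip_nrmE. Qed.

Lemma nrm2_ge0 f : 0 <= nrm L2s f.
Proof. exact: sip_nrm_ge0. Qed.

Lemma L2s_sq f : L2 f -> nrm L2s f ^+ 2 = ip f f.
Proof. by move=> lf; rewrite nrm2E sqr_sqrtr// ip_ge0. Qed.

Lemma ip_le f g : L2 f -> L2 g -> `|ip f g| <= nrm L2s f * nrm L2s g.
Proof.
exact: (cauchy_schwarz_nrm L2D L2Z (fun f g _ _ => ipC f g) ipDl ipZl ip_ge0).
Qed.

Lemma L2_ae f g : measurable_fun setT g -> aeeq f g -> L2 f -> L2 g.
Proof.
move=> mg fg /L2P[mf lf]; apply/L2P; split => //.
apply: (L1_ae _ _ lf); first exact: measurable_funX.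
by move: fg; apply: ae_imp => x ->.
Qed.

Lemma ip_ae f f' g g' : L2 f -> L2 f' -> L2 g -> L2 g' ->
  aeeq f f' -> aeeq g g' -> ip f g = ip f' g'.
Proof.
move=> lf lf' lg lg' ff' gg'; apply: Int_ae.
- by apply: measurable_funM; exact: L2_meas.
- by apply: measurable_funM; exact: L2_meas.
- exact: aeeqM.
Qed.

Lemma nrm2_ae f f' : L2 f -> L2 f' -> aeeq f f' -> nrm L2s f = nrm L2s f'.
Proof. by move=> lf lf' ff'; rewrite !nrm2E (ip_ae lf lf' lf lf' ff' ff'). Qed.

Lemma nrm2_eq0 f : L2 f -> nrm L2s f = 0 -> aeeq f (cst 0).
Proof.
move=> lf /eqP; rewrite nrm2E sqrtr_eq0 => h.
have : Int (fun x => f x ^+ 2) = 0.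
  by apply/eqP; rewrite eq_le; apply/andP; split => //; apply: Int_ge0 => x; exact: sqr_ge0.
move/(Int_eq0 (L2_L1sq lf) (fun x => sqr_ge0 _)).
by apply: ae_imp => x /eqP; rewrite sqrf_eq0 => /eqP.
Qed.

Lemma L2_bdd c f g : measurable_fun setT f -> (forall x, `|f x| <= c) -> L2 g ->
  L2 (fun x => f x * g x).
Proof.
move=> mf fc lg; apply: (@L2_le _ (c *: g)); last 2 first.
- exact: L2Z.
- move=> x; rewrite normrM [leRHS]normrM ler_wpM2r//.
  by rewrite (le_trans (fc x)) ?ler_norm.
by apply: measurable_funM => //; exact: L2_meas.
Qed.

Lemma nrm2_le f g c : L2 f -> L2 g -> 0 <= c -> {ae mu, forall x, `|f x| <= c * `|g x|} ->
  nrm L2s f <= c * nrm L2s g.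
Proof.
move=> lf lg c0 fg.
rewrite -(ger0_norm c0) -nrmZ// !nrm2E; apply: ler_wsqrtr.
pose h x := if `|f x| <= c * `|g x| then f x else 0.
have fh : aeeq f h by move: fg; apply: ae_imp => x; rewrite /h => ->.
have mh : measurable_fun setT h.
  apply: measurable_fun_ifT; [|exact: L2_meas|exact: measurable_cst].
  apply: measurable_fun_ler; first by apply: measurableT_comp => //; exact: L2_meas.
  by apply: measurable_funM => //; apply: measurableT_comp => //; exact: L2_meas.
have lh := L2_ae mh fh lf.
rewrite (ip_ae lf lh lf lh fh fh); apply: Int_le; [exact: L2_L1|apply: L2_L1; exact: L2Z|].
move=> x; rewrite -!expr2 -(real_normK (num_real (h x))) -(real_normK (num_real ((c *: g) x))).
rewrite lerXn2r ?nnegrE// /h [leRHS]normrM (ger0_norm c0).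
by case: ifP => // _; rewrite normr0 mulr_ge0.
Qed.

(** Links the extended-real norms in the definition of [H1norm] with the inner product used
    everywhere else. *)
Lemma fine_Lnorm2 f : L2 f -> fine ('N[mu]_(2%:E)[EFin \o f])%E ^+ 2 = ip f f.
Proof.
move=> lf; have /L2P[mf l1] := lf.
have f1 : (fine ('N[mu]_(2%:E)[EFin \o f]))%:E = ('N[mu]_(2%:E)[EFin \o f])%E.
  rewrite fineK// ge0_fin_numE ?Lnorm_ge0//.
  by move: lf; rewrite /L2 inE => /andP[_]; rewrite inE.
apply: EFin_inj; rewrite EFinInt; last exact: L2_L1.
have n2 : (2 : R) != 0 by [].
have := powR_Lnorm mu (EFin \o f) n2; rewrite -f1.
rewrite poweR_EFin powR_mulrn ?fine_ge0 ?Lnorm_ge0// => ->.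
by apply: eq_integral => x _ /=; rewrite powR_mulrn// real_normK ?num_real// expr2.
Qed.

Lemma geom_sum_le (C : R) (u : nat -> R) m n : 0 <= C ->
  (forall i, u i <= C * 2^-1 ^+ i) ->
  \sum_(m <= i < n) u i <= 2 * C * 2^-1 ^+ m.
Proof.
move=> C0 uC; have [mn|nm] := leqP m n; last first.
  by rewrite big_geq ?(ltnW nm)// !mulr_ge0// exprn_ge0.
suff : \sum_(m <= i < n) u i <= 2 * C * 2^-1 ^+ m - 2 * C * 2^-1 ^+ n.
  have : 0 <= 2 * C * 2^-1 ^+ n by rewrite !mulr_ge0// exprn_ge0.
  by lra.
elim: n mn => [|n IH]; first by rewrite leqn0 => /eqP ->; rewrite big_geq// subrr.
rewrite leq_eqVlt => /predU1P[->|mn]; first by rewrite big_geq// subrr.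
rewrite big_nat_recr//= exprS; have := IH mn; have := uC n; lra.
Qed.

(* The partial sums are dominated by the square root of the integrable limit of
   the squares of the sums of absolute values. *)
Lemma L2_series (C : R) (h : nat -> R -> R) : 0 <= C -> (forall n, L2 (h n)) ->
  (forall n, nrm L2s (h n) <= C * 2^-1 ^+ n) ->
  exists f, [/\ L2 f,
    forall n, nrm L2s (f - \sum_(i < n) h i) <= 2 * C * 2^-1 ^+ n &
    {ae mu, forall x, \sum_(i < n) h i x @[n --> \oo] --> f x}].
Proof.
move=> C0 lh hC.
pose F (m : nat) (x : R) : R := \sum_(0 <= i < m) `|h i x|.
pose S (m : nat) : R -> R := \sum_(0 <= i < m) h i.
have SE m x : S m x = \sum_(0 <= i < m) h i x by rewrite /S fct_sumE.
have lS m : L2 (S m) by apply: (@dom_sum _ _ L2s).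
have labs n : L2 (fun x => `|h n x|).
  apply: (L2_le _ (lh n)); last by move=> x; rewrite normr_id.
  by apply: measurableT_comp => //; exact: L2_meas.
have FE m : F m = \sum_(0 <= i < m) (fun x => `|h i x|) by apply/funext => x; rewrite fct_sumE.
have lF m : L2 (F m) by rewrite FE; apply: (@dom_sum _ _ L2s).
have nF m : nrm L2s (F m) <= 2 * C.
  rewrite FE; apply: le_trans (@nrm_sum _ _ L2s _ _ _ _ labs) _.
  rewrite -[leRHS]mulr1 -[X in _ * _ * X](expr0 2^-1); apply: geom_sum_le => // i.
  apply: le_trans (hC i); rewrite !nrm2E /ip; apply: ler_wsqrtr.
  rewrite le_eqVlt; apply/orP; left; apply/eqP; congr Int; apply/funext => x.
  by rewrite -normrM ger0_norm// -expr2 sqr_ge0.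
have F0 m x : 0 <= F m x by exact: sumr_ge0.
have Fnd x m n : (m <= n)%N -> F m x <= F n x.
  by move=> mn; rewrite /F (big_cat_nat (leq0n m) mn)//= lerDl sumr_ge0.
have SF m x : `|S m x| <= F m x by rewrite SE; exact: ler_norm_sum.
pose E x := ereal_sup (range (fun m => (F m x ^+ 2)%:E)).
have Fsq_nd x : {homo (fun m => (F m x ^+ 2)%:E) : m n / (m <= n)%N >-> (m <= n)%E}.
  by move=> m n mn; rewrite lee_fin lerXn2r ?nnegrE//; exact: Fnd.
have FE2 x : ((F m x ^+ 2)%:E @[m --> \oo] --> E x)%E.
  exact: ereal_nondecreasing_cvgn (Fsq_nd x).
have mFsq m : measurable_fun setT (fun x => (F m x ^+ 2)%:E).
  by apply/measurable_EFinP; apply: measurable_funX; exact: L2_meas.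
have mE : measurable_fun setT E.
  by apply: (emeasurable_fun_cvg _ _ mFsq) => x _; exact: FE2.
have iE : (\int[mu]_x E x <= ((2 * C) ^+ 2)%:E)%E.
  have : (\int[mu]_x (F m x ^+ 2)%:E @[m --> \oo] --> \int[mu]_x E x)%E.
    rewrite [X in _ --> X](_ : _ = (\int[mu]_x limn (fun m => (F m x ^+ 2)%:E))%E); last first.
      by apply: eq_integral => x _; apply/esym/cvg_lim => //; exact: FE2.
    apply: (@cvg_monotone_convergence _ _ R mu setT measurableT (fun m x => (F m x ^+ 2)%:E)).
    - exact: mFsq.
    - by move=> n x _; rewrite lee_fin sqr_ge0.
    - by move=> x _; exact: Fsq_nd.
  move=> mc; rewrite -(cvg_lim _ mc)//; apply: lime_le; first by apply/cvg_ex; eexists; exact: mc.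
  apply: nearW => n; rewrite -EFinInt; last exact: L2_L1sq.
  rewrite lee_fin -[leLHS]/(ip (F n) (F n)) -L2s_sq// lerXn2r ?nnegrE//; last exact: mulr_ge0.
  exact: nrm2_ge0.
have E0 x : (0 <= E x)%E.
  by apply: le_trans (ereal_sup_ubound _); last (exists 0%N; [done|reflexivity]); rewrite lee_fin sqr_ge0.
have intE : mu.-integrable setT E.
  apply/integrableP; split => //.
  under eq_integral do rewrite gee0_abs//.
  exact: le_lt_trans iE (ltry _).
pose g := fine \o E.
have [lg _] := EFin_fine_Int intE (erefl g).
pose G := [set x | (E x < +oo)%E].
have mG : measurable G by rewrite -[G]setTI; exact: emeasurable_fun_infty_o.
have aeG : {ae mu, forall x, G x}.
  by have := integrable_ae measurableT intE; apply: ae_imp => x /(_ I); rewrite ge0_fin_numE.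
have Fg m x : G x -> F m x ^+ 2 <= g x.
  move=> Gx; rewrite -lee_fin /g /= fineK ?ge0_fin_numE//.
  by apply: ereal_sup_ubound; exists m.
(* Cutting off to the set [G] where the dominating sum is finite makes the partial sums converge at
   every point, which gives measurability of the limit. *)
pose f x := limn (fun m => \1_G x * S m x).
have G1 x : G x -> \1_G x = 1 :> R by move=> Gx; rewrite indicE mem_set.
have G0 x : ~ G x -> \1_G x = 0 :> R by move=> Gx; rewrite indicE memNset.
have Scvg x : \1_G x * S m x @[m --> \oo] --> f x.
  have [Gx|nGx] := pselect (G x); last first.
    rewrite /f; under eq_fun do rewrite G0// mul0r.
    by rewrite lim_cst//; exact: cvg_cst.
  suff : cvgn (series (fun i => h i x)).
    rewrite /f (_ : (fun m => \1_G x * S m x) = series (fun i => h i x)) //.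
    by apply/funext => m; rewrite G1// mul1r SE.
  apply: normed_cvg; apply: nondecreasing_is_cvgn; first by move=> m n; exact: Fnd.
  exists (g x + 1) => _ [m _ <-]; rewrite /series /= -/(F m x).
  change (F m x <= g x + 1).
  by have := Fg m x Gx; have := sqr_ge0 (F m x - 1); have := sqr_ge0 (F m x); nra.
have mf : measurable_fun setT f.
  apply: (@measurable_fun_cvg _ _ R setT (fun m x => \1_G x * S m x)) => [m|x _]; last exact: Scvg.
  by apply: measurable_funM; [exact: measurable_indic|exact: L2_meas].
have key n : L1 (fun x => (f x - \1_G x * S n x) ^+ 2) /\
    Int (fun x => (f x - \1_G x * S n x) ^+ 2) <= (2 * C * 2^-1 ^+ n) ^+ 2.
  have mSG m : measurable_fun setT (fun x => \1_G x * S m x).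
    by apply: measurable_funM; [exact: measurable_indic|exact: L2_meas].
  (* The majorant [4 * g] comes from [(S m - S n)^2 <= 2 (S m)^2 + 2 (S n)^2], both squares being at
     most [g] on [G]. *)
  have [|||||l1 cv] := @Int_dct R (fun m x => (\1_G x * S m x - \1_G x * S n x) ^+ 2)
     (fun x => (f x - \1_G x * S n x) ^+ 2) (fun x => 4 * g x).
  - by move=> m; apply: measurable_funX; exact: measurable_funB.
  - by apply: measurable_funX; exact: measurable_funB.
  - exact: L1Z.
  - apply: aeW => x; under eq_fun do rewrite expr2; rewrite expr2.
    by apply: cvgM; apply: cvgB; by [exact: Scvg|exact: cvg_cst].
  - move=> m; apply: aeW => x.
    have g0 : 0 <= g x by exact: fine_ge0.
    have [Gx|nGx] := pselect (G x); last by rewrite G0// !mul0r subrr expr0n normr0 mulr_ge0.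
    rewrite G1// !mul1r ger0_norm ?sqr_ge0//.
    have := Fg m x Gx; have := Fg n x Gx; have := SF m x; have := SF n x.
    rewrite !ler_norml => /andP[h1 h2] /andP[h3 h4].
    have a1 : S m x ^+ 2 <= F m x ^+ 2 by nra.
    have a2 : S n x ^+ 2 <= F n x ^+ 2 by nra.
    have := sqr_ge0 (S m x + S n x); nra.
  split => //; rewrite -(cvg_lim _ cv)//; apply: limr_le; first by apply/cvg_ex; eexists; exact: cv.
  near=> m.
  have nm : (n <= m)%N by near: m; exact: nbhs_infty_ge.
  have d12 : S m - S n = \sum_(n <= i < m) h i.
    have -> : S m = \sum_(n <= i < m) h i + S n.
      by rewrite addrC /S (big_cat_nat (leq0n n) nm).
    exact: addrK.
  have ld : L2 (S m - S n) by exact: L2B.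
  apply: (@le_trans _ _ (ip (S m - S n) (S m - S n))).
    rewrite le_eqVlt; apply/orP; left; apply/eqP; apply: Int_ae.
    - by apply: measurable_funX; exact: measurable_funB.
    - by apply: measurable_funM; exact: L2_meas.
    - by move: aeG; apply: ae_imp => x Gx; rewrite G1// !mul1r expr2.
  rewrite -L2s_sq// lerXn2r ?nnegrE//; [exact: nrm2_ge0|by rewrite !mulr_ge0// exprn_ge0|].
  rewrite d12; apply: le_trans (@nrm_sum _ _ L2s _ _ _ _ lh) _.
  exact: geom_sum_le.
have l2d n : L2 (f - S n).
  apply: (@L2_ae (fun x => f x - \1_G x * S n x)).
  - by apply: measurable_funB => //; exact: L2_meas.
  - by move: aeG; apply: ae_imp => x Gx; rewrite G1// mul1r.
  - apply/L2P; split; last exact: (key n).1.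
    apply: measurable_funB => //.
    by apply: measurable_funM; [exact: measurable_indic|exact: L2_meas].
have S_ n : S n = \sum_(i < n) h i by rewrite /S big_mkord.
exists f; split.
- by have := l2d 0%N; rewrite /S big_geq// subr0.
- move=> n; rewrite -S_.
  rewrite -(@ler_pXn2r _ 2)// ?nnegrE; [|exact: nrm2_ge0|by rewrite !mulr_ge0// exprn_ge0].
  rewrite L2s_sq//; apply: le_trans (key n).2.
  rewrite le_eqVlt; apply/orP; left; apply/eqP; apply: Int_ae.
  + by apply: measurable_funM; exact: L2_meas.
  + exact: L1_meas (key n).1.
  + by move: aeG; apply: ae_imp => x Gx; rewrite G1// mul1r expr2.
- move: aeG; apply: ae_imp => x Gx; have := Scvg x.
  by under eq_fun do rewrite G1// mul1r SE big_mkord.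
Unshelve. all: by end_near. Qed.

Lemma geom_cvg0 (C : R) (u : nat -> R) : (forall n, 0 <= u n <= C * 2^-1 ^+ n) ->
  u n @[n --> \oo] --> (0 : R).
Proof.
move=> uC.
have lim : C * 2^-1 ^+ n @[n --> \oo] --> (0 : R).
  rewrite -[X in _ --> X](mulr0 C); apply: cvgM; first exact: cvg_cst.
  by apply: cvg_expr; rewrite gtr0_norm; lra.
apply: (squeeze_cvgr _ (cvg_cst 0) lim); exact: nearW.
Qed.

Lemma L2_complete : geom_complete L2s.
Proof.
move=> C h C0 lh hC; have [f [lf fh _]] := L2_series C0 lh hC; exists f => //.
by apply: (@geom_cvg0 (2 * C)) => n; rewrite nrm2_ge0 fh.
Qed.

End L2.
Global Opaque L2.

(** * Sobolev functions on the line *)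

Section test_functions.
Context {R : realType}.
Implicit Types (f g h F G phi : R -> R) (a b c x : R).
Local Notation mu := (@lebesgue_measure R).

(** A quadratic bound on the remainder suffices for differentiability. It settles polynomials by an
    algebraic identity, and also the square of the positive part, which is not a composition of
    smooth functions. *)
Lemma is_derive_quad f x l K : (forall h : R, `|f (x + h) - f x - l * h| <= K * h ^+ 2) ->
  is_derive x (1 : R) f l.
Proof.
move=> fK.
have K0 : 0 <= K by have := le_trans (normr_ge0 _) (fK 1); rewrite expr1n mulr1.
have cv : h^-1 *: (f (h *: (1 : R) + x) - f x) @[h --> 0^'] --> l.
  apply/cvgrPdist_le => e e0; near=> h.
  have h0 : h != 0 by near: h; exact: nbhs_dnbhs_neq.
  have hn : 0 < `|h| by rewrite normr_gt0.
  have he : (K + 1) * `|h| <= e.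
    rewrite mulrC -ler_pdivlMr; last by lra.
    near: h; apply: dnbhs0_le; rewrite divr_gt0//; lra.
  rewrite -(ler_pM2r hn) -normrM.
  rewrite (_ : _ * h = - (f (x + h) - f x - l * h)); last first.
    by rewrite -[_ *: _]/(_ * _) -[h *: _]/(h * 1) mulr1 [h + x]addrC; field.
  rewrite normrN (le_trans (fK h))// -(real_normK (num_real h)) expr2 mulrA.
  rewrite ler_wpM2r//; nra.
apply: DeriveDef; first by apply/cvg_ex; exists l.
exact: cvg_lim.
Unshelve. all: by end_near. Qed.

Lemma AC_deriv F f x : AC F f -> {for x, continuous f} -> is_derive x (1 : R) F (f x).
Proof.
move=> [lf Ff] cf.
have [] := @continuous_FTC1_closed R f (x - 1) x (x + 1) ltac:(lra) (locL1_cc _ _ lf)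
  ltac:(lra) cf.
set G := fun y : R => _ => dG dGE.
have nearG : {near x, G =1 fun y => F y - F (x - 1)}.
  near=> y; rewrite Ff ?itg_cc//; near: y.
  have := @lt_nbhsr R (x - 1) x ltac:(lra); apply: filterS => z; exact: ltW.
have dF : is_derive x (1 : R) (fun y => F y - F (x - 1)) (f x).
  apply: DeriveDef; first exact: near_eq_derivable nearG dG.
  rewrite -dGE derive1E; apply/esym; exact: near_eq_derive.
have -> : F = fun y => F y - F (x - 1) + F (x - 1) by apply/funext => y; rewrite subrK.
by have := is_deriveD dF (is_derive_cst (F (x - 1)) x (1 : R)); rewrite addr0.
Unshelve. all: by end_near. Qed.

Lemma C1c_bound phi : C1c phi -> exists2 M : R, 0 < M &
  forall x, M < `|x| -> phi x = 0 /\ derive1 phi x = 0.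
Proof.
move=> [dphi cphi [K cK K0]].
have [M [_ HM]] := compact_bounded cK.
pose N := `|M| + 1.
have MN : M < N by rewrite /N (le_lt_trans (ler_norm M))// ltrDl.
have K0' x : N < `|x| -> phi x = 0.
  by move=> Nx; apply: K0 => Kx; have := HM N MN x Kx; rewrite /= leNgt Nx.
exists N; first by rewrite /N ltr_wpDl.
move=> x Nx; split; first exact: K0'.
have : {near x, phi =1 cst 0}.
  near=> y; apply: K0'; near: y.
  have := @cvgr_norm_gt _ _ _ (nbhs x) _ idfun x; apply => //; exact: cvg_id.
by move/(near_eq_derive (1 : R)); rewrite derive1E => ->; rewrite derive_cst.
Unshelve. all: by end_near. Qed.

Lemma C1c_AC phi : C1c phi -> AC phi (derive1 phi).
Proof.
move=> [dphi cphi _]; apply: AC_FTC => // x.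
by apply: DeriveDef => //; rewrite derive1E.
Qed.

Lemma C1c_cont phi : C1c phi -> continuous phi.
Proof. by move=> /C1c_AC/AC_cont. Qed.

(** The margin 1 is there because the interval is open on the left while [f] may be nonzero at
    [- M]. *)
Lemma indic_supp M f x : 0 < M -> (forall x, M < `|x| -> f x = 0) ->
  \1_(`](- (M + 1)), (M + 1)]) x * f x = f x.
Proof.
move=> M0 fM; rewrite indic_oc; case: andP => [_|h]; first by rewrite mul1r.
rewrite mul0r fM// ltNge; apply/negP => xM; apply: h.
have := ler_norm x; have := ler_norm (- x); rewrite normrN => h1 h2; split; lra.
Qed.

Lemma L1_supp M f : 0 < M -> (forall x, M < `|x| -> f x = 0) -> locL1 f -> L1 f.
Proof.
move=> M0 fM lf; have := lf (- (M + 1)) (M + 1); congr L1; apply/funext => x.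
exact: indic_supp.
Qed.

Lemma Int_supp M f : 0 < M -> (forall x, M < `|x| -> f x = 0) ->
  Int f = itg f (- (M + 1)) (M + 1).
Proof. by move=> M0 fM; congr Int; apply/funext => x; rewrite indic_supp. Qed.

Lemma AC_by_parts F f phi : AC F f -> C1c phi ->
  [/\ L1 (fun x => F x * derive1 phi x), L1 (fun x => f x * phi x) &
    Int (fun x => F x * derive1 phi x) = - Int (fun x => f x * phi x)].
Proof.
move=> ACF cphi; have [M M0 phiM] := C1c_bound cphi.
have ACp := C1c_AC cphi.
have [lFp Fp] := AC_mul ACF ACp.
have l1 : locL1 (fun x => f x * phi x) by apply: locL1M; [exact: ACF.1|exact: C1c_cont].
have l2 : locL1 (fun x => F x * derive1 phi x).
  apply: locL1_cont => x; apply: cvgM; first exact: (AC_cont ACF).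
  by case: cphi => _ c _; exact: c.
have s1 x : M < `|x| -> f x * phi x = 0 by move=> /phiM[-> _]; rewrite mulr0.
have s2 x : M < `|x| -> F x * derive1 phi x = 0 by move=> /phiM[_ ->]; rewrite mulr0.
have L1a := L1_supp M0 s1 l1; have L1b := L1_supp M0 s2 l2.
split => //; apply/eqP; rewrite -subr_eq0 opprK addrC -IntD// (@Int_supp M)//; last first.
  by move=> x xM; rewrite s1// s2// addr0.
rewrite -Fp; last by lra.
have hM : M < `|M + 1| by rewrite gtr0_norm; lra.
have hM' : M < `|- (M + 1)| by rewrite normrN.
by rewrite (phiM _ hM).1 (phiM _ hM').1 !mulr0 subrr.
Qed.

(** The squared positive part of a parabola: supported in the closed interval of radius [r] around
    [x0], and exactly as smooth as the test functions [C1c] require. *)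
Definition bump x0 r x : R := Num.max 0 (r ^+ 2 - (x - x0) ^+ 2) ^+ 2.

Lemma is_derive_bump x0 r x : is_derive x (1 : R) (bump x0 r)
  (2 * Num.max 0 (r ^+ 2 - (x - x0) ^+ 2) * (- 2 * (x - x0))).
Proof.
have dm (t : R) : is_derive t (1 : R) (fun t => Num.max 0 t ^+ 2) (2 * Num.max 0 t).
  apply: (@is_derive_quad _ _ _ 1) => h.
  rewrite mul1r ler_norml; case: (leP 0 t) => t0; case: (leP 0 (t + h)) => th; apply/andP; split; nra.
have dp : is_derive x (1 : R) (fun x => r ^+ 2 - (x - x0) ^+ 2) (- 2 * (x - x0)).
  apply: (@is_derive_quad _ _ _ 1) => h.
  rewrite (_ : _ - _ - _ = - h ^+ 2); last by ring.
  by rewrite normrN ger0_norm ?sqr_ge0// mul1r.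
exact: (@is_derive1_comp R (fun t => Num.max 0 t ^+ 2) (fun x => r ^+ 2 - (x - x0) ^+ 2)
  x _ _ (dm (r ^+ 2 - (x - x0) ^+ 2)) dp).
Qed.

Lemma bump_C1c x0 r : C1c (bump x0 r).
Proof.
split.
- by move=> x; have [] := is_derive_bump x0 r x.
- have -> : derive1 (bump x0 r) = fun x =>
     2 * Num.max 0 (r ^+ 2 - (x - x0) ^+ 2) * (- 2 * (x - x0)).
    by apply/funext => x; rewrite derive1E; have [_ ->] := is_derive_bump x0 r x.
  have cp : continuous (fun x => r ^+ 2 - (x - x0) ^+ 2 : R).
    move=> x; apply: cvgB; first exact: cvg_cst.
    by apply: cvgM; apply: cvgB; by [exact: cvg_id|exact: cvg_cst].
  move=> x; apply: cvgM; last first.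
    by apply: cvgM; [exact: cvg_cst|apply: cvgB; by [exact: cvg_id|exact: cvg_cst]].
  apply: cvgM; first exact: cvg_cst.
  exact: (@continuous_max _ _ (cst 0) (fun x => r ^+ 2 - (x - x0) ^+ 2) x (cvg_cst _) (cp x)).
- exists `[x0 - `|r|, x0 + `|r|]%classic; first exact: segment_compact.
  move=> x /= /negP; rewrite in_itv /= negb_and -!ltNge => h.
  rewrite /bump (_ : Num.max _ _ = 0) ?expr0n//.
  apply/max_idPl; rewrite subr_le0 -(real_normK (num_real r)) -(real_normK (num_real (x - x0))).
  rewrite lerXn2r ?nnegrE//.
  have := ler_norm (x - x0); have := ler_norm (- (x - x0)); rewrite normrN.
  by case/orP: h; lra.
Qed.

Lemma bump_ge0 x0 r x : 0 <= bump x0 r x.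
Proof. exact: sqr_ge0. Qed.

Lemma bump_out x0 r x : 0 < r -> r <= `|x - x0| -> bump x0 r x = 0.
Proof.
move=> r0 rx; rewrite /bump (_ : Num.max _ _ = 0) ?expr0n//.
by apply/max_idPl; rewrite subr_le0 -(real_normK (num_real (x - x0))) lerXn2r ?nnegrE// ltW.
Qed.

Lemma bump_le x0 r x : bump x0 r x <= r ^+ 4.
Proof.
rewrite (_ : r ^+ 4 = (r ^+ 2) ^+ 2); last by rewrite -exprM.
rewrite lerXn2r ?nnegrE ?sqr_ge0// ?le_max ?lexx// ge_max sqr_ge0/=.
by rewrite lerBlDr lerDl sqr_ge0.
Qed.

Lemma C1c_L1 phi : C1c phi -> L1 phi.
Proof.
move=> cphi; have [M M0 phiM] := C1c_bound cphi.
apply: (L1_supp M0) => [x /phiM[]//|].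
by apply: locL1_cont; exact: C1c_cont.
Qed.

Lemma itg_cst c a b : a <= b -> itg (fun=> c) a b = c * (b - a).
Proof.
move=> ab; have [_ h] : AC (fun x => c * x) (fun=> c).
  apply: AC_FTC => x; first exact: cvg_cst.
  by apply: (@is_derive_quad _ _ _ 0) => h; rewrite (_ : _ - _ = 0) ?normr0 ?mul0r//; ring.
by rewrite -h// mulrBr.
Qed.

(** Within distance [r / 2] of the centre, an interval of length [r], the bump is at least
    [(3 / 4 * r^2)^2 = 9 / 16 * r^4]. *)
Lemma bump_int x0 r : 0 < r -> L1 (bump x0 r) /\ 9 / 16 * r ^+ 5 <= Int (bump x0 r).
Proof.
move=> r0; have l1 := C1c_L1 (bump_C1c x0 r); split => //.
have -> : 9 / 16 * r ^+ 5 = itg (fun=> 9 / 16 * r ^+ 4) (x0 - r / 2) (x0 + r / 2).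
  rewrite itg_cst; last by lra.
  by field.
apply: Int_le => //; first by apply: locL1_cont => x; exact: cvg_cst.
move=> x; rewrite indic_oc; case: andP => [[h1 h2]|_]; last by rewrite mul0r bump_ge0.
have h : (x - x0) ^+ 2 <= (r / 2) ^+ 2.
  by have : 0 <= (x - (x0 - r / 2)) * ((x0 + r / 2) - x) by [apply: mulr_ge0; lra|]; nra.
rewrite mul1r /bump; apply: (@le_trans _ _ ((3 / 4 * r ^+ 2) ^+ 2)).
  by rewrite le_eqVlt; apply/orP; left; apply/eqP; field.
have := sqr_ge0 r => r2.
by rewrite lerXn2r ?nnegrE// ?le_max ?lexx//; [lra|apply/orP; right; lra].
Qed.

Lemma locL1_locally g : locL1 g -> locally_integrable setT g.
Proof.
move=> lg; split; [exact: locL1_meas|exact: openT|].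
move=> K _ cK; have [M [_ HM]] := compact_bounded cK.
pose N := `|M| + 1.
have MN : M < N by rewrite /N (le_lt_trans (ler_norm M))// ltrDl.
pose J := `](- (N + 1)), (N + 1)]%classic.
have h : K `<=` J.
  move=> x Kx; have := HM N MN x Kx; rewrite /J /= in_itv/= => xN.
  have := ler_norm x; have := ler_norm (- x); rewrite normrN => h1 h2.
  by apply/andP; split; lra.
have mg : measurable_fun setT (fun x => `|g x|%:E).
  by apply/measurable_EFinP; apply: measurableT_comp => //; exact: locL1_meas.
apply: (@le_lt_trans _ _ (\int[mu]_(x in J) `|g x|%:E)%E).
  apply: ge0_subset_integral => //=.
  - exact: compact_measurable.
  - exact: measurable_itv.
  - exact: measurable_funS mg.
have /(L1_indicP _ (measurable_itv _)) := lg (- (N + 1)) (N + 1).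
by move=> /integrableP[].
Qed.

Lemma L1_mulC1c k phi : locL1 k -> C1c phi -> L1 (fun x => k x * phi x).
Proof.
move=> lk cphi; have [M M0 phiM] := C1c_bound cphi.
apply: (L1_supp M0) => [x /phiM[-> _]|]; first by rewrite mulr0.
by apply: locL1M => //; exact: C1c_cont.
Qed.

(* At a Lebesgue point, test against the bumps shrinking to it. *)
Lemma du_bois_reymond k : locL1 k -> (forall phi, C1c phi -> Int (fun x => k x * phi x) = 0) ->
  aeeq k (cst 0).
Proof.
move=> lk k0.
have := lebesgue_differentiation (locL1_locally lk); apply: ae_imp => x lx.
apply/eqP; rewrite -normr_le0; apply/ler_addgt0Pr => e e0; rewrite add0r.
have mk := locL1_meas lk.
(* The mean of [|k - k x|] over a ball of measure [2 r] is below [e / 4], so its integral [J] is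
   below [e / 2 * r]. Against the lower bound [9 / 16 * r^5] for the bump this leaves
   [|k x| <= 8 / 9 * e]. *)
have [r [r0 dr]] : exists r, 0 < r /\ (davg k x r < (e / 4)%:E)%E.
  have e4 : 0 < e / 4 by lra.
  move/fine_cvgP : lx => [fin lx].
  have /cvgrPdist_lt/(_ _ e4) near1 := lx.
  have [r [rf [re r0]]] : exists r : R, davg k x r \is a fin_num /\
      `|0 - (fine \o davg k x) r| < e / 4 /\ 0 < r.
    have r1 : \forall r \near (0 : R)^'+, 0 < r by exact: nbhs_right_gt.
    near (0 : R)^'+ => r; exists r.
    by split; [|split]; near: r; [exact: fin|exact: near1|exact: r1].
  exists r; split => //; rewrite -(fineK rf) lte_fin.
  by move: re; rewrite sub0r normrN; apply: le_lt_trans; exact: ler_norm.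
have mb : measurable (ball x r) by exact: measurable_ball.
pose J := Int (fun y => \1_(ball x r) y * `|k y - k x|).
have lJ : L1 (fun y => \1_(ball x r) y * `|k y - k x|).
  have lk' : locL1 (fun y => k y - k x).
    apply: locL1D => //; apply: locL1_cont => y; exact: cvg_cst.
  apply/(L1_indicP _ mb).
  apply: (@integrableS _ _ R mu `](x - r), (x + r)]) => //.
  - by rewrite ball_itv; exact: subset_itv_oo_oc.
  - exact: (integrable_norm ((L1_indicP _ (measurable_itv _)).1 (lk' (x - r) (x + r)))).
have dJ : davg k x r = ((r *+ 2)^-1 * J)%:E.
  rewrite /davg /iavg lebesgue_measure_ball ?ltW// EFinM inver; case: eqP => [h|_].
    by exfalso; lra.
  congr (_ * _)%E; rewrite /J EFinInt// integral_mkcond.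
  apply: eq_integral => y _; rewrite patchE indicE; case: ifP => _; last by rewrite mul0r.
  by rewrite mul1r.
move: dr; rewrite dJ lte_fin => dr.
have J0 : 0 <= J by apply: Int_ge0 => y; rewrite mulr_ge0// indicE; case: (_ \in _).
have Jr : J < e / 2 * r.
  move: dr; rewrite mulrC ltr_pdivrMr; last by lra.
  by lra.
have [lb bI] := bump_int x r0.
have l1 := L1_mulC1c lk (bump_C1c x r).
have l2 : L1 (fun y => k x * bump x r y) by exact: L1Z.
(* The integral of [k] against the bump vanishes, so [k x] may be replaced by [k x - k y] under the
   integral. *)
have : `|k x| * Int (bump x r) <= r ^+ 4 * J.
  rewrite -(ger0_norm (Int_ge0 (bump_ge0 x r))) -normrM -IntZ//.
  rewrite -[X in `|X|]subr0 -(k0 _ (bump_C1c x r)) -IntB// /J -IntZ//.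
  apply: le_trans (Int_norm _) _; first exact: L1B.
  apply: Int_le; [exact/L1_norm/L1B|exact: L1Z|move=> y].
  rewrite -mulrBl normrM (ger0_norm (bump_ge0 _ _ _)) indicE.
  have [yb|nyb] := pselect (ball x r y).
    by rewrite mem_set// mul1r mulrC distrC ler_wpM2r// bump_le.
  rewrite memNset// mul0r mulr0 bump_out ?mulr0// distrC leNgt.
  exact/negP.
have r4 : 0 < r ^+ 4 by rewrite exprn_gt0.
have h1 : `|k x| * (9 / 16 * r ^+ 5) <= `|k x| * Int (bump x r) by rewrite ler_wpM2l.
have h2 : r ^+ 4 * J <= r ^+ 4 * (e / 2 * r) by rewrite ler_wpM2l// ltW.
move=> h3; have := le_trans h1 (le_trans h3 h2).
have -> : `|k x| * (9 / 16 * r ^+ 5) = r ^+ 4 * ((9 / 16 * `|k x|) * r) by field.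
by rewrite ler_pM2l// ler_pM2r//; lra.
Unshelve. all: by end_near. Qed.

(** Since [itg] is 0 on reversed intervals, one of the two terms vanishes: this is the oriented
    integral from 0. *)
Definition prim g x := itg g 0 x - itg g x 0.

Lemma AC_prim g : locL1 g -> AC (prim g) g.
Proof.
move=> lg; split => // a b ab; rewrite /prim.
case: (leP 0 a) => a0.
  rewrite (itg0 g a0) (itg0 g (le_trans a0 ab)) (itg_split lg a0 ab); ring.
case: (leP b 0) => b0.
  rewrite (itg0 g b0) (itg0 g (ltW a0)) (itg_split lg ab b0); ring.
by rewrite (itg0 g (ltW a0)) (itg0 g (ltW b0)) (itg_split lg (ltW a0) (ltW b0)); ring.
Qed.

(** A zero integral is what makes the primitive vanish to the right of the support as well as to the
    left. *)
Lemma C1c_prim q : continuous q -> (exists2 M : R, 0 < M & forall x, M < `|x| -> q x = 0) ->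
  Int q = 0 -> exists2 phi, C1c phi & derive1 phi = q.
Proof.
move=> cq [M M0 qM] q0.
have lq := locL1_cont cq.
pose phi x := prim q x - prim q (- (M + 1)).
have ACp : AC phi q.
  have := AC_add (AC_prim lq) (AC_cst (- prim q (- (M + 1)))).
  by congr AC; apply/funext => x; rewrite addr0.
have dphi x : is_derive x (1 : R) phi (q x) by exact: AC_deriv ACp (cq x).
have dE : derive1 phi = q by apply/funext => x; rewrite derive1E; have [_ ->] := dphi x.
exists phi => //; split.
- by move=> x; have [] := dphi x.
- by rewrite dE.
- exists `[- (M + 1), M + 1]%classic; first exact: segment_compact.
  move=> x /= /negP; rewrite in_itv /= negb_and -!ltNge => h.
  have z : phi (- (M + 1)) = 0 by rewrite /phi subrr.
  have qx y : M < `|y| -> q y = 0 by exact: qM.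
  case/orP: h => h.
    have e : phi (- (M + 1)) - phi x = itg q x (- (M + 1)) by apply: ACp.2; lra.
    have : itg q x (- (M + 1)) = 0.
      rewrite -[RHS]Int0; congr Int; apply/funext => y; rewrite indic_oc.
      case: andP => [[_ y2]|_]; last by rewrite mul0r.
      by rewrite qx ?mulr0// ltr_normr; apply/orP; right; lra.
    by rewrite -e z sub0r => /eqP; rewrite oppr_eq0 => /eqP.
  have e : phi x - phi (- (M + 1)) = itg q (- (M + 1)) x by apply: ACp.2; lra.
  move: e; rewrite z subr0 => ->.
  rewrite (@itg_split _ q _ (M + 1)) ?(ltW h)//; last by lra.
  rewrite -(Int_supp M0)// q0 add0r -[RHS]Int0; congr Int; apply/funext => y; rewrite indic_oc.
  case: andP => [[y1 _]|_]; last by rewrite mul0r.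
  by rewrite qx ?mulr0// ltr_normr; apply/orP; left; lra.
Qed.

(** Any test function becomes the derivative of a test function after subtracting the multiple of a
    fixed bump that cancels its integral. The constant is the mean of [h] weighted by that bump. *)
Lemma const_of_derive0 h : locL1 h ->
  (forall phi, C1c phi -> Int (fun x => h x * derive1 phi x) = 0) ->
  exists c, aeeq h (cst c).
Proof.
move=> lh h0.
have r1 : (0 : R) < 1 by [].
pose b := bump 0 1; have cb : C1c b := bump_C1c 0 1.
have [lb Ib] := bump_int 0 r1.
have Ib0 : Int b != 0 by rewrite gt_eqF//; move: Ib; rewrite expr1n; apply: lt_le_trans; lra.
pose c := Int (fun x => h x * b x) / Int b.
exists c.
suff : aeeq (fun x => h x - c) (cst 0) by apply: ae_imp => x /eqP; rewrite subr_eq0 => /eqP.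
apply: du_bois_reymond.
  by apply: locL1D => //; apply: locL1_cont => x; exact: cvg_cst.
move=> psi cpsi.
pose q x := psi x - (Int psi / Int b) * b x.
have lpsi := C1c_L1 cpsi.
have [phi cphi dphi] : exists2 phi, C1c phi & derive1 phi = q.
  apply: C1c_prim.
  - move=> x; apply: cvgB; first exact: C1c_cont.
    by apply: cvgM; [exact: cvg_cst|exact: C1c_cont].
  - have [M M0 HM] := C1c_bound cpsi; have [N N0 HN] := C1c_bound cb.
    exists (M + N); first by lra.
    by move=> x hx; rewrite /q (HM x _).1 ?(HN x _).1 ?mulr0 ?subr0//; lra.
  - by rewrite IntB ?IntZ//; [rewrite divfK// subrr|exact: L1Z].
have := h0 _ cphi; rewrite dphi.
have l1 := L1_mulC1c lh cpsi; have l2 := L1_mulC1c lh cb.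
rewrite (_ : (fun x => h x * q x) =
   fun x => h x * psi x - (Int psi / Int b) * (h x * b x)); last first.
  by apply/funext => x; rewrite /q; ring.
rewrite IntB ?IntZ//; last exact: L1Z.
rewrite (_ : (fun x => (h x - c) * psi x) = fun x => h x * psi x - c * psi x); last first.
  by apply/funext => x; ring.
rewrite IntB ?IntZ//; last exact: L1Z.
by rewrite /c => <-; rewrite [in LHS](mulrAC (Int (fun x => h x * b x))) -[in RHS]mulrA [in RHS](mulrC _ (Int (fun x => h x * b x))); congr (_ - _); ring.
Qed.

End test_functions.

(** * Absolutely continuous representatives, products and completeness in [H^1] *)

Section sobolev.
Context {R : realType}.
Implicit Types (f g h F G phi : R -> R) (a b c x : R).
Local Notation mu := (@lebesgue_measure R).
Local Notation n2 := (nrm L2s).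
Local Notation D := weak_derivative.

Lemma L2_indic a b : L2 (\1_(`]a, b]) : R -> R).
Proof.
apply/L2P; split; first exact: measurable_indic_oc.
have /(_ a b) : locL1 (fun=> 1 : R) by apply: locL1_cont => x; exact: cvg_cst.
congr L1; apply/funext => x; rewrite mulr1 indic_oc; case: ifP => _; by rewrite ?expr1n ?expr0n.
Qed.

Lemma L2_loc f : L2 f -> locL1 f.
Proof. by move=> lf a b; apply: L2_L1 => //; exact: L2_indic. Qed.

Lemma C1c_L2 phi : C1c phi -> L2 phi.
Proof.
move=> cphi; apply/L2P; split; first by apply: continuous_meas; exact: C1c_cont.
have := L1_mulC1c (locL1_cont (C1c_cont cphi)) cphi; congr L1.
Qed.

Lemma C1c_L2' phi : C1c phi -> L2 (derive1 phi).
Proof.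
move=> cphi; have [M M0 phiM] := C1c_bound cphi.
have cd : continuous (derive1 phi) by case: cphi.
apply/L2P; split; first exact: continuous_meas.
apply: (L1_supp M0) => [x /phiM[_ ->]|]; first by rewrite expr0n.
by apply: locL1_cont => x; under eq_fun do rewrite expr2; apply: cvgM; exact: cd.
Qed.

Lemma weak_derivativesP f g : weak_derivatives f g <->
  L2 g /\ forall phi, C1c phi -> ip f (derive1 phi) = - ip g phi.
Proof.
by split=> -[lg h]; split => // phi /h; rewrite /ip !IntE.
Qed.

Opaque weak_derivative.

(** [f] is only a measurable representative; pointwise calculus takes place on the absolutely
    continuous [F] of the same class, with a square integrable density [g]. *)
Definition H1rep f F g := [/\ L2 f, aeeq f F, AC F g & L2 g].

Lemma H1rep_wd f F g : H1rep f F g -> weak_derivatives f g.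
Proof.
case=> lf fF ACF lg; apply/weak_derivativesP; split => // phi cphi.
have [l1 l2 e] := AC_by_parts ACF cphi.
rewrite /ip -e; apply: Int_ae.
- by apply: measurable_funM; apply: L2_meas => //; exact: C1c_L2'.
- exact: L1_meas.
- by apply: aeeqM => //; exact: aeeq_refl.
Qed.

(** The difference of [f] and a primitive of its weak derivative has zero weak derivative, so it is
    almost everywhere constant. *)
Lemma wd_H1rep f g : L2 f -> weak_derivatives f g -> exists F, H1rep f F g.
Proof.
move=> lf /weak_derivativesP[lg wd].
have llg := L2_loc lg; have llf := L2_loc lf.
have ACp := AC_prim llg.
have cp := AC_cont ACp.
have lh : locL1 (fun x => f x + (-1) * prim g x).
  by apply: locL1D => //; apply: locL1Z; exact: locL1_cont.
have [phi cphi|c hc] := const_of_derive0 lh.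
  have [l1 l2 e] := AC_by_parts ACp cphi.
  have l3 : L1 (fun x => f x * derive1 phi x) by apply: L2_L1 => //; exact: C1c_L2'.
  rewrite (_ : (fun _ => _) = fun x => f x * derive1 phi x - prim g x * derive1 phi x).
    by rewrite IntB// e opprK -[X in X + _]/(ip f _) wd// addNr.
  by apply/funext => x; ring.
exists (fun x => prim g x + c); split => //.
- by move: hc; apply: ae_imp => x /= hx; rewrite -hx; ring.
- by have := AC_add ACp (AC_cst c); congr AC; apply/funext => x; rewrite addr0.
Qed.

Lemma wd_unique f g g' : weak_derivatives f g -> weak_derivatives f g' -> aeeq g g'.
Proof.
move=> /weak_derivativesP[lg wg] /weak_derivativesP[lg' wg'].
suff : aeeq (fun x => g x - g' x) (cst 0).
  by apply: ae_imp => x /eqP; rewrite subr_eq0 => /eqP.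
apply: du_bois_reymond; first by apply: (@L2_loc (g - g')); exact: L2B.
move=> phi cphi; have lp := C1c_L2 cphi.
rewrite (_ : (fun _ => _) = fun x => g x * phi x - g' x * phi x).
  rewrite IntB; [|exact: L2_L1|exact: L2_L1].
  rewrite -[Int (fun x => g x * _)]/(ip g phi) -[Int (fun x => g' x * _)]/(ip g' phi).
  by apply/eqP; rewrite subr_eq0 -eqr_opp -wg// -wg'.
by apply/funext => x; rewrite mulrBl.
Qed.

Lemma H1_L2 f : H1 f -> L2 f.
Proof. by case. Qed.

Lemma H1_D f : H1 f -> weak_derivatives f (D f).
Proof. by case=> _ [g wg]; exact: (xgetI _ wg). Qed.

Lemma H1_DL2 f : H1 f -> L2 (D f).
Proof. by move=> /H1_D/weak_derivativesP[]. Qed.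

Lemma H1_rep f : H1 f -> exists F, H1rep f F (D f).
Proof. by move=> hf; apply: wd_H1rep; [exact: H1_L2|exact: H1_D]. Qed.

Lemma rep_H1 f F g : H1rep f F g -> H1 f /\ aeeq (D f) g.
Proof.
move=> r; have wg := H1rep_wd r.
have hf : H1 f by split; [case: r|exists g].
by split => //; apply: wd_unique wg; exact: H1_D.
Qed.

Opaque H1.

Lemma D_ae f g : H1 f -> H1 g -> aeeq f g -> aeeq (D f) (D g).
Proof.
move=> hf hg fg; have [F [lf fF ACF lD]] := H1_rep hf.
apply: aeeq_sym; apply: (proj2 (@rep_H1 g F (D f) _)); split => //.
  exact: H1_L2.
exact: aeeq_trans (aeeq_sym fg) fF.
Qed.

Lemma H1repD f F g f' F' g' : H1rep f F g -> H1rep f' F' g' ->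
  H1rep (f + f') (fun x => F x + F' x) (g + g').
Proof.
move=> [l1 e1 A1 k1] [l2 e2 A2 k2]; split; [exact: L2D|exact: aeeqD| |exact: L2D].
exact: AC_add.
Qed.

Lemma H1repZ c f F g : H1rep f F g -> H1rep (c *: f) (fun x => c * F x) (c *: g).
Proof.
move=> [l1 e1 A1 k1]; split; [exact: L2Z|exact: aeeqZ|exact: AC_scale|exact: L2Z].
Qed.

Lemma H1_0 : H1 (0 : R -> R).
Proof.
apply: (proj1 (@rep_H1 _ (fun=> 0) 0 _)); split; [exact: L2_0|exact: aeeq_refl| |exact: L2_0].
exact: AC_cst.
Qed.

Lemma H1_add f g : H1 f -> H1 g -> H1 (f + g) /\ aeeq (D (f + g)) (D f + D g).
Proof.
move=> /H1_rep[F rF] /H1_rep[G rG]; exact: rep_H1 (H1repD rF rG).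
Qed.

Lemma H1_scale c f : H1 f -> H1 (c *: f) /\ aeeq (D (c *: f)) (c *: D f).
Proof. by move=> /H1_rep[F rF]; exact: rep_H1 (H1repZ c rF). Qed.

Lemma H1D f g : H1 f -> H1 g -> H1 (f + g).
Proof. by move=> hf hg; case: (H1_add hf hg). Qed.

Lemma H1Z c f : H1 f -> H1 (c *: f).
Proof. by move=> hf; case: (H1_scale c hf). Qed.

Lemma H1B f g : H1 f -> H1 g -> H1 (f - g).
Proof. by move=> hf hg; rewrite -scaleN1r; apply: H1D => //; exact: H1Z. Qed.

Definition h1ip f g := ip f g + ip (D f) (D g).

Lemma h1ipC f g : H1 f -> H1 g -> h1ip f g = h1ip g f.
Proof. by move=> _ _; rewrite /h1ip ipC [ip (D f) _]ipC. Qed.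

Lemma h1ipDl f g h : H1 f -> H1 g -> H1 h -> h1ip (f + g) h = h1ip f h + h1ip g h.
Proof.
move=> hf hg hh; have [hfg e] := H1_add hf hg.
have [lf lg lh] := And3 (H1_L2 hf) (H1_L2 hg) (H1_L2 hh).
have [kf kg kh] := And3 (H1_DL2 hf) (H1_DL2 hg) (H1_DL2 hh).
rewrite /h1ip ipDl// (ip_ae (H1_DL2 hfg) (L2D kf kg) kh kh e (aeeq_refl _)) ipDl//.
by rewrite addrACA.
Qed.

Lemma h1ipZl c f h : H1 f -> H1 h -> h1ip (c *: f) h = c * h1ip f h.
Proof.
move=> hf hh; have [hcf e] := H1_scale c hf.
have [lf lh] := conj (H1_L2 hf) (H1_L2 hh).
have [kf kh] := conj (H1_DL2 hf) (H1_DL2 hh).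
by rewrite /h1ip ipZl// (ip_ae (H1_DL2 hcf) (L2Z c kf) kh kh e (aeeq_refl _)) ipZl// mulrDr.
Qed.

Lemma h1ip_ge0 f : H1 f -> 0 <= h1ip f f.
Proof. by move=> hf; rewrite addr_ge0// ip_ge0//; [exact: H1_L2|exact: H1_DL2]. Qed.

Definition H1s : seminormed (R -> R) :=
  sip_seminormed H1_0 H1D H1Z h1ipC h1ipDl h1ipZl h1ip_ge0.

Local Notation nH := (nrm H1s).

Lemma nHE f : nH f = Num.sqrt (h1ip f f).
Proof. exact: sip_nrmE. Qed.

Lemma H1normE f : H1 f -> H1norm f = nH f.
Proof.
move=> hf; rewrite nHE /H1norm !fine_Lnorm2//; [exact: H1_DL2|exact: H1_L2].
Qed.

Lemma nH_ge0 f : 0 <= nH f.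
Proof. by rewrite nHE sqrtr_ge0. Qed.

Lemma nH_sq f : H1 f -> nH f ^+ 2 = n2 f ^+ 2 + n2 (D f) ^+ 2.
Proof.
move=> hf; rewrite nHE sqr_sqrtr; last exact: h1ip_ge0.
by rewrite !L2s_sq//; [exact: H1_DL2|exact: H1_L2].
Qed.

Lemma n2_nH f : H1 f -> n2 f <= nH f.
Proof.
move=> hf; rewrite -(@ler_pXn2r _ 2)// ?nnegrE ?nrm2_ge0 ?nH_ge0// nH_sq//.
by rewrite lerDl sqr_ge0.
Qed.

Lemma n2D_nH f : H1 f -> n2 (D f) <= nH f.
Proof.
move=> hf; rewrite -(@ler_pXn2r _ 2)// ?nnegrE ?nrm2_ge0 ?nH_ge0// nH_sq//.
by rewrite lerDr sqr_ge0.
Qed.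

Lemma nH_le f : H1 f -> nH f <= n2 f + n2 (D f).
Proof.
move=> hf; have h1 := nrm2_ge0 f; have h2 := nrm2_ge0 (D f).
rewrite -(@ler_pXn2r _ 2)// ?nnegrE ?addr_ge0 ?nH_ge0// nH_sq//.
by nra.
Qed.

Lemma nH_ae f g : H1 f -> H1 g -> aeeq f g -> nH f = nH g.
Proof.
move=> hf hg fg.
suff e : h1ip f f = h1ip g g by rewrite !nHE e.
have Dfg := D_ae hf hg fg.
have lf := H1_L2 hf; have lg := H1_L2 hg.
by rewrite /h1ip (ip_ae lf lg lf lg fg fg) (ip_ae (H1_DL2 hf) (H1_DL2 hg) (H1_DL2 hf) (H1_DL2 hg) Dfg Dfg).
Qed.

(* Integrate [F x ^+ 2 - F y ^+ 2 = \int_y^x 2 F F'] over [y] in a unit interval. *)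
Lemma sup_bound f F g x : H1rep f F g -> `|F x| <= 2 * nH f.
Proof.
move=> r; have [lf fF ACF lg] := r; have [hf Dg] := rep_H1 r.
have cF := AC_cont ACF.
have lF : L2 F by apply: L2_ae fF lf; exact: continuous_meas.
have ACsq := AC_mul ACF ACF.
pose q y := g y * F y + F y * g y.
have lq : L1 q by apply: L1D; exact: L2_L1.
pose e y := F y ^+ 2 + g y ^+ 2.
have le : L1 e by apply: L1D; exact: L2_L1sq.
have qe y : q y <= e y by rewrite /q /e; have := sqr_ge0 (F y - g y); nra.
have e0 y : 0 <= e y by rewrite addr_ge0// sqr_ge0.
have Ie : Int e = nH f ^+ 2.
  rewrite nH_sq// !L2s_sq//; last exact: H1_DL2.
  rewrite (ip_ae lf lF lf lF fF fF) (ip_ae (H1_DL2 hf) lg (H1_DL2 hf) lg Dg Dg).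
  by rewrite IntD//; exact: L2_L1sq.
have step y : y <= x -> F x ^+ 2 <= F y ^+ 2 + nH f ^+ 2.
  move=> yx; rewrite -Ie -lerBlDl !expr2 ACsq.2//.
  apply: Int_le => //; first exact: ACsq.1.
  move=> z; rewrite indic_oc; case: ifP => _; rewrite ?mul1r ?mul0r//.
  exact: qe.
have : itg (fun=> F x ^+ 2) (x - 1) x <= itg (fun y => F y ^+ 2 + nH f ^+ 2) (x - 1) x.
  apply: itg_le.
  - by apply: locL1_cont => y; exact: cvg_cst.
  - apply: locL1_cont => y; apply: cvgD; last exact: cvg_cst.
    by under eq_fun do rewrite expr2; apply: cvgM; exact: cF.
  - by move=> y _ yx; exact: step.
have lF2 : locL1 (fun y => F y ^+ 2) by apply: L1_loc; exact: L2_L1sq.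
rewrite itg_cst; last by lra.
rewrite (_ : x - (x - 1) = 1) ?mulr1; last by ring.
have -> : itg (fun y => F y ^+ 2 + nH f ^+ 2) (x - 1) x =
    itg (fun y => F y ^+ 2) (x - 1) x + nH f ^+ 2.
  have e1 : itg (fun=> nH f ^+ 2) (x - 1) x = nH f ^+ 2.
    by rewrite itg_cst; [ring|lra].
  rewrite -[in RHS]e1 /itg -IntD.
  - by congr Int; apply/funext => y; rewrite mulrDr.
  - exact: lF2.
  - by apply: locL1_cont => y; exact: cvg_cst.
have : itg (fun y => F y ^+ 2) (x - 1) x <= nH f ^+ 2.
  rewrite -Ie; apply: Int_le => // y; rewrite indic_oc; case: ifP => _; rewrite ?mul0r ?e0//.
  by rewrite mul1r lerDl sqr_ge0.
move=> h1 h2.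
(* The two bounds give [F x ^ 2 <= 2 * nH f ^ 2]; the constant 2 in the statement avoids a square
   root of 2. *)
rewrite -(@ler_pXn2r _ 2)// ?nnegrE ?mulr_ge0 ?nH_ge0// real_normK ?num_real//.
by have := sqr_ge0 (nH f); nra.
Qed.

Lemma H1_sup f : H1 f -> {ae mu, forall x, `|f x| <= 2 * nH f}.
Proof.
move=> hf; have [F rF] := H1_rep hf; have [_ fF _ _] := rF.
by move: fF; apply: ae_imp => x ->; exact: sup_bound rF.
Qed.

Lemma L2_ae_bdd c f g : measurable_fun setT f -> {ae mu, forall x, `|f x| <= c} -> L2 g ->
  L2 (fun x => f x * g x) /\ (0 <= c -> n2 (fun x => f x * g x) <= c * n2 g).
Proof.
move=> mf fc lg.
pose f' x := if `|f x| <= c then f x else 0.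
have ff' : aeeq f f' by move: fc; apply: ae_imp => x; rewrite /f' => ->.
have mf' : measurable_fun setT f'.
  by apply: measurable_fun_ifT => //; apply: measurable_fun_ler => //; exact: measurableT_comp.
have lfg : L2 (fun x => f x * g x).
  apply: (@L2_ae _ (fun x => f' x * g x)).
  - by apply: measurable_funM => //; exact: L2_meas.
  - by apply: aeeq_sym; apply: aeeqM => //; exact: aeeq_refl.
  - apply: (@L2_bdd _ `|c|) => // x; rewrite /f'; case: ifP => [h|_]; last by rewrite normr0.
    exact: le_trans h (ler_norm _).
split => // c0; apply: nrm2_le => //.
by move: fc; apply: ae_imp => x h; rewrite normrM ler_wpM2r.
Qed.

Lemma H1repM f F f' g G g' : H1rep f F f' -> H1rep g G g' ->
  H1rep (fun x => f x * g x) (fun x => F x * G x) (fun x => f' x * G x + F x * g' x).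
Proof.
move=> rf rg; have [lf fF ACF lf'] := rf; have [lg gG ACG lg'] := rg.
have [hf _] := rep_H1 rf; have [hg _] := rep_H1 rg.
have mF : measurable_fun setT F by apply: continuous_meas; exact: AC_cont ACF.
have mG : measurable_fun setT G by apply: continuous_meas; exact: AC_cont ACG.
split.
- by case: (L2_ae_bdd (L2_meas lf) (H1_sup hf) lg).
- exact: aeeqM.
- exact: AC_mul.
- apply: L2D.
    rewrite (_ : (fun _ => _) = (fun x => G x * f' x)); last by apply/funext => x; rewrite mulrC.
    exact: (L2_bdd mG (fun x => sup_bound x rg)).
  exact: (L2_bdd mF (fun x => sup_bound x rf)).
Qed.

(** The constant 6 counts three terms, [f g], [f' g] and [f g'], each with L^2 norm at most
    [2 * nH f * nH g] by the sup bound on the factor that is not differentiated. *)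
Lemma H1M f g : H1 f -> H1 g ->
  [/\ H1 (fun x => f x * g x), aeeq (D (fun x => f x * g x)) (fun x => D f x * g x + f x * D g x) &
    nH (fun x => f x * g x) <= 6 * (nH f * nH g)].
Proof.
move=> hf hg; have [F rF] := H1_rep hf; have [G rG] := H1_rep hg.
have r := H1repM rF rG; have [h1 h2] := rep_H1 r.
have [lf fF _ lf'] := rF; have [lg gG _ lg'] := rG.
have e : aeeq (D (fun x => f x * g x)) (fun x => D f x * g x + f x * D g x).
  apply: aeeq_trans h2 _; apply: aeeqD.
    by apply: aeeqM; [exact: aeeq_refl|exact: aeeq_sym].
  by apply: aeeqM; [exact: aeeq_sym|exact: aeeq_refl].
split => //; apply: le_trans (nH_le h1) _.
have f0 := nH_ge0 f; have g0 := nH_ge0 g.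
have [l1 b1] := L2_ae_bdd (L2_meas lf) (H1_sup hf) lg.
have [l2 b2] := L2_ae_bdd (L2_meas lf) (H1_sup hf) lg'.
have [l3 b3] := L2_ae_bdd (L2_meas lg) (H1_sup hg) lf'.
have p1 : 0 <= 2 * nH f := mulr_ge0 (ler0n R 2) f0.
have p2 : 0 <= 2 * nH g := mulr_ge0 (ler0n R 2) g0.
have q1 := le_trans (b1 p1) (ler_wpM2l p1 (n2_nH hg)).
have q2 := le_trans (b2 p1) (ler_wpM2l p1 (n2D_nH hg)).
have q3 := le_trans (b3 p2) (ler_wpM2l p2 (n2D_nH hf)).
have l3' : L2 (fun x => D f x * g x).
  rewrite (_ : (fun _ => _) = (fun x => g x * D f x)); first exact: l3.
  by apply/funext => x; rewrite mulrC.
have e3 : n2 (fun x => D f x * g x) = n2 (fun x => g x * D f x).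
  by congr (n2 _); apply/funext => x; rewrite mulrC.
rewrite (nrm2_ae (H1_DL2 h1) (L2D l3' l2) e).
have n3 := @nrmD _ _ L2s _ _ l3' l2.
rewrite (_ : 6 * (nH f * nH g) = 2 * nH f * nH g + (2 * nH g * nH f + 2 * nH f * nH g)); last by ring.
apply: lerD; first exact: q1.
apply: le_trans n3 _; apply: lerD; last exact: q2.
by rewrite e3; exact: q3.
Qed.

Lemma ip_cvg f (u : nat -> R -> R) h : L2 f -> (forall n, L2 (u n)) -> L2 h ->
  n2 (f - u n) @[n --> \oo] --> (0 : R) -> ip (u n) h @[n --> \oo] --> ip f h.
Proof.
move=> lf lu lh fu; apply/cvgrPdist_le => e e0.
have h0 := nrm2_ge0 h.
have e1 : 0 < e / (n2 h + 1) by rewrite divr_gt0//; lra.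
have /cvgrPdist_lt/(_ _ e1) := fu; apply: filterS => n; rewrite sub0r normrN => fn.
have -> : ip f h - ip (u n) h = ip (f - u n) h.
  by rewrite ipBl.
apply: le_trans (ip_le (L2B lf (lu n)) lh) _.
have := le_lt_trans (ler_norm _) fn => {}fn.
apply: (@le_trans _ _ (e / (n2 h + 1) * n2 h)); first by rewrite ler_wpM2r// ltW.
by rewrite mulrAC ler_pdivrMr; [rewrite ler_wpM2l ?ltW//; lra|lra].
Qed.

(** Test functions and their derivatives are fixed elements of L^2, so the defining identity of weak
    derivatives passes to L^2 limits. *)
Lemma H1_closed f g (u : nat -> R -> R) (u' : nat -> R -> R) : L2 f -> L2 g ->
  (forall n, L2 (u n)) -> (forall n, weak_derivatives (u n) (u' n)) ->
  n2 (f - u n) @[n --> \oo] --> (0 : R) -> n2 (g - u' n) @[n --> \oo] --> (0 : R) ->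
  H1 f /\ aeeq (D f) g.
Proof.
move=> lf lg lu wu fu gu.
have wg : weak_derivatives f g.
  apply/weak_derivativesP; split => // phi cphi.
  have lu' n : L2 (u' n) by have /weak_derivativesP[] := wu n.
  have c1 := ip_cvg lf lu (C1c_L2' cphi) fu.
  have c2 : (- (fun n => ip (u' n) phi)) n @[n --> \oo] --> - ip g phi.
    by apply: cvgN; exact: ip_cvg (C1c_L2 cphi) gu.
  have e : (fun n => ip (u n) (derive1 phi)) = - (fun n => ip (u' n) phi).
    by apply/funext => n; have /weak_derivativesP[_ ->] := wu n.
  by rewrite e in c1; exact: (cvg_unique _ c1 c2).
have [F rF] := wd_H1rep lf wg.
exact: rep_H1 rF.
Qed.

Lemma D_sum n (x : nat -> R -> R) : (forall n, H1 (x n)) ->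
  aeeq (D (\sum_(i < n) x i)) (\sum_(i < n) D (x i)).
Proof.
move=> hx; elim: n => [|n IH].
  rewrite !big_ord0.
  have := (rep_H1 (_ : H1rep 0 (fun=> 0) 0)).2; apply; split; [exact: L2_0|exact: aeeq_refl| |exact: L2_0].
  exact: AC_cst.
rewrite !big_ord_recr /=.
have hs : H1 (\sum_(i < n) x i) by exact: (@dom_sum R _ H1s _ _ _ _ (fun i : 'I_n => hx i)).
have [_ e] := H1_add hs (hx n); apply: aeeq_trans e _.
by apply: aeeqD => //; exact: aeeq_refl.
Qed.

Lemma H1_complete : geom_complete H1s.
Proof.
move=> C x C0 hx xC.
have lx n := H1_L2 (hx n); have lx' n := H1_DL2 (hx n).
have [f lf fC] := L2_complete C0 lx (fun n => le_trans (n2_nH (hx n)) (xC n)).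
have [g lg gC] := L2_complete C0 lx' (fun n => le_trans (n2D_nH (hx n)) (xC n)).
have hs n : H1 (\sum_(i < n) x i) by exact: (@dom_sum R _ H1s _ _ _ _ (fun i : 'I_n => hx i)).
have ls n : L2 (\sum_(i < n) D (x i)) by exact: (@dom_sum R _ L2s _ _ _ _ (fun i : 'I_n => lx' i)).
have gE n : n2 (g - D (\sum_(i < n) x i)) = n2 (g - \sum_(i < n) D (x i)).
  apply: nrm2_ae; [apply: L2B => //; exact: H1_DL2|exact: L2B|].
  by move: (D_sum n hx); apply: ae_imp => z e; rewrite !fctE e.
have [hf Df] : H1 f /\ aeeq (D f) g.
  apply: (@H1_closed f g (fun n => \sum_(i < n) x i) (fun n => D (\sum_(i < n) x i))) => //.
  - by move=> n; exact: H1_L2.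
  - by move=> n; exact: H1_D.
  - by under eq_fun do rewrite gE.
exists f => //.
have bound n : nH (f - \sum_(i < n) x i) <=
    n2 (f - \sum_(i < n) x i) + n2 (g - \sum_(i < n) D (x i)).
  have h1 := H1B hf (hs n).
  apply: le_trans (nH_le h1) _; rewrite lerD2l -gE.
  rewrite (_ : n2 (D (_ - _)) = n2 (g - D (\sum_(i < n) x i)))//.
  apply: nrm2_ae; [exact: H1_DL2|apply: L2B => //; exact: H1_DL2|].
  have [h2 e2] := H1_scale (-1) (hs n); have [h3 e3] := H1_add hf h2.
  have e4 : f - \sum_(i < n) x i = f + (-1) *: (\sum_(i < n) x i).
    by apply/funext => z; rewrite !fctE; rewrite -[_ *: _]/(_ * _) mulN1r.
  rewrite e4; apply: aeeq_trans e3 _; move: Df e2; apply: ae_imp2 => z.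
  by rewrite !fctE => -> ->; rewrite -[_ *: _]/(_ * _) mulN1r.
have lim0 : n2 (f - \sum_(i < n) x i) + n2 (g - \sum_(i < n) D (x i)) @[n --> \oo] --> (0 : R).
  by rewrite -[X in _ --> X](addr0 0); exact: cvgD.
apply: (squeeze_cvgr _ (cvg_cst 0) lim0).
by apply: nearW => n; rewrite nH_ge0 bound.
Qed.

End sobolev.
Global Opaque H1 weak_derivative h1ip.

(** * Poisson kernels and the Hilbert transform *)

Section kernels.
Context {R : realType}.
Implicit Types (f g h F G : R -> R) (a b c d e s x y z : R).
Local Notation mu := (@lebesgue_measure R).

(* [Q e / pi] and [P e / pi] are the conjugate Poisson and the Poisson kernel. *)
Definition Qk e s := s / (s ^+ 2 + e ^+ 2).
Definition Pk e s := e / (s ^+ 2 + e ^+ 2).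

Lemma ker_den e s : 0 < e -> 0 < s ^+ 2 + e ^+ 2.
Proof. by move=> e0; rewrite ltr_wpDl ?sqr_ge0// exprn_gt0. Qed.

Lemma continuous_den e : continuous (fun s => s ^+ 2 + e ^+ 2 : R).
Proof.
move=> s; apply: cvgD; last exact: cvg_cst.
by under eq_fun do rewrite expr2; apply: cvgM; exact: cvg_id.
Qed.

Lemma continuous_Qk e : 0 < e -> continuous (Qk e).
Proof.
move=> e0 s; apply: cvgM; first exact: cvg_id.
by apply: cvgV; [rewrite gt_eqF// ker_den|exact: continuous_den].
Qed.

Lemma continuous_Pk e : 0 < e -> continuous (Pk e).
Proof.
move=> e0 s; apply: cvgM; first exact: cvg_cst.
by apply: cvgV; [rewrite gt_eqF// ker_den|exact: continuous_den].
Qed.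

Lemma Pk_ge0 e s : 0 < e -> 0 <= Pk e s.
Proof. by move=> e0; rewrite divr_ge0// ltW// ker_den. Qed.

Lemma Pk_le e s : 0 < e -> `|Pk e s| <= e^-1.
Proof.
move=> e0; rewrite ger0_norm ?Pk_ge0// /Pk ler_pdivrMr ?ker_den//.
rewrite mulrDr expr2 expr2 [e^-1 * (e * e)]mulKf ?gt_eqF//.
rewrite lerDr; apply: mulr_ge0; first by rewrite invr_ge0 ltW.
by rewrite -expr2 sqr_ge0.
Qed.

Lemma Qk_le e s : 0 < e -> `|Qk e s| <= e^-1.
Proof.
move=> e0; rewrite /Qk normrM normfV (gtr0_norm (ker_den s e0)) ler_pdivrMr ?ker_den//.
rewrite mulrC ler_pdivlMr// -(real_normK (num_real s)).
have := normr_ge0 s; set t := `|s|; move=> t0; have := sqr_ge0 (t - e); have := sqr_ge0 t.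
by have := sqr_ge0 e; nra.
Qed.

Lemma Qk_mul_le e s : 0 < e -> `|Qk e s| * `|s| <= 1.
Proof.
move=> e0; rewrite -normrM /Qk mulrAC -expr2 ger0_norm; last first.
  by rewrite divr_ge0 ?sqr_ge0// ltW// ker_den.
by rewrite ler_pdivrMr ?ker_den// mul1r lerDl sqr_ge0.
Qed.

Lemma QkN e s : Qk e (- s) = - Qk e s.
Proof. by rewrite /Qk sqrrN mulNr. Qed.

Lemma PkN e s : Pk e (- s) = Pk e s.
Proof. by rewrite /Pk sqrrN. Qed.

Lemma Qk_sq_le e s : 0 < e -> Qk e s ^+ 2 <= e^-1 * Pk e s.
Proof.
move=> e0; have d := ker_den s e0; rewrite /Qk /Pk mulKf ?gt_eqF//.
rewrite expr_div_n ler_pdivrMr ?exprn_gt0// expr2 mulKf ?gt_eqF//.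
by rewrite lerDl sqr_ge0.
Qed.

Lemma Pk_sq_le e s : 0 < e -> Pk e s ^+ 2 <= e^-1 * Pk e s.
Proof.
move=> e0; rewrite expr2 ler_wpM2r ?Pk_ge0//.
by rewrite -(ger0_norm (Pk_ge0 s e0)) Pk_le.
Qed.

Lemma is_derive_sub_div y e x : is_derive x (1 : R) (fun x => (x - y) / e) e^-1.
Proof.
apply: (@is_derive_quad _ _ _ _ 0) => h; rewrite mul0r.
by rewrite (_ : _ - _ = 0) ?normr0//; ring.
Qed.

Lemma AC_shift_cont f y : continuous f -> continuous (fun x => f (x - y)).
Proof.
move=> cf x; apply: (cvg_comp (fun x => x - y) f); last exact: cf.
by apply: cvgB; [exact: cvg_id|exact: cvg_cst].
Qed.

Lemma AC_atan y e : 0 < e -> AC (fun x => atan ((x - y) / e)) (fun x => Pk e (x - y)).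
Proof.
move=> e0; apply: AC_FTC => [|x]; first by apply: AC_shift_cont; exact: continuous_Pk.
have := @is_derive1_comp R atan (fun x => (x - y) / e) x _ _
  (is_derive1_atan _) (is_derive_sub_div y e x).
rewrite (_ : _ * e^-1 = Pk e (x - y))// /Pk; have d := ker_den (x - y) e0.
rewrite (_ : 1 + _ = ((x - y) ^+ 2 + e ^+ 2) / e ^+ 2); last by field; rewrite gt_eqF.
by rewrite invf_div; field; rewrite !gt_eqF.
Qed.

Lemma AC_ln y e : 0 < e ->
  AC (fun x => ln ((x - y) ^+ 2 + e ^+ 2)) (fun x => 2 * Qk e (x - y)).
Proof.
move=> e0; apply: AC_FTC => [|x].
  move=> x; apply: cvgM; first exact: cvg_cst.
  exact: (AC_shift_cont (continuous_Qk e0)).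
have dq : is_derive x (1 : R) (fun x => (x - y) ^+ 2 + e ^+ 2) (2 * (x - y)).
  apply: (@is_derive_quad _ _ _ _ 1) => h; rewrite mul1r.
  by rewrite (_ : _ - _ = h ^+ 2) ?ger0_norm ?sqr_ge0//; ring.
have := @is_derive1_comp R (@ln R) (fun x => (x - y) ^+ 2 + e ^+ 2) x _ _
  (is_derive1_ln (ker_den (x - y) e0)) dq.
by rewrite (_ : _ * (2 * (x - y)) = 2 * Qk e (x - y))// /Qk; ring.
Qed.

Lemma cvgy_atan_sub y e : 0 < e -> atan ((x - y) / e) @[x --> +oo] --> pi / 2.
Proof.
move=> e0; apply: (cvg_comp (fun x => (x - y) / e) atan); last exact: cvgy_atan.
apply/cvgryPge => A; near=> x; rewrite ler_pdivlMr// lerBrDr.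
by near: x; exact: nbhs_pinfty_ge (num_real _).
Unshelve. all: by end_near. Qed.

Lemma cvgNy_atan_sub y e : 0 < e -> atan ((x - y) / e) @[x --> -oo] --> - (pi / 2).
Proof.
move=> e0; apply/cvgNy_compNP.
rewrite (_ : _ \o _ = - (fun x => atan ((x - (- y)) / e))).
  by apply: cvgN; exact: cvgy_atan_sub.
apply/funext => x; rewrite !fctE -atanN; congr atan; rewrite -mulNr; congr (_ / _); ring.
Qed.

Lemma Pk_int y e : 0 < e -> L1 (fun x => Pk e (x - y)) /\ Int (fun x => Pk e (x - y)) = pi.
Proof.
move=> e0; have ACa := AC_atan y e0.
have b x : `|atan ((x - y) / e)| <= pi / 2.
  by rewrite ler_norml; apply/andP; split; apply: ltW; [exact: atan_gtNpi2|exact: atan_ltpi2].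
have [l1 _] := L1_AC ACa (fun x => Pk_ge0 _ e0) b.
split => //; rewrite (Int_AC ACa l1 (cvgy_atan_sub y e0) (cvgNy_atan_sub y e0)).
by field.
Qed.

Lemma Pk_int' y e : 0 < e -> L1 (fun x => Pk e (y - x)) /\ Int (fun x => Pk e (y - x)) = pi.
Proof.
move=> e0; have := Pk_int y e0; rewrite (_ : (fun x => Pk e (x - y)) = fun x => Pk e (y - x))//.
by apply/funext => x; rewrite -PkN opprB.
Qed.

Lemma Pk_L2 y e : 0 < e -> L2 (fun x => Pk e (x - y)).
Proof.
move=> e0; apply/L2P; split.
  by apply: continuous_meas; apply: AC_shift_cont; exact: continuous_Pk.
apply: (@L1_le _ (fun x => e^-1 * Pk e (x - y))).
- by apply: measurable_funX; apply: continuous_meas; apply: AC_shift_cont; exact: continuous_Pk.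
- by apply: L1Z; case: (Pk_int y e0).
- by move=> x; rewrite ger0_norm ?sqr_ge0// Pk_sq_le.
Qed.

Lemma Qk_L2 y e : 0 < e -> L2 (fun x => Qk e (x - y)).
Proof.
move=> e0; apply/L2P; split.
  by apply: continuous_meas; apply: AC_shift_cont; exact: continuous_Qk.
apply: (@L1_le _ (fun x => e^-1 * Pk e (x - y))).
- by apply: measurable_funX; apply: continuous_meas; apply: AC_shift_cont; exact: continuous_Qk.
- by apply: L1Z; case: (Pk_int y e0).
- by move=> x; rewrite ger0_norm ?sqr_ge0// Qk_sq_le.
Qed.

(** Each logarithm diverges, but the quotient of the arguments tends to 1. The filter is left
    abstract in order to serve at both infinities. *)
Lemma cvg_ln_ratio (F : set_system R) (FF : Filter F) y z e d : 0 < e -> 0 < d ->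
  (forall A, \forall x \near F, A <= `|x|) ->
  ln ((x - z) ^+ 2 + d ^+ 2) - ln ((x - y) ^+ 2 + e ^+ 2) @[x --> F] --> (0 : R).
Proof.
move=> e0 d0 Foo.
rewrite (_ : (fun _ => _) =
    fun x => ln (((x - z) ^+ 2 + d ^+ 2) / ((x - y) ^+ 2 + e ^+ 2))); last first.
  by apply/funext => x; rewrite ln_div// posrE ker_den.
rewrite -[X in _ --> X]ln1.
apply: (cvg_comp _ (@ln R)); last by apply: continuous_ln; exact: ltr01.
apply/cvgrPdist_le => r r0.
(* With [t = x - y], the quotient differs from 1 by [(2 (y - z) t + ((y - z)^2 + d^2 - e^2)) / (t^2
   + e^2)]; for [|t| >= 1] the numerator is at most [c |t|]. *)
pose c := 2 * `|y - z| + `|(y - z) ^+ 2 + d ^+ 2 - e ^+ 2|.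
have c0 : 0 <= c by rewrite addr_ge0// mulr_ge0.
near=> x.
have hx : c / r + 1 + `|y| <= `|x| by near: x; exact: Foo.
have ht : c / r + 1 <= `|x - y|.
  by have := lerB_dist x y; lra.
have cr : 0 <= c / r by rewrite divr_ge0// ltW.
set t := x - y in ht *.
have D := ker_den t e0.
rewrite (_ : 1 - _ = - ((2 * (y - z) * t + ((y - z) ^+ 2 + d ^+ 2 - e ^+ 2)) / (t ^+ 2 + e ^+ 2))); last first.
  by rewrite /t; field; rewrite gt_eqF.
rewrite normrN normrM normfV (gtr0_norm D) ler_pdivrMr//.
apply: le_trans (ler_normD _ _) _; rewrite !normrM (ger0_norm (ler0n R 2)).
have t1 : 1 <= `|t| by lra.
have crt : c <= r * `|t|.
  by rewrite -ler_pdivrMl// mulrC; lra.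
rewrite -(real_normK (num_real t)).
apply: (@le_trans _ _ (c * `|t|)).
  by rewrite /c [leRHS]mulrDl lerD2l ler_peMr.
apply: (@le_trans _ _ (r * `|t| * `|t|)); first by rewrite ler_wpM2r.
rewrite -mulrA -expr2; apply: ler_wpM2l; first exact: ltW.
by rewrite lerDl sqr_ge0.
Unshelve. all: by end_near. Qed.

(** As [1 / (s + i e) = Qk e s - i Pk e s], the integrand is the real part of
    [1 / ((x - y + i e) (x - z - i d))]. The poles lie on opposite sides of the line, whence the
    parameter [e + d], and partial fractions give the antiderivative [G]. Both kernels are taken at
    [x] minus a point, so the oddness of [Qk] turns the minus sign of the convolution identity into
    a plus. *)
Lemma ker_conv y z e d : 0 < e -> 0 < d ->
  Int (fun x => Qk e (x - y) * Qk d (x - z)) + Int (fun x => Pk e (x - y) * Pk d (x - z)) =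
  2 * pi * Pk (e + d) (y - z).
Proof.
move=> e0 d0; have ed : 0 < e + d by exact: addr_gt0.
have lQ : L1 (fun x => Qk e (x - y) * Qk d (x - z)) by apply: L2_L1; exact: Qk_L2.
have lP : L1 (fun x => Pk e (x - y) * Pk d (x - z)) by apply: L2_L1; exact: Pk_L2.
rewrite -IntD//.
pose a := y - z; pose s := e + d; pose m := (a ^+ 2 + s ^+ 2)^-1.
pose G x := m * (- (a / 2) * (ln ((x - z) ^+ 2 + d ^+ 2) - ln ((x - y) ^+ 2 + e ^+ 2)) +
   s * (atan ((x - z) / d) + atan ((x - y) / e))).
have ACG : AC G (fun x => Qk e (x - y) * Qk d (x - z) + Pk e (x - y) * Pk d (x - z)).
  have A1 := AC_add (AC_ln z d0) (AC_scale (-1) (AC_ln y e0)).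
  have A2 := AC_add (AC_atan z d0) (AC_atan y e0).
  have := AC_scale m (AC_add (AC_scale (- (a / 2)) A1) (AC_scale s A2)).
  congr AC; apply/funext => x; first by rewrite /G mulN1r.
  have D1 := ker_den (x - y) e0; have D2 := ker_den (x - z) d0; have D3 := ker_den a ed.
  rewrite /m /Qk /Pk /a /s; rewrite /a in D3.
  by field; rewrite !gt_eqF.
have lG : L1 (fun x => Qk e (x - y) * Qk d (x - z) + Pk e (x - y) * Pk d (x - z)) by exact: L1D.
have G1 : G x @[x --> +oo] --> m * (- (a / 2) * 0 + s * (pi / 2 + pi / 2)).
  apply: cvgM; first exact: cvg_cst.
  apply: cvgD; apply: cvgM; [exact: cvg_cst| |exact: cvg_cst|].
    apply: cvg_ln_ratio => // A; near=> x; apply: le_trans (ler_norm x).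
    by near: x; exact: nbhs_pinfty_ge (num_real _).
  by apply: cvgD; exact: cvgy_atan_sub.
have G2 : G x @[x --> -oo] --> m * (- (a / 2) * 0 + s * (- (pi / 2) + - (pi / 2))).
  apply: cvgM; first exact: cvg_cst.
  apply: cvgD; apply: cvgM; [exact: cvg_cst| |exact: cvg_cst|].
    apply: cvg_ln_ratio => // A; near=> x; rewrite -normrN; apply: le_trans (ler_norm (- x)).
    rewrite lerNr; near: x; exact: nbhs_ninfty_le (num_real _).
  by apply: cvgD; exact: cvgNy_atan_sub.
rewrite (Int_AC ACG lG G1 G2) /m /Pk -/a -/s.
by field; rewrite gt_eqF// ker_den.
Unshelve. all: by end_near. Qed.

End kernels.

(** * Convolution of integrable functions with the kernels, and the Poisson energy *)

Section convolution.
Context {R : realType}.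
Implicit Types (f g h w u K L F G : R -> R) (a b c d e s x y z : R).
Local Notation mu := (@lebesgue_measure R).
Local Notation n2 := (nrm L2s).

Definition conv K f x := Int (fun y => K (x - y) * f y).

Lemma discriminant (A B W : R) : 0 <= W -> (forall t, 0 <= B - 2 * t * A + t ^+ 2 * W) ->
  A ^+ 2 <= W * B.
Proof.
move=> W0 h; have [W1|W1] := ltP 0 W; last first.
  have -> : W = 0 by apply/eqP; rewrite eq_le W1.
  have {}W1 : W = 0 by apply/eqP; rewrite eq_le W1.
  have [->|A0] := eqVneq A 0; first by rewrite expr0n mul0r.
  have := h ((B + 1) / (2 * A)); rewrite W1 mulr0 addr0.
  by rewrite (_ : 2 * _ * A = B + 1); [lra|field].
have := h (A / W).
rewrite (_ : _ + _ = (W * B - A ^+ 2) / W); last by field; rewrite gt_eqF.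
by rewrite pmulr_lge0 ?invr_gt0// subr_ge0.
Qed.

(** Integrate [(u - t)^2 w >= 0] and take the discriminant in [t]. The weight is [|f|] in the L^2
    bound on convolutions and the Poisson kernel in the uniform one. *)
Lemma weighted_cs w u : (forall x, 0 <= w x) -> L1 w -> L1 (fun x => u x * w x) ->
  L1 (fun x => u x ^+ 2 * w x) ->
  Int (fun x => u x * w x) ^+ 2 <= Int w * Int (fun x => u x ^+ 2 * w x).
Proof.
move=> w0 lw luw luw2; apply: discriminant => [|t]; first exact: Int_ge0.
rewrite -mulrA -IntZ// -IntZ; last exact: L1Z.
rewrite -IntB//; last by apply: L1Z; exact: L1Z.
rewrite -IntZ// -IntD; last exact: L1Z.
  apply: Int_ge0 => x; have := mulr_ge0 (sqr_ge0 (u x - t)) (w0 x).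
  by congr (_ <= _); ring.
by apply: L1B => //; apply: L1Z; exact: L1Z.
Qed.

Lemma measurable_kernel K : continuous K ->
  measurable_fun setT (fun p : R * R => K (p.1 - p.2)).
Proof.
move=> cK; apply: (measurableT_comp (continuous_meas cK)).
by apply: measurable_funB.
Qed.

Lemma meas_shift' K x : continuous K -> measurable_fun setT (fun y => K (x - y)).
Proof.
move=> cK; apply: continuous_meas => y; apply: (cvg_comp (fun y => x - y) K); last exact: cK.
by apply: cvgB; [exact: cvg_cst|exact: cvg_id].
Qed.

Lemma conv_dual K f h (M B : R) : continuous K -> (forall s, `|K s| <= M) -> L1 f -> measurable_fun setT h ->
  (forall y, L1 (fun x => h x * K (x - y))) ->
  (forall y, Int (fun x => `|h x * K (x - y)|) <= B) ->
  [/\ Int (fun x => h x * conv K f x) = Int (fun y => f y * Int (fun x => h x * K (x - y))),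
     L1 (fun x => h x * conv K f x) & L1 (fun y => f y * Int (fun x => h x * K (x - y)))].
Proof.
move=> cK KM lf mh lhK hB.
pose k (p : R * R) := h p.1 * (K (p.1 - p.2) * f p.2).
have mk : measurable_fun setT k.
  apply: measurable_funM.
    by apply: (measurableT_comp mh); exact: measurable_fst.
  apply: measurable_funM; first exact: measurable_kernel.
  by apply: (measurableT_comp (L1_meas lf)); exact: measurable_snd.
have kE y : (fun x => k (x, y)) = fun x => f y * (h x * K (x - y)).
  by apply/funext => x; rewrite /k/=; ring.
have lk y : L1 (fun x => k (x, y)) by rewrite kE; exact: L1Z.
have lb : L1 (fun y => B * `|f y|) by exact/L1Z/L1_norm.
have kb y : Int (fun x => `|k (x, y)|) <= B * `|f y|.
  rewrite (_ : (fun _ => _) = fun x => `|f y| * `|h x * K (x - y)|); last first.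
    by apply/funext => x; rewrite -normrM /k/=; congr `|_|; ring.
  by rewrite IntZ; [rewrite mulrC ler_wpM2r|exact: L1_norm].
have [sw l1 l2 ae] := Int_swap mk lk lb kb.
have E2 : (fun y => Int (fun x => k (x, y))) = fun y => f y * Int (fun x => h x * K (x - y)).
  by apply/funext => y; rewrite kE IntZ.
have E1 x : Int (fun y => k (x, y)) = h x * conv K f x.
  by rewrite /k/= IntZ//; apply: (L1_bdd (meas_shift' x cK) (fun y => KM _)).
have E1' : (fun x => Int (fun y => k (x, y))) = fun x => h x * conv K f x.
  by apply/funext => x; exact: E1.
by move: sw l1 l2; rewrite E1' E2.
Qed.

Lemma L2_pair_bound f g (a b : R) : L2 f -> L2 g -> n2 f <= a -> n2 g <= b ->
  L1 (fun x => f x * g x) /\ Int (fun x => `|f x * g x|) <= a * b.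
Proof.
move=> lf lg fa gb; have l1 := L2_L1 lf lg; split => //.
have labs h : L2 h -> L2 (fun x => `|h x|) /\ n2 (fun x => `|h x|) = n2 h.
  move=> lh; split.
    apply: (L2_le _ lh); last by move=> x; rewrite normr_id.
    by apply: measurableT_comp => //; exact: L2_meas.
  rewrite !nrm2E; congr Num.sqrt; congr Int; apply/funext => x.
  by rewrite -normrM ger0_norm// -expr2 sqr_ge0.
have [lf' ef] := labs _ lf; have [lg' eg] := labs _ lg.
rewrite (_ : Int _ = ip (fun x => `|f x|) (fun x => `|g x|)); last first.
  by congr Int; apply/funext => x; rewrite normrM.
apply: le_trans (ler_norm _) _; apply: le_trans (ip_le lf' lg') _.
rewrite ef eg; apply: ler_pM => //; exact: nrm2_ge0.
Qed.

(** Conditions under which convolution maps integrable functions into L^2 and the integrals may be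
    exchanged. For [Qk] and [Pk] the bounds supplied here blow up as [e] tends to 0; the uniform
    bounds are proved separately. *)
Definition good_kernel (M N : R) K := [/\ continuous K, forall s, `|K s| <= M,
  forall y, L2 (fun x => K (x - y)) & forall y, n2 (fun x => K (x - y)) <= N].

Lemma conv_dual2 K f h (M N : R) : good_kernel M N K -> L1 f -> L2 h ->
  [/\ ip h (conv K f) = Int (fun y => f y * Int (fun x => h x * K (x - y))),
     L1 (fun x => h x * conv K f x) & L1 (fun y => f y * Int (fun x => h x * K (x - y)))].
Proof.
move=> [cK KM lK KN] lf lh.
apply: (@conv_dual K f h M (n2 h * N)) => //.
- exact: L2_meas.
- by move=> y; exact: L2_L1.
- by move=> y; case: (L2_pair_bound lh (lK y) (lexx _) (KN y)).
Qed.

Lemma Qk_good e : 0 < e -> good_kernel e^-1 (Num.sqrt (e^-1 * pi)) (Qk e).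
Proof.
move=> e0; split; [exact: continuous_Qk|by move=> s; exact: Qk_le|by move=> y; exact: Qk_L2|].
move=> y; rewrite nrm2E; apply: ler_wsqrtr; have [l1 e1] := Pk_int y e0.
rewrite -e1 -IntZ//; apply: Int_le; [by apply: L2_L1; exact: Qk_L2|exact: L1Z|].
by move=> x; rewrite -expr2; exact: Qk_sq_le.
Qed.

Lemma Pk_good e : 0 < e -> good_kernel e^-1 (Num.sqrt (e^-1 * pi)) (Pk e).
Proof.
move=> e0; split; [exact: continuous_Pk|by move=> s; exact: Pk_le|by move=> y; exact: Pk_L2|].
move=> y; rewrite nrm2E; apply: ler_wsqrtr; have [l1 e1] := Pk_int y e0.
rewrite -e1 -IntZ//; apply: Int_le; [by apply: L2_L1; exact: Pk_L2|exact: L1Z|].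
by move=> x; rewrite -expr2; exact: Pk_sq_le.
Qed.

Lemma conv_L1 K f (M N : R) x : good_kernel M N K -> L1 f -> L1 (fun y => K (x - y) * f y).
Proof. by move=> [cK KM _ _] lf; apply: (L1_bdd (meas_shift' x cK) (fun y => KM _)). Qed.

(** Fubini yields integrability, hence measurability, of the convolution times the square integrable
    weight [Pk 1]; this weight vanishes nowhere and can be divided out. *)
Lemma conv_meas K f (M N : R) : good_kernel M N K -> L1 f -> measurable_fun setT (conv K f).
Proof.
move=> gK lf; have r1 : (0 : R) < 1 by [].
have lP : L2 (fun x => Pk 1 (x - 0)) := Pk_L2 0 r1.
have [_ l1 _] := conv_dual2 gK lf lP.
have P0 x : Pk 1 (x - 0) != 0.
  by rewrite gt_eqF// /Pk divr_gt0//; exact: ker_den.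
rewrite (_ : conv K f = fun x => (x ^+ 2 + 1 ^+ 2) * (Pk 1 (x - 0) * conv K f x)).
  by apply: measurable_funM; [apply: continuous_meas; exact: continuous_den|exact: L1_meas].
apply/funext => x; rewrite mulrA [X in _ = X * _](_ : _ = 1) ?mul1r//.
by rewrite /Pk subr0 mul1r divff// gt_eqF// ker_den.
Qed.

(** Cauchy-Schwarz with weight [|f|] bounds the square of the convolution by [\int |f|] times the
    convolution of [K^2] with [|f|], which is integrable by Fubini. *)
Lemma conv_L2 K f (M N : R) : good_kernel M N K -> L1 f -> L2 (conv K f).
Proof.
move=> gK lf; have [cK KM lK KN] := gK.
have mc := conv_meas gK lf.
pose k (p : R * R) := K (p.1 - p.2) ^+ 2 * `|f p.2|.
have mk : measurable_fun setT k.
  apply: measurable_funM; first by apply: measurable_funX; exact: measurable_kernel.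
  apply: measurableT_comp => //; apply: (measurableT_comp (L1_meas lf)).
  exact: measurable_snd.
have kE y : (fun x => k (x, y)) = fun x => `|f y| * (K (x - y) ^+ 2).
  by apply/funext => x; rewrite /k/= mulrC.
have k0 p : 0 <= k p by rewrite mulr_ge0// sqr_ge0.
have lk y : L1 (fun x => k (x, y)) by rewrite kE; apply: L1Z; exact: L2_L1sq.
have lb : L1 (fun y => N ^+ 2 * `|f y|) by exact/L1Z/L1_norm.
have kb y : Int (fun x => `|k (x, y)|) <= N ^+ 2 * `|f y|.
  rewrite (_ : (fun _ => _) = fun x => k (x, y)); last by apply/funext => x; rewrite ger0_norm.
  rewrite kE IntZ; last exact: L2_L1sq.
  rewrite mulrC ler_wpM2r// -[leLHS]/(ip (fun x => K (x - y)) (fun x => K (x - y))) -L2s_sq//.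
  by rewrite lerXn2r ?nnegrE ?nrm2_ge0// (le_trans (nrm2_ge0 _) (KN y)).
have [_ l1 _ _] := Int_swap mk lk lb kb.
have labs := L1_norm lf.
apply/L2P; split => //.
apply: (@L1_le _ (fun x => Int (fun y => `|f y|) * Int (fun y => k (x, y)))).
- exact: measurable_funX.
- exact: L1Z.
- move=> x; rewrite ger0_norm ?sqr_ge0//.
  have b1 : `|conv K f x| <= Int (fun y => `|K (x - y)| * `|f y|).
    apply: le_trans (Int_norm (conv_L1 x gK lf)) _.
    rewrite le_eqVlt; apply/orP; left; apply/eqP; congr Int; apply/funext => y.
    by rewrite normrM.
  have mK : measurable_fun setT (fun y => `|K (x - y)|).
    by apply: measurableT_comp => //; exact: meas_shift'.
  have M0 : 0 <= M := le_trans (normr_ge0 _) (KM 0).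
  have l3 : L1 (fun y => `|K (x - y)| * `|f y|).
    by apply: (L1_bdd mK _ labs) => y; rewrite normr_id.
  have l4 : L1 (fun y => `|K (x - y)| ^+ 2 * `|f y|).
    apply: (@L1_bdd _ (M ^+ 2)) => //; first exact: measurable_funX.
    by move=> y; rewrite ger0_norm ?sqr_ge0// lerXn2r ?nnegrE.
  have cs := @weighted_cs (fun y => `|f y|) (fun y => `|K (x - y)|) (fun y => normr_ge0 _) labs l3 l4.
  rewrite -(real_normK (num_real (conv K f x))).
  apply: (@le_trans _ _ (Int (fun y => `|K (x - y)| * `|f y|) ^+ 2)).
    by rewrite lerXn2r ?nnegrE// (le_trans _ b1).
  apply: le_trans cs _; rewrite le_eqVlt; apply/orP; left; apply/eqP; congr (_ * Int _).
  by apply/funext => y; rewrite /k/= real_normK ?num_real.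
Qed.

Lemma conv_pair K L f (M N M' N' : R) : good_kernel M N K -> good_kernel M' N' L -> L1 f ->
  [/\ ip (conv K f) (conv L f) =
     Int (fun y => f y * Int (fun z => f z * Int (fun x => L (x - y) * K (x - z)))),
     L1 (fun y => f y * Int (fun z => f z * Int (fun x => L (x - y) * K (x - z)))) &
     forall y, L1 (fun z => f z * Int (fun x => L (x - y) * K (x - z)))].
Proof.
move=> gK gL lf; have lK := conv_L2 gK lf.
have [e1 _ l1] := conv_dual2 gL lf lK.
have lL y : L2 (fun x => L (x - y)) by case: gL.
have E y : Int (fun x => conv K f x * L (x - y)) =
    Int (fun z => f z * Int (fun x => L (x - y) * K (x - z))).
  have [<- _ _] := conv_dual2 gK lf (lL y).
  by congr Int; apply/funext => x; rewrite mulrC.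
have E' : (fun y => f y * Int (fun x => conv K f x * L (x - y))) =
   fun y => f y * Int (fun z => f z * Int (fun x => L (x - y) * K (x - z))).
  by apply/funext => y; rewrite E.
split; [by rewrite e1 E'|by rewrite -E'|].
by move=> y; case: (conv_dual2 gK lf (lL y)).
Qed.

Definition energy f s := Int (fun y => f y * Int (fun z => f z * Pk s (y - z))).

(** This is [ker_conv] integrated against [f y * f z]. *)
Lemma conv_energy f e d : L1 f -> 0 < e -> 0 < d ->
  ip (conv (Qk e) f) (conv (Qk d) f) + ip (conv (Pk e) f) (conv (Pk d) f) =
  2 * pi * energy f (e + d).
Proof.
move=> lf e0 d0; have ed : 0 < e + d by exact: addr_gt0.
have [eQ lQ lQ'] := conv_pair (Qk_good e0) (Qk_good d0) lf.
have [eP lP lP'] := conv_pair (Pk_good e0) (Pk_good d0) lf.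
rewrite eQ eP -IntD//.
have lfP y : L1 (fun z => f z * Pk (e + d) (y - z)).
  rewrite (_ : (fun _ => _) = fun z => Pk (e + d) (y - z) * f z).
    exact: conv_L1 (Pk_good ed) lf.
  by apply/funext => z; rewrite mulrC.
have E y : f y * Int (fun z => f z * Int (fun x => Qk d (x - y) * Qk e (x - z))) +
   f y * Int (fun z => f z * Int (fun x => Pk d (x - y) * Pk e (x - z))) =
   2 * pi * (f y * Int (fun z => f z * Pk (e + d) (y - z))).
  rewrite -mulrDr -IntD// [RHS]mulrCA -(IntZ (2 * pi) (lfP y)); congr (_ * Int _); apply/funext => z.
  by rewrite -mulrDr ker_conv// mulrCA (addrC d).
rewrite /energy -IntZ.
  by congr Int; apply/funext => y; rewrite E.
have pi2 : 2 * pi != 0 :> R by rewrite mulf_neq0// gt_eqF// pi_gt0.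
rewrite (_ : (fun _ => _) = fun y => (2 * pi)^-1 *
  (f y * Int (fun z => f z * Int (fun x => Qk d (x - y) * Qk e (x - z))) +
   f y * Int (fun z => f z * Int (fun x => Pk d (x - y) * Pk e (x - z))))).
  by apply: L1Z; exact: L1D.
by apply/funext => y; rewrite E mulKf.
Qed.

Lemma energy_ip f s : L1 f -> 0 < s -> energy f s = ip f (conv (Pk s) f).
Proof.
move=> lf s0; congr Int; apply/funext => y; congr (_ * Int _).
by apply/funext => z; rewrite mulrC.
Qed.

(** [Pk s] is positive of total mass [pi]: Cauchy-Schwarz with this weight costs one factor [pi] in
    the square and Fubini another, uniformly in [s]. *)
Lemma conv_Pk_nrm f s : L1 f -> L2 f -> 0 < s -> n2 (conv (Pk s) f) <= pi * n2 f.
Proof.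
move=> lf l2f s0; have gP := Pk_good s0; have lc := conv_L2 gP lf.
have lf2 := L2_L1sq l2f.
have [cP _ _ _] := gP.
have pi0 := @pi_ge0 R.
pose k (p : R * R) := Pk s (p.1 - p.2) * f p.2 ^+ 2.
have mk : measurable_fun setT k.
  apply: measurable_funM; first exact: measurable_kernel.
  by apply: measurable_funX; apply: (measurableT_comp (L1_meas lf)); exact: measurable_snd.
have k0 p : 0 <= k p by rewrite mulr_ge0 ?sqr_ge0// Pk_ge0.
have kE y : (fun x => k (x, y)) = fun x => f y ^+ 2 * Pk s (x - y).
  by apply/funext => x; rewrite /k/= mulrC.
have lk y : L1 (fun x => k (x, y)).
  by rewrite kE; apply: L1Z; case: (Pk_int y s0).
have Ik y : Int (fun x => k (x, y)) = pi * f y ^+ 2.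
  by rewrite kE; have [l1 e1] := Pk_int y s0; rewrite IntZ// e1 mulrC.
have kb y : Int (fun x => `|k (x, y)|) <= pi * f y ^+ 2.
  rewrite -Ik le_eqVlt; apply/orP; left; apply/eqP; congr Int; apply/funext => x.
  by rewrite ger0_norm.
have [sw l1 l2 _] := Int_swap mk lk (L1Z pi lf2) kb.
rewrite -(@ler_pXn2r _ 2)// ?nnegrE ?mulr_ge0 ?nrm2_ge0//.
rewrite exprMn !L2s_sq//.
apply: (@le_trans _ _ (Int (fun x => pi * Int (fun y => k (x, y))))).
  apply: Int_le; [exact: L2_L1|exact: L1Z|move=> x].
  have [lP eP] := Pk_int' x s0.
  have h1 : L1 (fun y => f y * Pk s (x - y)).
    rewrite (_ : (fun _ => _) = fun y => Pk s (x - y) * f y); first exact: conv_L1 gP lf.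
    by apply/funext => y; rewrite mulrC.
  have h2 : L1 (fun y => f y ^+ 2 * Pk s (x - y)).
    rewrite (_ : (fun _ => _) = fun y => Pk s (x - y) * f y ^+ 2); first exact: conv_L1 gP lf2.
    by apply/funext => y; rewrite mulrC.
  have := weighted_cs (fun y => Pk_ge0 (x - y) s0) lP h1 h2; rewrite eP -expr2.
  rewrite (_ : conv (Pk s) f x = Int (fun y => f y * Pk s (x - y))); last first.
    by congr Int; apply/funext => y; rewrite mulrC.
  by rewrite (_ : (fun y => f y ^+ 2 * Pk s (x - y)) = fun y => k (x, y))//; apply/funext => y; rewrite /k mulrC.
rewrite IntZ// sw (_ : (fun y => Int _) = fun y => pi * f y ^+ 2); last first.
  by apply/funext => y; rewrite Ik.
rewrite IntZ// mulrA -expr2 le_eqVlt; apply/orP; left; apply/eqP; congr (_ * Int _).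
Qed.

Lemma energy_le f s : L1 f -> L2 f -> 0 < s -> `|energy f s| <= pi * n2 f ^+ 2.
Proof.
move=> lf l2f s0; rewrite energy_ip//.
apply: le_trans (ip_le l2f (conv_L2 (Pk_good s0) lf)) _.
by rewrite expr2 mulrCA ler_wpM2l ?nrm2_ge0// conv_Pk_nrm.
Qed.

End convolution.

(** * The L^2 limit of the conjugate Poisson integrals *)

Section conjugate_limit.
Context {R : realType}.
Implicit Types (f g h w u K L F G : R -> R) (a b c d e s x y z : R).
Local Notation mu := (@lebesgue_measure R).
Local Notation n2 := (nrm L2s).

Lemma nrm2B f g h : L2 f -> L2 g -> L2 h -> n2 (f - h) <= n2 (f - g) + n2 (g - h).
Proof. exact: (@nrm_trans _ _ L2s). Qed.

(** A subsequence with geometric increments reduces this to [L2_series]. The almost everywhere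
    convergence along it later identifies the limit with the principal value. *)
Lemma L2_cauchy (u : nat -> R -> R) : (forall n, L2 (u n)) ->
  (forall e, 0 < e -> exists N, forall m n, (N <= m)%N -> (N <= n)%N -> n2 (u m - u n) <= e) ->
  exists h, [/\ L2 h, n2 (h - u n) @[n --> \oo] --> (0 : R) &
    exists2 M : nat -> nat, (forall k, (k <= M k)%N) &
      {ae mu, forall x, u (M k) x @[k --> \oo] --> h x}].
Proof.
move=> lu uC.
have [N HN] := choice (fun k => uC (2^-1 ^+ k) (exprn_gt0 k (ltac:(lra) : 0 < 2^-1 :> R))).
(* Cumulated sums make [M] nondecreasing, and the summand [k] makes it tend to infinity. *)
pose M k := (\sum_(i < k.+1) N i + k)%N.
have NM k : (N k <= M k)%N by rewrite /M big_ord_recr/=; exact: leq_trans (leq_addl _ _) (leq_addr _ _).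
have kM k : (k <= M k)%N by rewrite /M leq_addl.
have MM k : (M k <= M k.+1)%N by rewrite /M [X in (_ <= X + _)%N]big_ord_recr/=; apply: leq_add; [exact: leq_addr|exact: leqnSn].
pose x k := u (M k.+1) - u (M k).
have lx k : L2 (x k) by exact: L2B.
have xC k : n2 (x k) <= 1 * 2^-1 ^+ k.
  by rewrite mul1r; apply: HN => //; exact: leq_trans (NM k) (MM k).
have [f [lf fx aex]] := L2_series ler01 lx xC.
have tel n : \sum_(i < n) x i = u (M n) - u (M 0%N).
  elim: n => [|n IH]; first by rewrite big_ord0 subrr.
  by rewrite big_ord_recr/= IH /x addrC addrA subrK.
pose h := f + u (M 0%N).
have lh : L2 h by exact: L2D.
have hM n : n2 (h - u (M n)) <= 2 * 2^-1 ^+ n.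
  have := fx n; rewrite tel mulr1; congr (n2 _ <= _).
  by rewrite /h opprB addrA.
exists h; split => //.
- apply/cvgrPdist_le => e e0.
  have e2 : 0 < e / 2 by lra.
  have [N0 HN0] := uC _ e2.
  have g0 : 2 * 2^-1 ^+ n @[n --> \oo] --> (0 : R).
    apply: (@geom_cvg0 _ 2) => n; rewrite lexx andbT mulr_ge0// exprn_ge0//.
  have [k kN0 ke] : exists2 k, (N0 <= k)%N & 2 * 2^-1 ^+ k <= e / 2 :> R.
    have /cvgrPdist_le/(_ _ e2) g1 := g0.
    near \oo => k; exists k; first by near: k; exact: nbhs_infty_ge.
    have : `|0 - 2 * 2^-1 ^+ k| <= e / 2 :> R by near: k.
    by rewrite sub0r normrN; apply: le_trans; exact: ler_norm.
  near=> n; rewrite sub0r normrN ger0_norm ?nrm2_ge0//.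
  apply: le_trans (nrm2B lh (lu (M k)) (lu n)) _.
  have h1 := le_trans (hM k) ke.
  have h2 : n2 (u (M k) - u n) <= e / 2.
    apply: HN0; first exact: leq_trans kN0 (kM k).
    by near: n; exact: nbhs_infty_ge.
  by move: (n2 _) (n2 _) h1 h2; clear => p q; lra.
- exists M => //; move: aex; apply: ae_imp => z hz.
  have -> : (fun k => u (M k) z) = fun k => \sum_(i < k) x i z + u (M 0%N) z.
    apply/funext => k; have := congr1 (fun F => F z) (tel k); rewrite fct_sumE => ->.
    by rewrite !fctE subrK.
  by apply: cvgD => //; exact: cvg_cst.
Unshelve. all: by end_near. Qed.

Lemma ip_sq_diff f g : L2 f -> L2 g -> n2 (f - g) ^+ 2 = ip f f - 2 * ip f g + ip g g.
Proof.
move=> lf lg; have lfg := L2B lf lg.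
rewrite L2s_sq// ipBl// (ipC f) (ipC g) !ipBl// (ipC g f); ring.
Qed.

(** Expand both squares and use [conv_energy] three times; the Poisson part, itself a square, is
    dropped. Nonnegativity of the left side then says that the energy is midpoint convex. *)
Lemma energy_dist f e d : L1 f -> 0 < e -> 0 < d ->
  n2 (conv (Qk e) f - conv (Qk d) f) ^+ 2 <=
  2 * pi * (energy f (e + e) + energy f (d + d) - 2 * energy f (e + d)).
Proof.
move=> lf e0 d0.
have Qe := conv_L2 (Qk_good e0) lf; have Qd := conv_L2 (Qk_good d0) lf.
have Pe := conv_L2 (Pk_good e0) lf; have Pd := conv_L2 (Pk_good d0) lf.
have h1 := conv_energy lf e0 e0; have h2 := conv_energy lf d0 d0; have h3 := conv_energy lf e0 d0.
have h4 := ip_sq_diff Qe Qd; have h5 := ip_sq_diff Pe Pd.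
have h6 := sqr_ge0 (n2 (conv (Pk e) f - conv (Pk d) f)).
rewrite h5 in h6; rewrite h4.
rewrite (_ : 2 * pi * (_ - _) = 2 * pi * energy f (e + e) + 2 * pi * energy f (d + d) -
  2 * (2 * pi * energy f (e + d))); last by ring.
rewrite -h1 -h2 -h3.
move: h6; move: (ip _ _) (ip _ _) (ip _ _) (ip _ _) (ip _ _) (ip _ _); clear => *; lra.
Qed.

(* Midpoint convexity and boundedness force monotonicity. *)
Lemma energy_mono f s r : L1 f -> L2 f -> 0 < s -> 0 < r -> energy f (s + r) <= energy f s.
Proof.
move=> lf l2f s0 r0; rewrite leNgt; apply/negP => lt.
pose v n := energy f (s + n%:R * r).
have sn n : 0 < s + n%:R * r by rewrite ltr_wpDr// mulr_ge0// ltW.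
have conv2 n : v n.+1 - v n <= v n.+2 - v n.+1.
  (* With halves of [s + n r] and [s + (n + 2) r] as parameters, [e + e], [e + d] and [d + d] are
     three consecutive points of the progression. *)
  have e0 : 0 < (s + n%:R * r) / 2 by rewrite divr_gt0.
  have d0 : 0 < (s + n.+2%:R * r) / 2 by rewrite divr_gt0.
  have := le_trans (sqr_ge0 _) (energy_dist lf e0 d0).
  have -> : (s + n%:R * r) / 2 + (s + n%:R * r) / 2 = s + n%:R * r by field.
  have -> : (s + n.+2%:R * r) / 2 + (s + n.+2%:R * r) / 2 = s + n.+2%:R * r by field.
  have -> : (s + n%:R * r) / 2 + (s + n.+2%:R * r) / 2 = s + n.+1%:R * r.
    by rewrite -!natr1; field.
  rewrite pmulr_rge0; last by rewrite mulr_gt0// pi_gt0.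
  rewrite -/(v n) -/(v n.+1) -/(v n.+2); move: (v n) (v n.+1) (v n.+2); clear => *; lra.
pose del := v 1%N - v 0%N.
have del0 : 0 < del by rewrite /del /v mul0r mul1r addr0 subr_gt0.
have step n : del <= v n.+1 - v n by elim: n => // n IH; exact: le_trans (conv2 n).
have lin n : v 0%N + n%:R * del <= v n.
  elim: n => [|n IH]; first by rewrite mul0r addr0.
  have := step n; rewrite -natr1 mulrDl mul1r; move: IH.
  by move: (n%:R * del) => q; lra.
have bd n : `|v n| <= pi * n2 f ^+ 2 by exact: energy_le.
pose B := pi * n2 f ^+ 2.
have B0 : 0 <= B by exact: le_trans (normr_ge0 _) (bd 0%N).
(* So many increments of at least [del] exceed [3 * B], whereas two values bounded by [B] differ by
   at most [2 * B]. *)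
pose n := (Num.truncn (3 * B / del)).+1.
have hn : 3 * B / del < n%:R.
  have := truncn_itv (_ : 0 <= 3 * B / del); rewrite -/n => /(_ _)/andP[]//.
  by apply: divr_ge0 (ltW del0); exact: mulr_ge0 (ler0n R 3) B0.
rewrite ltr_pdivrMr// in hn.
have := lin n; have := bd n; have := bd 0%N; rewrite -/B !ler_norml => /andP[h1 _] /andP[_ h2].
by move: hn h1 h2; move: (v n) (v 0%N) (_ * del) => p q t; lra.
Qed.

Definition epsn (n : nat) : R := 2^-1 ^+ n.

Lemma epsn_gt0 n : 0 < epsn n. Proof. by rewrite exprn_gt0. Qed.

Lemma epsn_cvg : epsn n @[n --> \oo] --> (0 : R).
Proof. by apply: (@geom_cvg0 _ 1) => n; rewrite mul1r lexx andbT exprn_ge0. Qed.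

Lemma nrm2_cvg f (u : nat -> R -> R) c : L2 f -> (forall n, L2 (u n)) ->
  n2 (f - u n) @[n --> \oo] --> (0 : R) -> (forall n, n2 (u n) <= c) -> n2 f <= c.
Proof.
move=> lf lu cv uc; apply/ler_addgt0Pr => e e0.
have /cvgrPdist_le/(_ _ e0) cv1 := cv.
near \oo => n.
have h1 : n2 (f - u n) <= e.
  have : `|0 - n2 (f - u n)| <= e by near: n.
  by rewrite sub0r normrN; apply: le_trans; exact: ler_norm.
have h2 : n2 f <= n2 (f - u n) + n2 (u n).
  rewrite -[in leLHS](subrK (u n) f); exact: (@nrmD _ _ L2s _ _ (L2B lf (lu n)) (lu n)).
by rewrite addrC; apply: le_trans h2 _; exact: lerD.
Unshelve. all: by end_near. Qed.

(** Taking [d = e] in [conv_energy] bounds the square by [2 * pi * energy f (e + e)], hence by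
    [2 * pi^2 * n2 f ^ 2]; the stated constant is rounded up from the square root. *)
Lemma conv_Q_nrm f e : L1 f -> L2 f -> 0 < e -> n2 (conv (Qk e) f) <= 2 * pi * n2 f.
Proof.
move=> lf l2f e0; have pi0 := @pi_ge0 R.
have Qe := conv_L2 (Qk_good e0) lf; have Pe := conv_L2 (Pk_good e0) lf.
have h1 := conv_energy lf e0 e0.
have h2 := le_trans (ler_norm _) (energy_le lf l2f (addr_gt0 e0 e0)).
have h3 : ip (conv (Qk e) f) (conv (Qk e) f) <= 2 * pi * energy f (e + e).
  by rewrite -h1 lerDl ip_ge0.
rewrite -(@ler_pXn2r _ 2)// ?nnegrE ?mulr_ge0 ?nrm2_ge0// L2s_sq//.
apply: le_trans h3 _.
apply: (@le_trans _ _ (2 * pi * (pi * n2 f ^+ 2))); first by rewrite ler_wpM2l// mulr_ge0.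
have := sqr_ge0 (pi * n2 f); rewrite !exprMn.
move: (n2 f) (@pi R); clear => p q; nra.
Qed.

Lemma conv_Q_limit f : L1 f -> L2 f ->
  exists h, [/\ L2 h, n2 (h - conv (Qk (epsn n)) f) @[n --> \oo] --> (0 : R),
    n2 h <= 2 * pi * n2 f &
    exists2 M : nat -> nat, (forall k, (k <= M k)%N) &
      {ae mu, forall x, conv (Qk (epsn (M k))) f x @[k --> \oo] --> h x}].
Proof.
move=> lf l2f.
have lQ n : L2 (conv (Qk (epsn n)) f) by exact: conv_L2 (Qk_good (epsn_gt0 n)) lf.
have mono s t : 0 < s -> s <= t -> energy f t <= energy f s.
  move=> s0; rewrite le_eqVlt => /predU1P[->//|st].
  rewrite -(subrKC s t) energy_mono// subr_gt0//.
have mon : {homo (fun n => energy f (epsn n)) : m n / (m <= n)%N >-> m <= n}.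
  move=> m n mn; apply: mono; first exact: epsn_gt0.
  by rewrite /epsn ler_wiXn2l//; lra.
have cvA : cvgn (fun n => energy f (epsn n)).
  apply: nondecreasing_is_cvgn => //; exists (pi * n2 f ^+ 2) => _ [n _ <-].
  by apply: le_trans (ler_norm _) _; exact: energy_le (epsn_gt0 n).
have [h [lh hQ [M kM Mh]]] : exists h, [/\ L2 h,
    n2 (h - conv (Qk (epsn n)) f) @[n --> \oo] --> (0 : R) &
    exists2 M : nat -> nat, (forall k, (k <= M k)%N) &
      {ae mu, forall x, conv (Qk (epsn (M k))) f x @[k --> \oo] --> h x}].
  apply: L2_cauchy => // e e0.
  set l := limn (fun n => energy f (epsn n)) in cvA.
  (* The right side of [energy_dist] will be at most [2 * pi] times twice the gap
     [l - energy f (epsn N)], so this tolerance makes it at most [e^2]. *)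
  have r0 : 0 < e ^+ 2 / (4 * pi) by rewrite divr_gt0 ?mulr_gt0 ?exprn_gt0// pi_gt0.
  have /cvgrPdist_le/(_ _ r0)[N _ HN] := cvA.
  have Al s : 0 < s -> energy f s <= l.
    move=> s0; near \oo => n; apply: (@le_trans _ _ (energy f (epsn n))).
      apply: mono; first exact: epsn_gt0.
      apply: ltW; near: n.
      have /cvgrPdist_lt/(_ _ s0) := epsn_cvg; apply: filterS => n.
      by rewrite sub0r normrN gtr0_norm// epsn_gt0.
    exact: (nondecreasing_cvgn_le mon).
  exists N.+1 => m n Nm Nn.
  rewrite -(@ler_pXn2r _ 2)// ?nnegrE ?nrm2_ge0 ?(ltW e0)//.
  apply: le_trans (energy_dist lf (epsn_gt0 m) (epsn_gt0 n)) _.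
  have hN : l - energy f (epsn N) <= e ^+ 2 / (4 * pi).
    by apply: le_trans (ler_norm _) _; exact: (HN N (leqnn N)).
  (* Beyond [N] two parameters add up to at most [epsn N], so the mixed energy is at least the
     energy at [epsn N]. *)
  have eh k : (N.+1 <= k)%N -> epsn k <= epsn N / 2.
    by move=> Nk; rewrite -[_ / 2]/(epsn N * 2^-1) /epsn -exprSr ler_wiXn2l//; lra.
  have h1 : energy f (epsn N) <= energy f (epsn m + epsn n).
    apply: mono; first by rewrite addr_gt0// epsn_gt0.
    by have := eh _ Nm; have := eh _ Nn; lra.
  have h2 := Al _ (addr_gt0 (epsn_gt0 m) (epsn_gt0 m)).
  have h3 := Al _ (addr_gt0 (epsn_gt0 n) (epsn_gt0 n)).
  have pi0 : 0 < @pi R := pi_gt0 R.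
  have pi4 : 4 * pi != 0 :> R by rewrite mulf_neq0// gt_eqF.
  have -> : e ^+ 2 = 2 * pi * (2 * (e ^+ 2 / (4 * pi))).
    rewrite (_ : 2 * pi * (2 * _) = e ^+ 2 / (4 * pi) * (4 * pi)); last by ring.
    by rewrite divfK.
  rewrite ler_pM2l ?mulr_gt0//.
  clear Al HN cvA; clearbody l; move: hN h1 h2 h3.
  by move: (energy f _) (energy f _) (energy f _) (energy f _) (_ / _) => *; lra.
exists h; split => //; last by exists M.
by apply: (nrm2_cvg lh lQ hQ) => n; exact: conv_Q_nrm (epsn_gt0 n).
Unshelve. all: by end_near. Qed.

End conjugate_limit.

(** * Derivatives of conjugate Poisson integrals, and reflections of the line *)

Section conjugate_derivative.
Context {R : realType}.
Implicit Types (f g h w u K L F G : R -> R) (a b c d e s x y z : R).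
Local Notation mu := (@lebesgue_measure R).
Local Notation n2 := (nrm L2s).

Definition dQk e s := (e ^+ 2 - s ^+ 2) / (s ^+ 2 + e ^+ 2) ^+ 2.

Lemma is_derive_Qk e s : 0 < e -> is_derive s (1 : R) (Qk e) (dQk e s).
Proof.
move=> e0; have D0 := ker_den s e0.
have dq : is_derive s (1 : R) (fun s => s ^+ 2 + e ^+ 2) (2 * s).
  apply: (@is_derive_quad _ _ _ _ 1) => h; rewrite mul1r.
  by rewrite (_ : _ - _ = h ^+ 2) ?ger0_norm ?sqr_ge0//; ring.
have dv := @is_deriveV R (fun s => s ^+ 2 + e ^+ 2) s _ 1 (lt0r_neq0 D0) dq.
refine (is_derive_eq (is_deriveM (is_derive_id s (1 : R)) dv) _).
rewrite -![_ *: _]/(_ * _) /dQk mulr1.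
by field; rewrite gt_eqF.
Qed.

Lemma continuous_dQk e : 0 < e -> continuous (dQk e).
Proof.
move=> e0 s; apply: cvgM.
  apply: cvgB; first exact: cvg_cst.
  by under eq_fun do rewrite expr2; apply: cvgM; exact: cvg_id.
apply: cvgV; first by rewrite expf_neq0// gt_eqF// ker_den.
by under eq_fun do rewrite expr2; apply: cvgM; exact: continuous_den.
Qed.

Lemma dQk_le e s : 0 < e -> `|dQk e s| <= e ^- 2.
Proof.
move=> e0; have D0 := ker_den s e0; have e2 : 0 < e ^+ 2 by rewrite exprn_gt0.
rewrite /dQk normrM normfV (gtr0_norm (exprn_gt0 2 D0)) ler_pdivrMr ?exprn_gt0//.
rewrite mulrC ler_pdivlMr//.
have h : `|e ^+ 2 - s ^+ 2| <= s ^+ 2 + e ^+ 2.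
  by have := sqr_ge0 s; rewrite ler_norml => s2; apply/andP; split; lra.
rewrite expr2; apply: ler_pM => //; first exact: ltW.
by rewrite lerDr sqr_ge0.
Qed.

Lemma AC_Qk_sub e x : 0 < e -> AC (fun y => Qk e (x - y)) (fun y => - dQk e (x - y)).
Proof.
move=> e0; apply: AC_FTC => [y|y].
  apply: cvgN; apply: (cvg_comp (fun y => x - y) (dQk e)); last exact: continuous_dQk.
  by apply: cvgB; [exact: cvg_cst|exact: cvg_id].
have dl : is_derive y (1 : R) (fun y => x - y) (- 1).
  by apply: (@is_derive_quad _ _ _ _ 0) => h; rewrite (_ : _ - _ = 0) ?normr0 ?mul0r//; ring.
have := @is_derive1_comp R (Qk e) (fun y => x - y) y _ _ (is_derive_Qk (x - y) e0) dl.
by rewrite mulrN1.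
Qed.

Lemma AC_Qk e : 0 < e -> AC (Qk e) (dQk e).
Proof. by move=> e0; apply: AC_FTC => [|s]; [exact: continuous_dQk|exact: is_derive_Qk]. Qed.

(** The class to which a product of two [H^1] functions belongs: a Sobolev function that is
    integrable together with its derivative. Integrability makes convolutions absolutely
    convergent. *)
Definition nice f F g := [/\ H1rep f F g, L1 f & L1 g].

Lemma nice_L1F f F g : nice f F g -> L1 F.
Proof.
move=> [[_ fF ACF _] lf _]; apply: L1_ae fF lf.
by apply: continuous_meas; exact: AC_cont ACF.
Qed.

Lemma conv_ae K f F x (M N : R) : good_kernel M N K -> measurable_fun setT f ->
  measurable_fun setT F -> aeeq f F -> conv K f x = conv K F x.
Proof.
move=> [cK _ _ _] mf mF fF; apply: Int_ae.
- by apply: measurable_funM => //; exact: meas_shift'.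
- by apply: measurable_funM => //; exact: meas_shift'.
- by apply: aeeqM => //; exact: aeeq_refl.
Qed.

Lemma cvg_mul_Qk (A : set_system R) (FA : Filter A) e x F (B : R) : 0 < e ->
  (forall y, `|F y| <= B) -> (forall C, \forall y \near A, C <= `|y|) ->
  F y * Qk e (x - y) @[y --> A] --> (0 : R).
Proof.
move=> e0 FB Aoo; have B0 : 0 <= B := le_trans (normr_ge0 _) (FB 0).
apply/cvgrPdist_le => r r0; near=> y.
rewrite sub0r normrN normrM.
have hy : B / r + 1 + `|x| <= `|y| by near: y; exact: Aoo.
have Br : 0 <= B / r by rewrite divr_ge0// ltW.
have hxy : B / r + 1 <= `|x - y|.
  by have := lerB_dist y x; rewrite distrC; lra.
have t0 : 0 < `|x - y| by lra.
have q1 := Qk_mul_le (x - y) e0.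
have q2 : `|Qk e (x - y)| <= `|x - y|^-1 by rewrite -(mul1r _^-1) ler_pdivlMr.
apply: (@le_trans _ _ (B * `|x - y|^-1)); first exact: ler_pM.
rewrite ler_pdivrMr// -ler_pdivrMl// mulrC; lra.
Unshelve. all: by end_near. Qed.

(** Integration by parts over the line; the boundary terms vanish because [F] is bounded and [Qk e]
    decays. *)
Lemma conv_Qk_deriv f F g e x : nice f F g -> 0 < e ->
  conv (dQk e) F x = conv (Qk e) g x.
Proof.
move=> nf e0; have [rf lf lg] := nf; have lF := nice_L1F nf; have [_ _ ACF _] := rf.
have cdQ := continuous_dQk e0.
have l1 : L1 (fun y => dQk e (x - y) * F y).
  by apply: (L1_bdd (meas_shift' x cdQ) (fun y => dQk_le _ e0)).
have l2 : L1 (fun y => Qk e (x - y) * g y) := conv_L1 x (Qk_good e0) lg.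
have ACp := AC_mul ACF (AC_Qk_sub x e0).
have lp : L1 (fun y => g y * Qk e (x - y) + F y * - dQk e (x - y)).
  rewrite (_ : (fun _ => _) = fun y => Qk e (x - y) * g y - dQk e (x - y) * F y).
    exact: L1B.
  by apply/funext => y; ring.
have B y := sup_bound y rf.
have z1 : F y * Qk e (x - y) @[y --> +oo] --> (0 : R).
  apply: cvg_mul_Qk => // C; near=> y; apply: le_trans (ler_norm y).
  by near: y; exact: nbhs_pinfty_ge (num_real _).
have z2 : F y * Qk e (x - y) @[y --> -oo] --> (0 : R).
  apply: cvg_mul_Qk => // C; near=> y; rewrite -normrN; apply: le_trans (ler_norm (- y)).
  by rewrite lerNr; near: y; exact: nbhs_ninfty_le (num_real _).
have := Int_AC ACp lp z1 z2; rewrite subrr.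
rewrite (_ : (fun y => _ + _) = fun y => Qk e (x - y) * g y - dQk e (x - y) * F y); last first.
  by apply/funext => y; ring.
by rewrite IntB// => /eqP; rewrite subr_eq0 => /eqP.
Unshelve. all: by end_near. Qed.

(** Convolution with [Qk e] commutes with the derivative. Fubini over []a, b]] proves the integrated
    identity required by [AC], in place of differentiation under the integral sign. *)
Lemma conv_Qk_rep f F g e : nice f F g -> 0 < e ->
  H1rep (conv (Qk e) F) (conv (Qk e) F) (conv (Qk e) g).
Proof.
move=> nf e0; have [rf lf lg] := nf; have lF := nice_L1F nf.
have gQ := Qk_good e0; have cdQ := continuous_dQk e0.
have l2 := conv_L2 gQ lF; have l2g := conv_L2 gQ lg.
split => //; first exact: aeeq_refl.
split; first exact: L2_loc.
move=> a b ab.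
have ACQ := AC_Qk e0.
rewrite /conv -IntB; [|exact: conv_L1 gQ lF|exact: conv_L1 gQ lF].
have l1 y : L1 (fun x => \1_(`]a, b]) x * dQk e (x - y)).
  by apply: locL1_cont; exact: AC_shift_cont.
have l1c : L1 (fun x => \1_(`]a, b]) x * e ^- 2).
  by apply: locL1_cont => x; exact: cvg_cst.
have [|eq _ _] := @conv_dual R (dQk e) F (\1_(`]a, b])) (e ^- 2) (e ^- 2 * (b - a)) cdQ
   (fun s => dQk_le s e0) lF (measurable_indic_oc a b) l1.
  move=> y; rewrite -itg_cst//; apply: Int_le => //; first exact: L1_norm.
  move=> x; rewrite normrM indic_oc; case: ifP => _; rewrite ?normr1 ?normr0 ?mul0r// !mul1r.
  exact: dQk_le.
rewrite /itg; transitivity (Int (fun x => \1_(`]a, b]) x * conv (dQk e) F x)); last first.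
  by congr Int; apply/funext => x; rewrite (conv_Qk_deriv x nf e0).
rewrite eq; congr Int; apply/funext => y.
rewrite -mulrBl mulrC; congr (_ * _).
have ACs : AC (fun x => Qk e (x - y)) (fun x => dQk e (x - y)).
  have := AC_scale (-1) (AC_Qk_sub y e0); congr AC; apply/funext => x.
    by rewrite -opprB QkN mulN1r opprK.
  by rewrite mulN1r opprK -[in RHS]opprB /dQk sqrrN.
by rewrite ACs.2.
Qed.

(** The image of Lebesgue measure under [y |-> x - y] gives an interval its length, although the
    preimage of []a, b]] is closed on the other side; uniqueness of the measure concludes. *)
Lemma Int_refl x h : L1 h -> L1 (fun y => h (x - y)) /\ Int (fun y => h (x - y)) = Int h.
Proof.
move=> lh; have mh := L1_meas lh; pose T y : measurableTypeR R := x - y.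
have mT : measurable_fun [set: measurableTypeR R] T by exact: measurable_funB.
pose nu := measure_function_pushforward__canonical__measure_function_Measure mu mT.
have push A : measurable A -> mu A = nu A.
  apply: lebesgue_measure_unique => _ [[a b] _ <-] /=.
  rewrite /pushforward (_ : _ @^-1` _ = `[x - b, x - a[%classic); last first.
    by apply/seteqP; split => y /=; rewrite !in_itv/= /T => /andP[h1 h2]; apply/andP; split; lra.
  by rewrite !lebesgue_measure_itv/= !lte_fin ltrD2l ltrN2; case: ifP => // _; rewrite -!EFinB; congr EFin; ring.
have mh' : measurable_fun [set: measurableTypeR R] (EFin \o h) by apply/measurable_EFinP.
have lT : L1 (fun y => h (x - y)).
  apply/integrableP; split.
    by apply/measurable_EFinP; apply: (measurableT_comp mh).
  have mh2 : measurable_fun [set: measurableTypeR R] (fun y => `|(h y)%:E|)%E.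
    by apply: measurableT_comp.
  have := ge0_integral_pushforward mT mu measurableT mh2 (fun y _ => abse_ge0 _).
  rewrite preimage_setT => <-.
  rewrite (_ : (\int[_]_(_ in _) _)%E = (\int[mu]_y `|(h y)%:E|)%E); last first.
    transitivity (\int[nu]_y `|(h y)%:E|)%E => //.
    by apply: eq_measure_integral => A mA _; exact/esym/push.
  by have /integrableP[] := lh.
split => //; rewrite !IntE /Rintegral; congr fine.
transitivity (\int[nu]_y (h y)%:E)%E; last first.
  by apply: eq_measure_integral => A mA _; exact/esym/push.
by rewrite (integral_pushforward mT (D := setT) mh')// preimage_setT.
Qed.

End conjugate_derivative.

(** * The principal value at every point *)

Section principal_value.
Context {R : realType}.
Implicit Types (f g h w u K L F G : R -> R) (a b c d e s x y z : R).
Local Notation mu := (@lebesgue_measure R).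
Local Notation n2 := (nrm L2s).

(* A smooth minorant of [1 / (2 * sqrt |s|)] with antiderivative [(s^2 + c^2)^(1/4)]. *)
Definition qroot c s := Num.sqrt (Num.sqrt (s ^+ 2 + c ^+ 2)).
Definition dqroot c s := s / (2 * Num.sqrt (s ^+ 2 + c ^+ 2) * qroot c s).

Lemma AC_qroot c : 0 < c -> AC (qroot c) (dqroot c).
Proof.
move=> c0; have D0 s := ker_den s c0.
have S0 s : 0 < Num.sqrt (s ^+ 2 + c ^+ 2) by rewrite sqrtr_gt0.
have Q0 s : 0 < qroot c s by rewrite sqrtr_gt0.
have cS : continuous (fun s => Num.sqrt (s ^+ 2 + c ^+ 2) : R).
  move=> s; apply: (cvg_comp _ Num.sqrt); first exact: continuous_den.
  exact: sqrt_continuous.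
have cQ : continuous (qroot c).
  by move=> s; apply: (cvg_comp _ Num.sqrt); [exact: cS|exact: sqrt_continuous].
apply: AC_FTC => s.
  apply: cvgM; first exact: cvg_id.
  apply: cvgV; first by rewrite gt_eqF// !mulr_gt0.
  by apply: cvgM; [apply: cvgM; [exact: cvg_cst|exact: cS]|exact: cQ].
have dq : is_derive s (1 : R) (fun s => s ^+ 2 + c ^+ 2) (2 * s).
  apply: (@is_derive_quad _ _ _ _ 1) => h; rewrite mul1r.
  by rewrite (_ : _ - _ = h ^+ 2) ?ger0_norm ?sqr_ge0//; ring.
have d1 := @is_derive1_comp R Num.sqrt (fun s => s ^+ 2 + c ^+ 2) s _ _ (is_derive1_sqrt (D0 s)) dq.
have d2 := @is_derive1_comp R Num.sqrt (Num.sqrt \o (fun s => s ^+ 2 + c ^+ 2)) s _ _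
  (is_derive1_sqrt (S0 s)) d1.
refine (is_derive_eq d2 _); rewrite /dqroot -/(qroot c s).
have := Q0 s; have := S0 s; rewrite /=; move: (qroot c s) (Num.sqrt _) => q r r0 q0.
by field; rewrite !gt_eqF.
Qed.

Definition rho s : R := (Num.sqrt `|s|)^-1.

Definition chi s : R := if `|s| < 1 then 1 else 0.

Lemma measurable_chi : measurable_fun setT chi.
Proof. by apply: measurable_fun_if => //; exact: measurable_fun_ltr. Qed.

Lemma chi_le s : 0 <= chi s <= \1_(`]-1, 1]) s.
Proof.
rewrite /chi indic_oc; case: ifPn => [|_]; last by case: ifP; rewrite lexx ?ler01.
by rewrite ltr_norml => /andP[h1 h2]; rewrite h1 (ltW h2) ler01 lexx.
Qed.

Lemma Qk_cvg s : Qk (epsn n) s @[n --> \oo] --> s^-1.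
Proof.
have [->|s0] := eqVneq s 0.
  rewrite invr0 (_ : (fun _ => _) = fun=> 0); first exact: cvg_cst.
  by apply/funext => n; rewrite /Qk mul0r.
rewrite (_ : s^-1 = s / (s ^+ 2 + 0 * 0)); last by rewrite mul0r addr0; field.
apply: cvgM; first exact: cvg_cst.
apply: cvgV; first by rewrite mul0r addr0 expf_neq0.
apply: cvgD; first exact: cvg_cst.
by under eq_fun do rewrite expr2; apply: cvgM; exact: epsn_cvg.
Qed.

Lemma measurable_inv : measurable_fun setT (fun s : R => s^-1).
Proof.
have mQ n : measurable_fun setT (Qk (epsn n) : R -> R).
  by apply: continuous_meas; exact: continuous_Qk (epsn_gt0 n).
apply: (@measurable_fun_cvg _ _ _ setT (fun n => Qk (epsn n)) (fun s : R => s^-1) mQ) => s _; exact: Qk_cvg.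
Qed.

Lemma measurable_rho : measurable_fun setT rho.
Proof.
apply: (measurableT_comp (f := fun t : R => t^-1)); first exact: measurable_inv.
apply: (measurableT_comp (f := @Num.sqrt R)); last exact: continuous_meas (@norm_continuous _ R).
by apply: continuous_meas; exact: sqrt_continuous.
Qed.

Lemma dqroot_norm c s : 0 < c ->
  `|dqroot c s| = `|s| / (2 * Num.sqrt (s ^+ 2 + c ^+ 2) * qroot c s).
Proof. move=> c0; rewrite /dqroot normrM normfV; congr (_ * _^-1); apply: ger0_norm.
by rewrite !mulr_ge0 ?sqrtr_ge0. Qed.

(** With [c = 1 / (n + 1)], the functions [2 |dqroot c|] increase to [rho]. On each half of the
    interval the integral is twice an increment of [qroot], at most 4, whence the bound 8. *)
Lemma rho_L1 : L1 (fun s => \1_(`]-1, 1]) s * rho s).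
Proof.
pose c n : R := n.+1%:R^-1.
have c0 n : 0 < c n by rewrite invr_gt0.
have D0 n s : 0 < s ^+ 2 + c n ^+ 2 := ker_den s (c0 n).
have lq n := (AC_qroot (c0 n)).1.
have l2 n : locL1 (fun s => 2 * `|dqroot (c n) s|).
  by apply: locL1Z => a b; have := L1_norm (lq n a b); congr L1; apply/funext => s;
    rewrite normrM indic_oc; case: ifP; rewrite ?normr1 ?normr0 ?mul0r.
have sq4 n : qroot (c n) (-1) <= 2 /\ qroot (c n) 1 <= 2.
  rewrite /qroot sqrrN; suff h : Num.sqrt (Num.sqrt (1 ^+ 2 + c n ^+ 2)) <= 2 by [].
  have -> : 2 = Num.sqrt (Num.sqrt ((2 ^+ 2) ^+ 2)) :> R.
    by rewrite sqrtr_sqr ger0_norm ?exprn_ge0// sqrtr_sqr ger0_norm.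
  apply: ler_wsqrtr; apply: ler_wsqrtr.
  have : c n ^+ 2 <= 1 by rewrite expr_le1// ?invf_le1 ?ler1n// ltW.
  by lra.
apply: (Int_mct (F := fun n s => \1_(`]-1, 1]) s * (2 * `|dqroot (c n) s|)) (M := 8) _ _ _ _ _).1.
- by move=> n; exact: l2.
- by move=> n s; rewrite indic_oc mulr_ge0 ?mulr_ge0//; case: ifP.
- move=> s m n mn /=.
  apply: ler_wpM2l; first by rewrite indic_oc; case: ifP.
  apply: ler_wpM2l => //; rewrite !dqroot_norm//; apply: ler_wpM2l => //.
  have cc : c n ^+ 2 <= c m ^+ 2.
    by rewrite lerXn2r ?nnegrE ?(ltW (c0 _))// lef_pV2 ?posrE// ler_nat.
  have ss : Num.sqrt (s ^+ 2 + c n ^+ 2) <= Num.sqrt (s ^+ 2 + c m ^+ 2).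
    by apply: ler_wsqrtr; rewrite lerD2l.
  rewrite lef_pV2 ?posrE ?mulr_gt0 ?sqrtr_gt0//.
  apply: ler_pM; rewrite ?mulr_ge0 ?sqrtr_ge0//.
    by rewrite ler_pM2l.
  exact: ler_wsqrtr.
- move=> s; apply: cvgM; first exact: cvg_cst.
  have [->|s0] := eqVneq s 0.
    rewrite /rho normr0 sqrtr0 invr0.
    rewrite (_ : (fun _ => _) = fun=> 0); first exact: cvg_cst.
    by apply/funext => n; rewrite /dqroot mul0r normr0 mulr0.
  have sp : 0 < `|s| by rewrite normr_gt0.
  have cc : Num.sqrt (s ^+ 2 + c n ^+ 2) @[n --> \oo] --> `|s|.
    rewrite -sqrtr_sqr; apply: (cvg_comp _ Num.sqrt); last exact: sqrt_continuous.
    have h : c n @[n --> \oo] --> (0 : R) by exact: cvg_harmonic.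
    have : s ^+ 2 + c n * c n @[n --> \oo] --> s ^+ 2 + 0 * 0.
      by apply: cvgD; [exact: cvg_cst|by apply: cvgM; exact: h].
    by rewrite mulr0 addr0.
  have cq : qroot (c n) s @[n --> \oo] --> Num.sqrt `|s|.
    by apply: (cvg_comp _ Num.sqrt cc); exact: sqrt_continuous.
  have -> : rho s = 2 * (`|s| / (2 * `|s| * Num.sqrt `|s|)).
    rewrite /rho; have q0 : 0 < Num.sqrt `|s| by rewrite sqrtr_gt0.
    by field; rewrite !gt_eqF.
  rewrite (_ : (fun _ => _) = fun n => 2 * (`|s| / (2 * Num.sqrt (s ^+ 2 + c n ^+ 2) * qroot (c n) s))).
    apply: cvgM; first exact: cvg_cst.
    apply: cvgM; first exact: cvg_cst.
    apply: cvgV; first by rewrite !mulf_neq0// gt_eqF// sqrtr_gt0.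
    by apply: cvgM => //; apply: cvgM => //; exact: cvg_cst.
  by apply/funext => n; rewrite dqroot_norm.
- move=> n; rewrite -/(itg (fun s => 2 * `|dqroot (c n) s|) (-1) 1) (@itg_split _ _ _ 0 _ (l2 n)); [|lra|lra].
  have ACq := (AC_qroot (c0 n)).2.
  have -> : itg (fun s => 2 * `|dqroot (c n) s|) (-1) 0 = - 2 * itg (dqroot (c n)) (-1) 0.
    rewrite /itg -IntZ; last exact: lq.
    congr Int; apply/funext => s; rewrite indic_oc; case: ifPn => [/andP[_ s0]|]; last by rewrite !mul0r mulr0.
    rewrite !mul1r dqroot_norm// ler0_norm// /dqroot; ring.
  have -> : itg (fun s => 2 * `|dqroot (c n) s|) 0 1 = 2 * itg (dqroot (c n)) 0 1.
    rewrite /itg -IntZ; last exact: lq.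
    congr Int; apply/funext => s; rewrite indic_oc; case: ifPn => [/andP[s0 _]|]; last by rewrite !mul0r mulr0.
    by rewrite !mul1r dqroot_norm// gtr0_norm.
  rewrite -(ACq 0 1)// -(ACq (-1) 0); last by lra.
  have [h1 h2] := sq4 n; have : 0 <= qroot (c n) 0 by rewrite sqrtr_ge0.
  by move: h1 h2; move: (qroot _ _) (qroot _ _) (qroot _ _); clear; move=> p q r; lra.
Qed.

Lemma chi_rho_L1 : L1 (fun s => chi s * rho s).
Proof.
apply: L1_le rho_L1 _; first exact: measurable_funM measurable_chi measurable_rho.
move=> s; have /andP[c0 c1] := chi_le s.
have r0 : 0 <= rho s by rewrite invr_ge0 sqrtr_ge0.
by rewrite !ger0_norm ?mulr_ge0 ?ler_wpM2r// (le_trans c0 c1).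
Qed.

(** Cauchy-Schwarz on an interval. The exponent 1/2 is what makes [(F y - F x) / (y - x)] integrable
    near [x], with [rho] as majorant. *)
Lemma H1rep_holder f F g x y : H1rep f F g -> `|F y - F x| <= n2 g * Num.sqrt `|y - x|.
Proof.
move=> [lf fF ACF lg].
wlog xy : x y / x <= y.
  move=> h; case: (leP x y) => [|/ltW]; first exact: h.
  by rewrite distrC (distrC y); exact: h.
rewrite ACF.2// /itg -/(ip _ g) (ger0_norm (_ : 0 <= y - x)) ?subr_ge0//.
apply: le_trans (ip_le (L2_indic x y) lg) _.
rewrite mulrC ler_wpM2l ?nrm2_ge0// nrm2E; apply: ler_wsqrtr.
have -> : y - x = itg (fun=> 1) x y by rewrite itg_cst ?mul1r.
rewrite /ip /itg (_ : (fun _ => _) = fun t => \1_(`]x, y]) t * 1)//.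
by apply/funext => t; rewrite indic_oc; case: ifP; rewrite ?mul1r ?mul0r.
Qed.

Lemma Int_odd h : L1 h -> (forall s, h (- s) = - h s) -> Int h = 0.
Proof.
move=> lh hN; have [_] := Int_refl 0 lh.
rewrite (_ : (fun _ => _) = fun s => - h s); last by apply/funext => s; rewrite sub0r hN.
rewrite IntN//; move: (Int h) => t; lra.
Qed.

(* The principal value made absolutely convergent by subtracting [F x] near [x]. *)
Definition pv F x := Int (fun y => (x - y)^-1 * (F y - F x * chi (x - y))).

Lemma meas_shiftm h x : measurable_fun setT h -> measurable_fun setT (fun y => h (x - y)).
Proof. by move=> mh; apply: (measurableT_comp mh); exact: measurable_funB. Qed.

(** Serves twice, for the truncated kernel that defines [hilbert] and for [Qk], which therefore have
    the same limit. The bound [C n] may blow up; domination rests on [|K n s| |s| <= 1]. At [s = 0]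
    the limit is consistent: the inverse of 0 is 0 and oddness gives [K n 0 = 0]. *)
Lemma pv_cvg f F g x (K : nat -> R -> R) (C : nat -> R) : nice f F g ->
  (forall n, measurable_fun setT (K n)) -> (forall n s, K n (- s) = - K n s) ->
  (forall n s, `|K n s| <= C n) -> (forall n s, `|K n s| * `|s| <= 1) ->
  (forall s, K n s @[n --> \oo] --> s^-1) ->
  Int (fun y => K n (x - y) * f y) @[n --> \oo] --> pv F x.
Proof.
move=> nf mK KN KC Ks Kc; have [rf lf lg] := nf; have [_ fF ACF l2g] := rf.
have lF := nice_L1F nf; have mF := L1_meas lF.
have lchi : L1 (fun y => chi (x - y)).
  apply: (Int_refl x _).1.
  have l1 : L1 (\1_(`]-1, 1]) : R -> R).
    rewrite (_ : \1_(`]-1, 1]) = fun t => \1_(`]-1, 1]) t * 1); last by apply/funext => t; rewrite mulr1.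
    by apply: (@locL1_cont R (fun=> 1)) => t; exact: cvg_cst.
  apply: L1_le l1 _; first exact: measurable_chi.
  by move=> s; have /andP[c0 c1] := chi_le s; rewrite !ger0_norm// (le_trans c0 c1).
have mKx n : measurable_fun setT (fun y => K n (x - y)) by exact: meas_shiftm.
have split n : Int (fun y => K n (x - y) * f y) =
    Int (fun y => K n (x - y) * (F y - F x * chi (x - y))).
  have lKF : L1 (fun y => K n (x - y) * F y) by exact: L1_bdd (mKx n) (fun y => KC n _) lF.
  have lKc : L1 (fun y => K n (x - y) * chi (x - y)).
    exact: L1_bdd (mKx n) (fun y => KC n _) lchi.
  transitivity (Int (fun y => K n (x - y) * F y)).
    apply: Int_ae; [exact: measurable_funM (mKx n) (L1_meas lf)|exact: measurable_funM|].
    by apply: aeeqM => //; exact: aeeq_refl.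
  rewrite (_ : (fun y => K n (x - y) * (_ - _)) =
     fun y => K n (x - y) * F y - F x * (K n (x - y) * chi (x - y))); last first.
    by apply/funext => y; ring.
  rewrite IntB//; last exact: L1Z.
  rewrite IntZ// (_ : Int (fun y => _ * chi _) = 0) ?mulr0 ?subr0//.
  have lKc0 : L1 (fun s => K n s * chi s).
    have := (Int_refl x lKc).1; congr L1; apply/funext => s.
    by rewrite opprB addrC subrK.
  have [_ ->] := Int_refl x lKc0.
  by apply: Int_odd => // s; rewrite KN /chi normrN mulNr.
rewrite (funext split).
(* At distance at least 1 from [x] the kernel is bounded by 1, which leaves [|F y|]; nearer, the
   Hölder bound leaves [n2 g * rho]. *)
have lrho : L1 (fun y => `|F y| + n2 g * (chi (x - y) * rho (x - y))).
  apply: L1D; first exact: L1_norm.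
  by apply: L1Z; exact: (Int_refl x chi_rho_L1).1.
have mFx : measurable_fun setT (fun y => F y - F x * chi (x - y)).
  apply: measurable_funB => //; apply: measurable_funM => //.
  by apply: meas_shiftm; exact: measurable_chi.
apply: (Int_dct (g := fun y => `|F y| + n2 g * (chi (x - y) * rho (x - y))) _ _ lrho _ _).2.
- by move=> n; apply: measurable_funM.
- apply: measurable_funM => //; apply: (meas_shiftm (h := fun t : R => t^-1)).
  exact: measurable_inv.
- by apply: aeW => y; apply: cvgM; [exact: Kc|exact: cvg_cst].
- move=> n; apply: aeW => y; rewrite normrM; have g0 := nrm2_ge0 g.
  have r0 : 0 <= rho (x - y) by rewrite invr_ge0 sqrtr_ge0.
  rewrite /chi; case: ifPn => [h|]; last first.
    rewrite -leNgt => h; rewrite mulr0 subr0 mul0r mulr0 addr0 -[leRHS]mul1r.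
    apply: ler_wpM2r => //; apply: le_trans (Ks n (x - y)).
    by rewrite ler_peMr.
  rewrite mulr1 mul1r; apply: (@le_trans _ _ (n2 g * rho (x - y))); last by rewrite lerDr.
  have hol := H1rep_holder x y rf.
  have [z|z] := eqVneq (x - y) 0.
    rewrite (_ : y = x) ?subrr ?normr0 ?mulr0 ?mulr_ge0//; last by move/eqP: z; rewrite subr_eq0 => /eqP.
    by rewrite invr_ge0 sqrtr_ge0.
  have t0 : 0 < `|x - y| by rewrite normr_gt0.
  have q0 : 0 < Num.sqrt `|x - y| by rewrite sqrtr_gt0.
  apply: (@le_trans _ _ (`|K n (x - y)| * (n2 g * Num.sqrt `|x - y|))).
    by apply: ler_wpM2l => //; rewrite (distrC x).
  rewrite mulrCA; apply: ler_wpM2l => //.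
  rewrite /rho -(mul1r (_^-1)) ler_pdivlMr// -mulrA -expr2 sqr_sqrtr//.
Qed.

Definition trunc_inv e s : R := if e < `|s| then s^-1 else 0.

(** Valid at every [x]: replacing [f] by its continuous representative does not affect the truncated
    integrals. *)
Lemma hilbert_pv f F g x : nice f F g -> hilbert f x = pi^-1 * pv F x.
Proof.
move=> nf; rewrite /hilbert; congr (_ * _); apply: cvg_lim => //.
apply/cvg_at_rightP => u [u0 uc].
have mt e : measurable_fun setT (trunc_inv e).
  apply: measurable_fun_if => //; first exact: measurable_fun_ltr.
  exact: measurable_funTS measurable_inv.
have e1 e : \int[leb]_(y in [set y | e < `|x - y|]) (f y / (x - y)) =
    Int (fun y => trunc_inv e (x - y) * f y).
  rewrite -Int_indic; congr Int; apply/funext => y; rewrite indicE /trunc_inv.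
  case: ifPn => h.
    by rewrite mem_set//= mul1r mulrC.
  by rewrite memNset ?mul0r//= => h'; rewrite h' in h.
rewrite (funext (fun n => e1 (u n))).
apply: (@pv_cvg f F g x (fun n => trunc_inv (u n)) (fun n => (u n)^-1)) => //.
- move=> n s; rewrite /trunc_inv normrN invrN; case: ifP => //; rewrite oppr0//.
- move=> n s; rewrite /trunc_inv; case: ifPn => h; last by rewrite normr0 invr_ge0 ltW.
  by rewrite normfV lef_pV2 ?posrE// ?ltW// (lt_trans _ h).
- move=> n s; rewrite /trunc_inv; case: ifPn => h; last by rewrite normr0 mul0r.
  by rewrite normfV mulVf// gt_eqF// (lt_trans _ h).
- move=> s; have [->|s0] := eqVneq s 0.
    rewrite invr0 (_ : (fun _ => _) = fun=> 0); first exact: cvg_cst.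
    by apply/funext => n; rewrite /trunc_inv invr0; case: ifP.
  have sp : 0 < `|s| by rewrite normr_gt0.
  apply: cvg_near_cst; have /cvgrPdist_lt/(_ _ sp) := uc.
  apply: filterS => n; rewrite sub0r normrN => h.
  by rewrite /trunc_inv (le_lt_trans (ler_norm _) h).
Qed.

Lemma conv_Q_hilbert f F g x : nice f F g ->
  conv (Qk (epsn n)) f x @[n --> \oo] --> pi * hilbert f x.
Proof.
move=> nf; rewrite (hilbert_pv x nf) mulVKf ?gt_eqF ?pi_gt0//.
apply: (@pv_cvg f F g x (fun n => Qk (epsn n)) (fun n => (epsn n)^-1)) => //.
- by move=> n; apply: continuous_meas; exact: continuous_Qk (epsn_gt0 _).
- by move=> n s; exact: QkN.
- by move=> n s; exact: Qk_le (epsn_gt0 n).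
- by move=> n s; exact: Qk_mul_le (epsn_gt0 n).
- exact: Qk_cvg.
Qed.

End principal_value.

(** * Boundedness and moments of the Hilbert transform *)

Section hilbert_transform.
Context {R : realType}.
Implicit Types (f g h w u K L F G : R -> R) (a b c d e s x y z : R).
Local Notation mu := (@lebesgue_measure R).
Local Notation n2 := (nrm L2s).
Local Notation nH := (nrm H1s).
Local Notation D := weak_derivative.

(** The intrinsic form of [nice], stable under linear combinations, on which [hilbert] is linear at
    every point and bounded in [H^1]. *)
Definition W11 f := [/\ H1 f, L1 f & L1 (D f)].

Lemma W11_nice f : W11 f -> exists F, nice f F (D f).
Proof. by move=> [hf lf lg]; have [F rF] := H1_rep hf; exists F. Qed.

Lemma W11D f g : W11 f -> W11 g -> W11 (f + g).
Proof.
move=> [hf lf ldf] [hg lg ldg]; have [h e] := H1_add hf hg; split => //; first exact: L1D.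
apply: L1_ae (aeeq_sym e) (L1D ldf ldg); exact: L2_meas (H1_DL2 h).
Qed.

Lemma W11Z c f : W11 f -> W11 (c *: f).
Proof.
move=> [hf lf ldf]; have [h e] := H1_scale c hf; split => //; first exact: L1Z.
apply: L1_ae (aeeq_sym e) (L1Z c ldf); exact: L2_meas (H1_DL2 h).
Qed.

Lemma W11M f g : H1 f -> H1 g -> W11 (fun x => f x * g x).
Proof.
move=> hf hg; have [h e _] := H1M hf hg; split => //.
  by apply: L2_L1; exact: H1_L2.
apply: L1_ae (aeeq_sym e) (L1D _ _); first exact: L2_meas (H1_DL2 h).
  by apply: L2_L1; [exact: H1_DL2|exact: H1_L2].
by apply: L2_L1; [exact: H1_L2|exact: H1_DL2].
Qed.

Lemma hilbert_cvg f x : W11 f ->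
  conv (Qk (epsn n)) f x @[n --> \oo] --> pi * hilbert f x.
Proof. by move=> /W11_nice[F nF]; exact: conv_Q_hilbert nF. Qed.

Lemma pi_neq0 : (pi : R) != 0. Proof. by rewrite gt_eqF// pi_gt0. Qed.

Lemma hilbert_add f g : W11 f -> W11 g -> hilbert (f + g) = hilbert f + hilbert g.
Proof.
move=> wf wg; apply/funext => x; apply: (mulfI pi_neq0); rewrite [RHS]mulrDr.
have c1 : ((fun n => conv (Qk (epsn n)) f x) + (fun n => conv (Qk (epsn n)) g x)) n @[n --> \oo] -->
    pi * hilbert f x + pi * hilbert g x by apply: cvgD; exact: hilbert_cvg.
have [_ lf _] := wf; have [_ lg _] := wg; apply: (cvg_unique _ _ c1) => //.
have := hilbert_cvg (x := x) (W11D wf wg).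
rewrite (_ : (fun n => conv _ (f + g) x) =
  (fun n => conv (Qk (epsn n)) f x) + (fun n => conv (Qk (epsn n)) g x))//.
apply/funext => n; rewrite !fctE /conv -IntD.
- by congr Int; apply/funext => y; rewrite mulrDr.
- exact: conv_L1 (Qk_good (epsn_gt0 n)) lf.
- exact: conv_L1 (Qk_good (epsn_gt0 n)) lg.
Qed.

Lemma hilbert_scale c f : W11 f -> hilbert (c *: f) = c *: hilbert f.
Proof.
move=> wf; apply/funext => x; apply: (mulfI pi_neq0); rewrite [RHS]mulrCA.
have c1 : c * conv (Qk (epsn n)) f x @[n --> \oo] --> c * (pi * hilbert f x).
  by apply: cvgM; [exact: cvg_cst|exact: hilbert_cvg].
have [_ lf _] := wf; apply: (cvg_unique _ _ c1) => //.
have := hilbert_cvg (x := x) (W11Z c wf).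
rewrite (_ : (fun n => conv _ (c *: f) x) = (fun n => c * conv (Qk (epsn n)) f x))//.
apply/funext => n; rewrite /conv -IntZ; last exact: conv_L1 (Qk_good (epsn_gt0 n)) lf.
by congr Int; apply/funext => y; rewrite mulrCA.
Qed.

Lemma hilbert_meas f : W11 f -> measurable_fun setT (hilbert f).
Proof.
move=> wf; have [_ lf _] := wf.
have mQ n : measurable_fun setT (conv (Qk (epsn n)) f).
  exact: conv_meas (Qk_good (epsn_gt0 n)) lf.
have m : measurable_fun setT (fun x => pi * hilbert f x).
  apply: (@measurable_fun_cvg _ _ _ setT (fun n => conv (Qk (epsn n)) f) _ mQ) => x _.
  exact: hilbert_cvg.
rewrite (_ : hilbert f = fun x => pi^-1 * (pi * hilbert f x)); first exact: measurable_funM.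
by apply/funext => x; rewrite mulKf// pi_neq0.
Qed.

(** The L^2 limit of the convolutions agrees with the pointwise limit [pi * hilbert f] almost
    everywhere, along the subsequence of [conv_Q_limit]. *)
Lemma hilbert_L2 f : W11 f -> [/\ L2 (hilbert f),
  n2 (pi *: hilbert f - conv (Qk (epsn n)) f) @[n --> \oo] --> (0 : R) &
  n2 (hilbert f) <= 2 * n2 f].
Proof.
move=> wf; have [hf lf _] := wf; have l2f := H1_L2 hf.
have [h [lh hc hn [M kM Mh]]] := conv_Q_limit lf l2f.
have hH : aeeq h (pi *: hilbert f).
  move: Mh; apply: ae_imp => x /= c1.
  have c2 : conv (Qk (epsn (M k))) f x @[k --> \oo] --> pi * hilbert f x.
    apply: (cvg_comp M _ _ (hilbert_cvg wf)).
    apply/cvgnyPge => A; near=> k; apply: leq_trans (kM k); near: k; exact: nbhs_infty_ge.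
  exact: cvg_unique c1 c2.
have mp : measurable_fun setT (pi *: hilbert f).
  by apply: measurable_funM => //; exact: hilbert_meas.
have lp : L2 (pi *: hilbert f) := L2_ae mp hH lh.
have lH : L2 (hilbert f).
  have := L2Z pi^-1 lp; rewrite scalerA mulVf ?scale1r//; exact: pi_neq0.
have lQ n : L2 (conv (Qk (epsn n)) f) := conv_L2 (Qk_good (epsn_gt0 n)) lf.
split => //.
  rewrite (_ : (fun n => _) = fun n => n2 (h - conv (Qk (epsn n)) f))//.
  apply/funext => n; apply: nrm2_ae; [exact: L2B|exact: L2B|].
  by move: hH; apply: ae_imp => x e; rewrite !fctE e.
have p0 : 0 < pi :> R := pi_gt0 R.
rewrite (nrm2_ae lh lp hH) (@nrmZ _ _ L2s)// gtr0_norm// in hn.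
by rewrite -(ler_pM2l p0) mulrA (mulrC pi 2).
Unshelve. all: by end_near. Qed.

(** The convolutions of [f] and of its derivative with [Qk] both converge in L^2, so closedness of
    the weak derivative applies and the L^2 bound holds for each separately. *)
Lemma hilbert_H1 f : W11 f -> H1 (hilbert f) /\ nH (hilbert f) <= 2 * nH f.
Proof.
move=> wf; have [hf lf lg] := wf; have [F nF] := W11_nice wf.
have [lH Hc Hn] := hilbert_L2 wf.
have l2g := H1_DL2 hf.
have [h [lh hc hn _]] := conv_Q_limit lg l2g.
have lQ n : L2 (conv (Qk (epsn n)) f) := conv_L2 (Qk_good (epsn_gt0 n)) lf.
have wd n : weak_derivatives (conv (Qk (epsn n)) f) (conv (Qk (epsn n)) (D f)).
  rewrite (_ : conv _ f = conv (Qk (epsn n)) F); first exact: H1rep_wd (conv_Qk_rep nF (epsn_gt0 n)).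
  have [[_ fF ACF _] _ _] := nF; apply/funext => x.
  by apply: conv_ae (Qk_good (epsn_gt0 n)) (L1_meas lf) _ fF; apply: continuous_meas; exact: AC_cont ACF.
have [hp Dp] := H1_closed (L2Z pi lH) lh lQ wd Hc hc.
have p0 : 0 < pi :> R := pi_gt0 R.
have hH : H1 (hilbert f).
  have := H1Z pi^-1 hp; rewrite scalerA mulVf ?scale1r//; exact: pi_neq0.
split => //.
have DH : n2 (D (hilbert f)) <= 2 * n2 (D f).
  have e : aeeq h (pi *: D (hilbert f)).
    exact: aeeq_trans (aeeq_sym Dp) (H1_scale pi hH).2.
  rewrite (nrm2_ae lh (L2Z pi (H1_DL2 hH)) e) in hn.
  rewrite (@nrmZ _ _ L2s) ?gtr0_norm// in hn; last exact: H1_DL2.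
  by rewrite -(ler_pM2l p0) mulrA (mulrC pi 2).
rewrite -(@ler_pXn2r _ 2)// ?nnegrE ?mulr_ge0 ?nH_ge0// exprMn !nH_sq//.
have h1 : n2 (hilbert f) ^+ 2 <= (2 * n2 f) ^+ 2.
  by rewrite lerXn2r ?nnegrE ?mulr_ge0 ?nrm2_ge0.
have h2 : n2 (D (hilbert f)) ^+ 2 <= (2 * n2 (D f)) ^+ 2.
  by rewrite lerXn2r ?nnegrE ?mulr_ge0 ?nrm2_ge0.
rewrite mulrDr -!exprMn; exact: lerD.
Qed.

Lemma ip_hilbert_cvg f h : W11 f -> L2 h ->
  ip h (conv (Qk (epsn n)) f) @[n --> \oo] --> pi * ip h (hilbert f).
Proof.
move=> wf lh; have [lH Hc _] := hilbert_L2 wf; have [_ lf _] := wf.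
have lQ n : L2 (conv (Qk (epsn n)) f) := conv_L2 (Qk_good (epsn_gt0 n)) lf.
have := ip_cvg (L2Z pi lH) lQ lh Hc.
rewrite ipZl// ipC (_ : (fun n => ip _ h) = fun n => ip h (conv (Qk (epsn n)) f))//.
by apply/funext => n; rewrite ipC.
Qed.

Lemma conv_Q_anti f h e : L1 f -> L1 h -> L2 h -> 0 < e ->
  ip h (conv (Qk e) f) = - Int (fun y => f y * conv (Qk e) h y).
Proof.
move=> lf lh l2h e0; have [-> _ l1] := conv_dual2 (Qk_good e0) lf l2h.
have e1 y : f y * Int (fun x => h x * Qk e (x - y)) = - (f y * conv (Qk e) h y).
  rewrite -mulrN; congr (_ * _); rewrite /conv -IntN; last exact: conv_L1 (Qk_good e0) lh.
  by congr Int; apply/funext => x; rewrite -opprB QkN mulrN mulrC.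
rewrite (_ : (fun y => f y * Int _) = fun y => - (f y * conv (Qk e) h y)); last exact/funext.
rewrite IntN//; move: l1 => /L1N; congr L1; apply/funext => y.
by rewrite e1 opprK.
Qed.

Lemma ip_hilbert_self f : W11 f -> ip f (hilbert f) = 0.
Proof.
move=> wf; have [hf lf _] := wf; have l2f := H1_L2 hf.
have z n : ip f (conv (Qk (epsn n)) f) = 0.
  have := conv_Q_anti lf lf l2f (epsn_gt0 n).
  by rewrite -/(ip _ _); move: (ip _ _) => t; lra.
have := ip_hilbert_cvg wf l2f; rewrite (funext z) => /cvg_unique -/(_ (@Rhausdorff R) _ (cvg_cst 0)).
by move/eqP; rewrite mulf_eq0 (negPf pi_neq0) => /eqP.
Qed.

(* Antisymmetrising [x] against the kernel gives [x - y], which cancels the singularity. *)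
Lemma ip_moment_hilbert f : W11 f -> L1 (fun x => x * f x) -> L2 (fun x => x * f x) ->
  ip (fun x => x * f x) (hilbert f) = (Int f) ^+ 2 / (2 * pi).
Proof.
move=> wf l1x l2x; have [hf lf _] := wf; have l2f := H1_L2 hf.
pose I := Int f.
(* As [s * Qk e s = 1 - e * Pk e s], the antisymmetrised integrand is
   [f x * f y * (1 - e * Pk e (x - y))]. Energies are bounded, so the correction vanishes with
   [e]. *)
have key e : 0 < e -> ip (fun x => x * f x) (conv (Qk e) f) = (I ^+ 2 - e * energy f e) / 2.
  move=> e0; have gQ := Qk_good e0; have gP := Pk_good e0.
  have anti := conv_Q_anti lf l1x l2x e0.
  have [_ l1 _] := conv_dual2 gQ lf l2x.
  have [_ l2 _] := conv_dual2 gQ l1x l2f.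
  have [_ l3 _] := conv_dual2 gP lf l2f.
  suff : ip (fun x => x * f x) (conv (Qk e) f) - Int (fun y => f y * conv (Qk e) (fun x => x * f x) y) =
    I ^+ 2 - e * energy f e.
    by move: anti; move: (Int _) (ip _ _) (energy _ _) => p q r -> <-; field.
  rewrite -IntB//.
  have e1 x : x * f x * conv (Qk e) f x - f x * conv (Qk e) (fun x => x * f x) x =
     I * f x - e * (f x * conv (Pk e) f x).
    have -> : x * f x * conv (Qk e) f x - f x * conv (Qk e) (fun x => x * f x) x =
      f x * (x * conv (Qk e) f x - conv (Qk e) (fun x => x * f x) x) by ring.
    have -> : I * f x - e * (f x * conv (Pk e) f x) = f x * (I - e * conv (Pk e) f x) by ring.
    congr (_ * _); have lQ := conv_L1 x gQ lf; have lQ' := conv_L1 x gQ l1x.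
    have lP := conv_L1 x gP lf.
    rewrite /conv -IntZ// -IntB//; last exact: L1Z.
    rewrite /I -IntZ// -IntB//; last exact: L1Z.
    congr Int; apply/funext => y; rewrite /Qk /Pk; have := ker_den (x - y) e0.
    by move=> d0; field; rewrite gt_eqF.
  rewrite (funext e1) IntB; [|exact: L1Z|exact: L1Z].
  by rewrite !IntZ// energy_ip// expr2.
have c1 := ip_hilbert_cvg wf l2x.
have c2 : ip (fun x => x * f x) (conv (Qk (epsn n)) f) @[n --> \oo] --> (I ^+ 2 - 0) / 2.
  rewrite (funext (fun n => key _ (epsn_gt0 n))).
  apply: cvgM; last exact: cvg_cst.
  apply: cvgB; first exact: cvg_cst.
  apply/cvgrPdist_le => e e0.
  pose B := pi * n2 f ^+ 2 + 1.
  have B0 : 0 < B by rewrite ltr_wpDl// mulr_ge0 ?sqr_ge0// pi_ge0.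
  have /cvgrPdist_le/(_ _ (divr_gt0 e0 B0)) := @epsn_cvg R; apply: filterS => n.
  rewrite !sub0r !normrN normrM => h; have en := energy_le lf l2f (epsn_gt0 n).
  apply: (@le_trans _ _ (e / B * B)); last by rewrite divfK// gt_eqF.
  apply: ler_pM => //; apply: le_trans en _; rewrite /B lerDl//.
have h : pi * ip (fun x => x * f x) (hilbert f) = (I ^+ 2 - 0) / 2 by exact: (cvg_unique _ c1 c2).
apply: (mulfI pi_neq0); rewrite h /I subr0; move: (Int f); move: pi_neq0; move: (@pi R) => t t0 q; field; exact: t0.
Qed.

End hilbert_transform.

(** * Differentiable curves in seminormed spaces *)

(** The algebraic identities are equalities of elements, not equalities up to seminorm zero. *)
Record bilin (R : realType) (U V W : lmodType R) (E : seminormed U) (F : seminormed V)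
    (G : seminormed W) (B : U -> V -> W) (beta : R) : Prop := Bilin {
  bil_dom : forall x y, dom E x -> dom F y -> dom G (B x y);
  bilDl : forall x x' y, dom E x -> dom E x' -> dom F y -> B (x + x') y = B x y + B x' y;
  bilZl : forall c x y, dom E x -> dom F y -> B (c *: x) y = c *: B x y;
  bilDr : forall x y y', dom E x -> dom F y -> dom F y' -> B x (y + y') = B x y + B x y';
  bilZr : forall c x y, dom E x -> dom F y -> B x (c *: y) = c *: B x y;
  bil_ge0 : 0 <= beta;
  bil_le : forall x y, dom E x -> dom F y -> nrm G (B x y) <= beta * nrm E x * nrm F y }.

Section bilinear.
Context {R : realType} {U V W : lmodType R} {E : seminormed U} {F : seminormed V}
  {G : seminormed W} {B : U -> V -> W} {beta : R} (bB : bilin E F G B beta).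

Lemma bilBl x x' y : dom E x -> dom E x' -> dom F y -> B (x - x') y = B x y - B x' y.
Proof.
by move=> dx dx' dy; rewrite -scaleN1r (bilDl bB)// ?(bilZl bB) ?scaleN1r//; exact: domN.
Qed.

Lemma bilBr x y y' : dom E x -> dom F y -> dom F y' -> B x (y - y') = B x y - B x y'.
Proof.
by move=> dx dy dy'; rewrite -scaleN1r (bilDr bB)// ?(bilZr bB) ?scaleN1r//; exact: domN.
Qed.

Lemma bil_suml n (x : nat -> U) y : (forall i, dom E (x i)) -> dom F y ->
  B (\sum_(i < n) x i) y = \sum_(i < n) B (x i) y.
Proof.
move=> dx dy; elim: n => [|n IH].
  by rewrite !big_ord0 -(scale0r 0) (bilZl bB) ?scale0r//; exact: dom0.
by rewrite !big_ord_recr/= (bilDl bB) ?IH//; exact: dom_sum.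
Qed.

Lemma bil_sumr (r : seq nat) x (y : nat -> V) : dom E x -> (forall i, dom F (y i)) ->
  B x (\sum_(i <- r) y i) = \sum_(i <- r) B x (y i).
Proof.
move=> dx dy; elim: r => [|i r IH].
  by rewrite !big_nil -(scale0r 0) (bilZr bB) ?scale0r//; exact: dom0.
by rewrite !big_cons (bilDr bB) ?IH//; exact: dom_sum.
Qed.

Lemma bil_dist x x' y y' : dom E x -> dom E x' -> dom F y -> dom F y' ->
  nrm G (B x y - B x' y') <= beta * (nrm E (x - x') * nrm F y + nrm E x' * nrm F (y - y')).
Proof.
move=> dx dx' dy dy'.
have -> : B x y - B x' y' = B (x - x') y + B x' (y - y').
  by rewrite bilBl// bilBr// addrA subrK.
apply: le_trans (nrmD (bil_dom bB (domB dx dx') dy) (bil_dom bB dx' (domB dy dy'))) _.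
by rewrite mulrDr !mulrA; apply: lerD; apply: (bil_le bB) => //; exact: domB.
Qed.

End bilinear.

(** * Derivatives relative to a set of times *)

Section derivative.
Context {R : realType}.
Implicit Types (D : set R) (s t c e : R).

(** A remainder estimate instead of a difference quotient: there is no division and [s = t] need not
    be excluded. The set [D] makes the derivative one-sided at an end point. *)
Definition deriv_at {V : lmodType R} (E : seminormed V) D (y : R -> V) (dy : V) t :=
  forall e, 0 < e -> \forall s \near within D (nbhs t),
    nrm E (y s - y t - (s - t) *: dy) <= e * `|s - t|.

Lemma deriv_lip {V : lmodType R} (E : seminormed V) D (y : R -> V) dy t :
  (forall s, D s -> dom E (y s)) -> D t -> dom E dy -> deriv_at E D y dy t ->
  \forall s \near within D (nbhs t), nrm E (y s - y t) <= (nrm E dy + 1) * `|s - t|.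
Proof.
move=> dy' Dt ddy /(_ _ ltr01) h; near=> s.
have Ds : D s by near: s; exact: withinT.
have h1 : nrm E (y s - y t - (s - t) *: dy) <= 1 * `|s - t| by near: s.
rewrite -[y s - y t](subrK ((s - t) *: dy)).
apply: le_trans (nrmD _ _) _; [by apply: domB; [apply: domB; exact: dy'|exact: domZ]|exact: domZ|].
by rewrite nrmZ// mulrDl addrC lerD// mulrC.
Unshelve. all: by end_near. Qed.

Lemma deriv_cont {V : lmodType R} (E : seminormed V) D (y : R -> V) dy t e :
  (forall s, D s -> dom E (y s)) -> D t -> dom E dy -> deriv_at E D y dy t -> 0 < e ->
  \forall s \near within D (nbhs t), nrm E (y s - y t) <= e.
Proof.
move=> dy' Dt ddy h e0; have lip := deriv_lip dy' Dt ddy h.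
have N0 := nrm_ge0 ddy; have N1 : 0 < nrm E dy + 1 by rewrite ltr_wpDl.
near=> s; have h1 : nrm E (y s - y t) <= (nrm E dy + 1) * `|s - t| by near: s.
apply: le_trans h1 _; rewrite -ler_pdivlMl// mulrC distrC.
near: s; apply: cvg_within; apply: (@cvgr_dist_le _ _ _ _ _ id t cvg_id); exact: divr_gt0.
Unshelve. all: by end_near. Qed.

Lemma bilinear_expansion {W : lmodType R} (a b c d f g : W) :
  a - f - (d + g) = (a - b - c) + (c - d) + (b - f - g).
Proof.
rewrite (addrA _ c) subrK -!addrA (addrCA (- d)) addKr opprD.
by rewrite (addrCA (- d)).
Qed.

(** The remainder splits into [B] of the remainder of [y] with [z s], [B dy] of the increment of
    [z], and [B (y t)] of the remainder of [z]. *)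
Lemma deriv_bil {U V W : lmodType R} (E : seminormed U) (F : seminormed V)
    (G : seminormed W) (B : U -> V -> W) (beta : R) D y z dy dz t :
  bilin E F G B beta -> (forall s, D s -> dom E (y s)) -> (forall s, D s -> dom F (z s)) ->
  D t -> dom E dy -> dom F dz -> deriv_at E D y dy t -> deriv_at F D z dz t ->
  deriv_at G D (fun s => B (y s) (z s)) (B dy (z t) + B (y t) dz) t.
Proof.
move=> bB Dy Dz Dt ddy ddz hy hz e e0.
have b0 := bil_ge0 bB; have n1 := nrm_ge0 ddy.
have n2 := nrm_ge0 (Dy _ Dt); have n3 := nrm_ge0 (Dz _ Dt).
(* Near [t] the norm of [z s] is at most that of [z t] plus 1, so [beta * K] is the total
   coefficient of [e1 * |s - t|] in the three bounds. *)
pose K := nrm F (z t) + 1 + nrm E dy + nrm E (y t).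
have K0 : 0 <= K by rewrite /K !addr_ge0.
have bK : 0 < beta * K + 1 by rewrite ltr_wpDl// mulr_ge0.
pose e1 := e / (beta * K + 1).
have e10 : 0 < e1 by exact: divr_gt0.
have hz1 := deriv_cont Dz Dt ddz hz ltr01.
have hz2 := deriv_cont Dz Dt ddz hz e10.
near=> s.
have Ds : D s by near: s; exact: withinT.
have q1 : nrm E (y s - y t - (s - t) *: dy) <= e1 * `|s - t|.
  by near: s; exact: hy.
have q2 : nrm F (z s - z t - (s - t) *: dz) <= e1 * `|s - t|.
  by near: s; exact: hz.
have q3 : nrm F (z s - z t) <= 1 by near: s.
have q4 : nrm F (z s - z t) <= e1 by near: s.
have d1 : dom E (y s - y t - (s - t) *: dy).
  by apply: domB; [apply: domB; exact: Dy|exact: domZ].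
have d2 : dom F (z s - z t - (s - t) *: dz).
  by apply: domB; [apply: domB; exact: Dz|exact: domZ].
have d3 : dom F (z s - z t) by apply: domB; exact: Dz.
have dys := Dy _ Ds; have dyt := Dy _ Dt; have dzs := Dz _ Ds; have dzt := Dz _ Dt.
have dB x y' := bil_dom bB (x := x) (y := y').
rewrite scalerDr (bilinear_expansion _ (B (y t) (z s)) ((s - t) *: B dy (z s))).
have -> : B (y s) (z s) - B (y t) (z s) - (s - t) *: B dy (z s) = B (y s - y t - (s - t) *: dy) (z s).
  by rewrite !(bilBl bB)// ?(bilZl bB)//; [exact: domB|exact: domZ].
have -> : (s - t) *: B dy (z s) - (s - t) *: B dy (z t) = (s - t) *: B dy (z s - z t).
  by rewrite -scalerBr (bilBr bB).
have -> : B (y t) (z s) - B (y t) (z t) - (s - t) *: B (y t) dz = B (y t) (z s - z t - (s - t) *: dz).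
  by rewrite !(bilBr bB)// ?(bilZr bB)//; exact: domZ.
have g1 := dB _ _ d1 dzs; have g2 := dB _ _ ddy d3; have g3 := dB _ _ dyt d2.
have z1 : nrm F (z s) <= nrm F (z t) + 1.
  rewrite -[in leLHS](subrK (z t) (z s)) addrC; apply: le_trans (nrmD dzt d3) _.
  by rewrite lerD2l.
apply: le_trans (nrmD (domD g1 (domZ _ g2)) g3) _.
apply: (@le_trans _ _ (beta * (e1 * `|s - t|) * (nrm F (z t) + 1) +
   `|s - t| * (beta * nrm E dy * e1) + beta * nrm E (y t) * (e1 * `|s - t|))).
  apply: lerD.
    apply: le_trans (nrmD g1 (domZ _ g2)) _; apply: lerD.
      apply: le_trans (bil_le bB d1 dzs) _; apply: ler_pM => //.
      - by rewrite mulr_ge0// nrm_ge0.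
      - exact: nrm_ge0.
      - exact: ler_wpM2l.
    rewrite nrmZ//; apply: ler_wpM2l => //.
    apply: le_trans (bil_le bB ddy d3) _; apply: ler_wpM2l => //; exact: mulr_ge0.
  apply: le_trans (bil_le bB dyt d2) _; apply: ler_wpM2l => //; exact: mulr_ge0.
rewrite (_ : _ + _ = (beta * K) * e1 * `|s - t|); last by rewrite /K; ring.
apply: ler_wpM2r => //; rewrite /e1 mulrA ler_pdivrMr// mulrC ler_wpM2l ?(ltW e0)//.
by rewrite lerDl.
Unshelve. all: by end_near. Qed.

(** The line as a module over itself, so that [deriv_at] also covers real functions. *)
Definition Rs : seminormed R^o.
Proof.
apply: (@Seminormed R R^o (fun _ => True) (fun x => `|x|)) => //.
- by move=> x y _ _; exact: ler_normD.
- by move=> c x _; rewrite normrM.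
Defined.

Lemma mul_bilin : bilin Rs Rs Rs (fun x y : R => x * y) 1.
Proof.
split => //=; [by move=> *; exact: mulrDl|by move=> *; exact/esym/mulrA| |
  by move=> *; exact: mulrCA|by move=> *; rewrite mul1r normrM].
by move=> *; exact: mulrDr.
Qed.

Lemma is_derive_deriv_at D (f : R -> R) (df t : R) : is_derive t (1 : R) f df -> deriv_at Rs D f df t.
Proof.
move=> [dv dE] e e0; rewrite -dE.
have cv : h^-1 *: (f (h *: (1 : R) + t) - f t) @[h --> 0^'] --> 'D_1 f t := dv.
move/cvgrPdist_le : cv => /(_ _ e0) H.
have {}H : \forall h \near (0 : R), h != 0 ->
  `|'D_1 f t - h^-1 *: (f (h *: (1 : R) + t) - f t)| <= e by exact: H.
have c : s - t @[s --> t] --> (0 : R).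
  by rewrite -(subrr t); apply: cvgB; [exact: cvg_id|exact: cvg_cst].
have G : \forall s \near t, s - t != 0 ->
  `|'D_1 f t - (s - t)^-1 *: (f ((s - t) *: (1 : R) + t) - f t)| <= e := c _ H.
near=> s; have Hs : s - t != 0 ->
  `|'D_1 f t - (s - t)^-1 *: (f ((s - t) *: (1 : R) + t) - f t)| <= e.
  by near: s; exact: cvg_within G.
have [->|st] := eqVneq s t; first by rewrite !subrr scale0r subr0 /= normr0 mulr0.
have st0 : s - t != 0 by rewrite subr_eq0.
have := Hs st0; rewrite -[(s - t) *: 1]/((s - t) * 1) mulr1 subrK => {}Hs.
have sp : 0 < `|s - t| by rewrite normr_gt0.
rewrite distrC in Hs; rewrite /= -ler_pdivrMr// -normfV -normrM; apply: le_trans Hs.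
rewrite le_eqVlt; apply/orP; left; apply/eqP; congr `|_|.
by rewrite -![_ *: _]/(_ * _) mulrBl mulrC; congr (_ - _); rewrite mulrC mulKf// mulrC.
Unshelve. all: by end_near. Qed.

Lemma deriv_at_is_derive D (f : R -> R) (df t : R) : nbhs t D ->
  deriv_at Rs D f df t -> is_derive t (1 : R) f df.
Proof.
move=> tD hf.
have cv : h^-1 *: (f (h *: (1 : R) + t) - f t) @[h --> 0^'] --> df.
  apply/cvgrPdist_le => e e0.
  have H : \forall s \near t, `|f s - f t - (s - t) *: df| <= e * `|s - t|.
    by have := hf _ e0; move: tD; apply: filterS2 => s Ds; exact.
  have c : h + t @[h --> (0 : R)] --> t.
    by rewrite -[X in _ --> X]add0r; apply: cvgD; [exact: cvg_id|exact: cvg_cst].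
  have G : \forall h \near (0 : R), `|f (h + t) - f t - (h + t - t) *: df| <= e * `|h + t - t|.
    exact: c _ H.
  near=> h.
  have h0 : h != 0 by near: h; exact: nbhs_dnbhs_neq.
  have Hh : `|f (h + t) - f t - (h + t - t) *: df| <= e * `|h + t - t|.
    by near: h; exact: nbhs_dnbhs G.
  have hp : 0 < `|h| by rewrite normr_gt0.
  move: Hh; rewrite addrK -ler_pdivrMr// -normfV -normrM => Hh; apply: le_trans Hh.
  rewrite le_eqVlt; apply/orP; left; apply/eqP; rewrite distrC; congr `|_|.
  by rewrite -![_ *: _]/(_ * _) mulr1 mulrBl mulrC; congr (_ - _); rewrite mulrC mulKf.
apply: DeriveDef; first by apply/cvg_ex; exists df.
exact: cvg_lim.
Unshelve. all: by end_near. Qed.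

Lemma deriv_at_sub {V : lmodType R} (E : seminormed V) A D (y : R -> V) (dy : V) t :
  A `<=` D -> deriv_at E D y dy t -> deriv_at E A y dy t.
Proof.
move=> AD h e e0; have := h e e0; rewrite !near_withinE; apply: filterS => s hs As.
exact/hs/AD.
Qed.

(** The mean value theorem uses the derivative in the interior only; at the end points the relative
    derivative provides continuity. *)
Lemma deriv_nondecr D (f f' : R -> R) t1 t2 : t1 <= t2 -> `[t1, t2] `<=` D ->
  (forall t, t1 <= t <= t2 -> deriv_at Rs D f (f' t) t /\ 0 <= f' t) -> f t1 <= f t2.
Proof.
rewrite le_eqVlt => /predU1P[->//|t12] AD hf.
have [||c] := @MVT R f f' t1 t2 t12.
- move=> t; rewrite in_itv/= => /andP[h1 h2].
  apply: (@deriv_at_is_derive D); last by apply: (hf t _).1; rewrite !ltW.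
  have : nbhs t [set` `]t1, t2[] by apply: near_in_itvoo; rewrite in_itv/= h1.
  by apply: filterS => s /=; rewrite in_itv/= => /andP[a1 a2]; apply: AD; rewrite /= in_itv/= !ltW.
- apply/subspace_continuousP => t /=; rewrite in_itv/= => tt.
  apply/cvgrPdist_le => e e0.
  have h := deriv_at_sub AD (hf t tt).1.
  have := @deriv_cont _ Rs `[t1, t2] f (f' t) t e (fun _ _ => I) _ I h e0.
  rewrite /= in_itv/= tt => /(_ isT); apply: filterS => s; rewrite distrC//.
- rewrite in_itv/= => /andP[c1 c2] e; rewrite -subr_ge0 e; apply: mulr_ge0; last by rewrite subr_ge0 ltW.
  by apply: (hf c _).2; rewrite !ltW.
Qed.

Lemma deriv_at_add {V : lmodType R} (E : seminormed V) D (y z : R -> V) dy dz t :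
  (forall s, D s -> dom E (y s)) -> (forall s, D s -> dom E (z s)) -> D t ->
  dom E dy -> dom E dz ->
  deriv_at E D y dy t -> deriv_at E D z dz t -> deriv_at E D (fun s => y s + z s) (dy + dz) t.
Proof.
move=> Dy Dz Dt ddy ddz hy hz e e0.
have e2 : 0 < e / 2 by rewrite divr_gt0.
near=> s; have Ds : D s by near: s; exact: withinT.
have q1 : nrm E (y s - y t - (s - t) *: dy) <= e / 2 * `|s - t| by near: s; exact: hy.
have q2 : nrm E (z s - z t - (s - t) *: dz) <= e / 2 * `|s - t| by near: s; exact: hz.
rewrite (_ : _ - _ = (y s - y t - (s - t) *: dy) + (z s - z t - (s - t) *: dz)); last first.
  by rewrite scalerDr !opprD [RHS]addrACA -(addrACA (y s)).
rewrite [e]splitr mulrDl; apply: le_trans (nrmD _ _) (lerD q1 q2).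
  by apply: domB; [apply: domB; exact: Dy|exact: domZ].
by apply: domB; [apply: domB; exact: Dz|exact: domZ].
Unshelve. all: by end_near. Qed.

Lemma deriv_at_scale {V : lmodType R} (E : seminormed V) D (y : R -> V) dy t c :
  (forall s, D s -> dom E (y s)) -> D t -> dom E dy ->
  deriv_at E D y dy t -> deriv_at E D (fun s => c *: y s) (c *: dy) t.
Proof.
move=> Dy Dt ddy hy e e0.
have c1 : 0 < `|c| + 1 by rewrite ltr_wpDl.
near=> s; have Ds : D s by near: s; exact: withinT.
have q1 : nrm E (y s - y t - (s - t) *: dy) <= e / (`|c| + 1) * `|s - t|.
  by near: s; apply: hy; exact: divr_gt0.
rewrite scalerA (mulrC _ c) -scalerA -!scalerBr nrmZ; last first.
  by apply: domB; [apply: domB; exact: Dy|exact: domZ].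
apply: le_trans (ler_wpM2l (normr_ge0 c) q1) _.
rewrite mulrA ler_wpM2r// mulrCA ler_piMr ?(ltW e0)// ler_pdivrMr// mul1r lerDl//.
Unshelve. all: by end_near. Qed.

Lemma deriv_at_comp D (f Phi : R -> R) (df dPhi t : R) : D t ->
  deriv_at Rs D f df t -> is_derive (f t) (1 : R) Phi dPhi ->
  deriv_at Rs D (fun s => Phi (f s)) (dPhi * df) t.
Proof.
move=> Dt hf hP e e0.
have tr (_ : R) : dom Rs (_ : R^o) := I.
pose K := `|df| + 1 + `|dPhi|.
have K0 : 0 < K by rewrite ltr_wpDr// ltr_wpDl.
have e1 : 0 < e / (2 * K) by rewrite divr_gt0 ?mulr_gt0.
have lip := @deriv_lip _ Rs D f df t (fun _ _ => I) Dt I hf.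
have cont := fun r (r0 : 0 < r) => @deriv_cont _ Rs D f df t r (fun _ _ => I) Dt I hf r0.
have HP := @is_derive_deriv_at setT Phi dPhi (f t) hP _ e1.
rewrite withinET in HP; have [r /= r0 Hr] := HP.
have r20 : 0 < r / 2 by rewrite divr_gt0.
have cr := cont _ r20.
near=> s.
have q1 : `|f s - f t| <= (`|df| + 1) * `|s - t| by near: s.
have q2 : `|f s - f t - (s - t) * df| <= e / (2 * K) * `|s - t| by near: s; exact: hf.
have q3 : `|Phi (f s) - Phi (f t) - (f s - f t) * dPhi| <= e / (2 * K) * `|f s - f t|.
  apply: (Hr (f s)); rewrite /= distrC.
  have : `|f s - f t| <= r / 2 by near: s.
  by move=> h; apply: le_lt_trans h _; rewrite ltr_pdivrMr// ltr_pMr// ltr1n.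
rewrite /= -[_ *: _]/(_ * _).
have -> : Phi (f s) - Phi (f t) - (s - t) * (dPhi * df) =
  (Phi (f s) - Phi (f t) - (f s - f t) * dPhi) + dPhi * (f s - f t - (s - t) * df) by ring.
apply: le_trans (ler_normD _ _) _; rewrite normrM.
have q4 : e / (2 * K) * `|f s - f t| <= e / (2 * K) * ((`|df| + 1) * `|s - t|).
  by apply: ler_wpM2l => //; exact: ltW.
have q5 := ler_wpM2l (normr_ge0 dPhi) q2.
apply: le_trans (lerD (le_trans q3 q4) q5) _.
have -> : e / (2 * K) * ((`|df| + 1) * `|s - t|) + `|dPhi| * (e / (2 * K) * `|s - t|) =
  e / (2 * K) * K * `|s - t| by rewrite /K; ring.
apply: ler_wpM2r => //; rewrite invfM mulrA divfK ?gt_eqF//.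
by rewrite ler_pdivrMr// ler_pMr// ler1n.
Unshelve. all: by end_near. Qed.

End derivative.

(** * Quadratic differential equations *)

Section power_series.
Context {R : realType} {V : lmodType R} (E : seminormed V) (B : V -> V -> V) (beta A : R).
Hypotheses (cE : geom_complete E) (bB : bilin E E E B beta) (beta0 : 0 < beta) (A0 : 0 < A).
Implicit Types s t e : R.
Local Notation N := (nrm E).

(* The recursion [(n + 1) y_(n+1) = \sum_(k <= n) B y_k y_(n-k)] for the Taylor coefficients
   of the solution, on functions agreeing with the sequence up to [n]. *)
Fixpoint taylor_upto (y0 : V) (n : nat) : nat -> V :=
  if n is m.+1 then
    let f := taylor_upto y0 m in
    fun k => if k == m.+1 then m.+1%:R^-1 *: \sum_(i < m.+1) B (f i) (f (m - i)%N) else f k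
  else fun _ => y0.

Definition taylor y0 n := taylor_upto y0 n n.

Lemma taylor_uptoE y0 n k : (k <= n)%N -> taylor_upto y0 n k = taylor y0 k.
Proof.
elim: n => [|n IH]; first by rewrite leqn0 => /eqP->.
rewrite leq_eqVlt => /predU1P[->//|]; rewrite ltnS => kn.
by rewrite /= ifN ?IH// neq_ltn ltnS kn.
Qed.

Lemma taylorS y0 n :
  n.+1%:R *: taylor y0 n.+1 = \sum_(i < n.+1) B (taylor y0 i) (taylor y0 (n - i)%N).
Proof.
rewrite {1}/taylor /= eqxx scalerA divff ?pnatr_eq0// scale1r.
apply: eq_bigr => i _; rewrite !taylor_uptoE ?leq_subr//.
by rewrite -ltnS.
Qed.

Definition rate := beta * A.

Lemma rate_gt0 : 0 < rate. Proof. exact: mulr_gt0. Qed.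

Variable y0 : V.
Hypotheses (dy0 : dom E y0) (Ny0 : N y0 <= A).
Local Notation y := (taylor y0).

(** Each of the [n + 1] products in the recursion has norm at most
    [beta * A^2 * rate^n = A * rate^(n + 1)], and the division by [n + 1] absorbs their number. *)
Lemma taylor_bound n : dom E (y n) /\ N (y n) <= A * rate ^+ n.
Proof.
elim/ltn_ind: n => -[_|n IH]; first by rewrite expr0 mulr1.
have dB i : (i < n.+1)%N -> dom E (B (y i) (y (n - i)%N)).
  by move=> il; apply: (bil_dom bB); apply: (IH _ _).1 => //; rewrite ltnS leq_subr.
have NB i : (i < n.+1)%N -> N (B (y i) (y (n - i)%N)) <= A * rate ^+ n.+1.
  move=> il; have [d1 n1] := IH _ il; have [d2 n2] := IH (n - i)%N ltac:(by rewrite ltnS leq_subr).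
  apply: le_trans (bil_le bB d1 d2) _.
  have -> : A * rate ^+ n.+1 = beta * (A * rate ^+ i) * (A * rate ^+ (n - i)).
    have -> : rate ^+ n.+1 = rate * (rate ^+ i * rate ^+ (n - i)).
      by rewrite -exprD subnKC// exprS.
    by rewrite {1}/rate; ring.
  have N1 := nrm_ge0 d1; have N2 := nrm_ge0 d2.
  by apply: ler_pM => //; [rewrite mulr_ge0// ltW|rewrite ler_pM2l].
pose z i := if (i < n.+1)%N then B (y i) (y (n - i)%N) else 0.
have dz i : dom E (z i) by rewrite /z; case: ifPn => [/dB//|_]; exact: dom0.
have yE : y n.+1 = n.+1%:R^-1 *: \sum_(i < n.+1) z i.
  transitivity (n.+1%:R^-1 *: (n.+1%:R *: y n.+1)).
    by rewrite scalerA mulVf ?scale1r// pnatr_eq0.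
  by rewrite taylorS; congr (_ *: _); apply: eq_bigr => i _; rewrite /z ltn_ord.
have ds : dom E (\sum_(i < n.+1) z i) by exact: dom_sum.
split; first by rewrite yE; exact: domZ.
rewrite yE nrmZ// ger0_norm ?invr_ge0//.
rewrite mulrC ler_pdivrMr ?ltr0n//; apply: le_trans (nrm_sum _ _ (fun i : 'I_n.+1 => dz i)) _.
apply: (@le_trans _ _ (\sum_(i < n.+1) (A * rate ^+ n.+1))).
  by apply: ler_sum => i _; rewrite /z ltn_ord; exact: NB.
by rewrite sumr_const card_ord mulr_natr.
Qed.

(** Here [|t| * rate <= 1 / 8]: terms decay faster than the two factors [2^-n] spent in tail
    estimates, with room left for the factors [n] that differentiation creates. *)
Definition radius := (8 * rate)^-1.

Lemma radius_gt0 : 0 < radius. Proof. by rewrite invr_gt0 mulr_gt0// rate_gt0. Qed.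

Lemma rate_small t : `|t| <= radius -> `|t| * rate <= 8^-1.
Proof.
have r0 := rate_gt0; move=> h; apply: le_trans (ler_wpM2r (ltW r0) h) _.
by rewrite /radius invfM divfK// gt_eqF.
Qed.

Lemma term_dom (t : R) n : dom E (t ^+ n *: y n).
Proof. exact/domZ/(taylor_bound n).1. Qed.

Lemma term_bound (t : R) n : `|t| <= radius -> N (t ^+ n *: y n) <= A * 2^-1 ^+ n * 2^-1 ^+ n.
Proof.
move=> tr; have [d b] := taylor_bound n; rewrite nrmZ// normrX.
apply: le_trans (ler_wpM2l (exprn_ge0 n (normr_ge0 t)) b) _.
rewrite mulrCA -mulrA -!exprMn; apply: ler_wpM2l; first exact: ltW.
have h := rate_small tr.
have p1 : 0 <= `|t| * rate by rewrite mulr_ge0// ltW// rate_gt0.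
by apply: lerXn2r; rewrite ?nnegrE//; apply: le_trans h _; lra.
Qed.

Lemma term_bound1 (t : R) n : `|t| <= radius -> N (t ^+ n *: y n) <= A * 2^-1 ^+ n.
Proof.
move=> tr; apply: le_trans (term_bound n tr) _; rewrite ler_piMr//.
  by rewrite mulr_ge0 ?exprn_ge0// ltW.
by rewrite exprn_ile1//; lra.
Qed.

Definition psum t n := \sum_(i < n) (t ^+ i *: y i).
Definition dpsum (t : R) n := \sum_(i < n) ((i%:R * t ^+ i.-1) *: y i).

Lemma psum_dom t n : dom E (psum t n).
Proof. by apply: (@dom_sum _ _ E _ _ _ (fun i : 'I_n => t ^+ i *: y i)) => i; exact: term_dom. Qed.

Lemma psum_bound t n : `|t| <= radius -> N (psum t n) <= 2 * A.
Proof.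
move=> tr; apply: le_trans (nrm_sum _ _ (fun i : 'I_n => term_dom t i)) _.
rewrite -(big_mkord xpredT (fun i => N (t ^+ i *: y i))).
have := @geom_sum_le R A (fun i => N (t ^+ i *: y i)) 0 n (ltW A0) (fun i => term_bound1 i tr).
by rewrite expr0 mulr1.
Qed.

(** By the recursion, differentiating a partial sum gives the Cauchy product truncated to the index
    pairs with [k + j < n]. *)
Lemma dpsumS (t : R) n :
  dpsum t n.+1 = \sum_(k < n) \sum_(j < n - k) B (t ^+ k *: y k) (t ^+ j *: y j).
Proof.
have dy i : dom E (y i) := (taylor_bound i).1.
elim: n => [|n IH]; first by rewrite /dpsum big_ord_recl !big_ord0 mul0r scale0r addr0.
rewrite /dpsum big_ord_recr/= -/(dpsum t n.+1) IH.
rewrite mulrC -scalerA taylorS [RHS]big_ord_recr/= subSnn big_ord1.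
have -> : \sum_(k < n) \sum_(j < n.+1 - k) B (t ^+ k *: y k) (t ^+ j *: y j) =
    \sum_(k < n) \sum_(j < n - k) B (t ^+ k *: y k) (t ^+ j *: y j) +
    \sum_(k < n) B (t ^+ k *: y k) (t ^+ (n - k) *: y (n - k)%N).
  rewrite -big_split/=; apply: eq_bigr => k _.
  by rewrite subSn ?(ltnW (ltn_ord k))// big_ord_recr.
rewrite -addrA; congr (_ + _); rewrite scaler_sumr big_ord_recr/= subnn.
congr (_ + _).
  apply: eq_bigr => k _; rewrite (bilZl bB)//; last exact: domZ.
  by rewrite (bilZr bB)// scalerA -exprD subnKC// ltnW.
rewrite (bilZl bB)//; last exact: domZ.
by rewrite (bilZr bB)// scalerA expr0 mulr1.
Qed.

Lemma dpsum_dom t n : dom E (dpsum t n).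
Proof.
apply: (@dom_sum _ _ E _ _ _ (fun i : 'I_n => (i%:R * t ^+ i.-1) *: y i)) => i.
exact/domZ/(taylor_bound i).1.
Qed.

(** The difference collects the pairs [k, j < n] with [k + j >= n]. The tail over [j] is of order
    [2^-(n - k)], and the two factors [2^-k] from [term_bound] turn it into [2^-n] times a summable
    [2^-k]. *)
Lemma dpsum_B t n : `|t| <= radius ->
  N (B (psum t n) (psum t n) - dpsum t n.+1) <= 4 * beta * A ^+ 2 * 2^-1 ^+ n.
Proof.
move=> tr; pose a i := t ^+ i *: y i; have da i : dom E (a i) := term_dom t i.
have A0' := ltW A0; have b0' := ltW beta0.
have -> : B (psum t n) (psum t n) - dpsum t n.+1 =
    \sum_(k < n) B (a k) (\sum_(n - k <= j < n) a j).
  rewrite dpsumS -[X in B X _]/(\sum_(i < n) a i).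
  rewrite (@bil_suml _ _ _ _ _ _ _ _ _ bB n a _ da (psum_dom t n)).
  rewrite -sumrB; apply: eq_bigr => k _.
  rewrite /psum -(big_mkord xpredT a) (big_cat_nat (leq0n (n - k)) (leq_subr k n))/=.
  rewrite (bilDr bB)//; [|exact: dom_sum|exact: dom_sum].
  rewrite big_mkord -(big_mkord xpredT (fun j => B _ (a j))) -(bil_sumr bB)//; last exact: term_dom.
  by rewrite big_mkord [X in X - _]addrC addrK.
have dS m k : dom E (\sum_(m <= j < k) a j) by exact: dom_sum.
apply: le_trans (nrm_sum _ _ (fun k : 'I_n => bil_dom bB (da k) (dS _ _))) _.
have tail m : N (\sum_(m <= j < n) a j) <= 2 * A * 2^-1 ^+ m.
  apply: le_trans (nrm_sum _ _ da) _.
  exact: (@geom_sum_le R A (fun i => N (a i)) m n A0' (fun i => term_bound1 i tr)).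
have step k : (k < n)%N -> N (B (a k) (\sum_(n - k <= j < n) a j)) <=
    2 * beta * A ^+ 2 * 2^-1 ^+ n * 2^-1 ^+ k.
  move=> kn; apply: le_trans (bil_le bB (da k) (dS _ _)) _.
  have -> : 2 * beta * A ^+ 2 * 2^-1 ^+ n * 2^-1 ^+ k =
    beta * (A * 2^-1 ^+ k * 2^-1 ^+ k) * (2 * A * 2^-1 ^+ (n - k)).
    by rewrite -[in LHS](subnKC (ltnW kn)) exprD; ring.
  apply: ler_pM; [by rewrite mulr_ge0// nrm_ge0|exact: nrm_ge0| |exact: tail].
  by apply: ler_wpM2l => //; exact: term_bound.
apply: (@le_trans _ _ (\sum_(k < n) (2 * beta * A ^+ 2 * 2^-1 ^+ n * 2^-1 ^+ k))).
  by apply: ler_sum => k _; exact: step.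
rewrite -(big_mkord xpredT (fun k => 2 * beta * A ^+ 2 * 2^-1 ^+ n * 2^-1 ^+ k)).
have C0 : 0 <= 2 * beta * A ^+ 2 * 2^-1 ^+ n.
  by rewrite !mulr_ge0 ?exprn_ge0.
have := @geom_sum_le R _ (fun k => 2 * beta * A ^+ 2 * 2^-1 ^+ n * 2^-1 ^+ k) 0 n C0 (fun i => lexx _).
by rewrite expr0 mulr1 => h; apply: le_trans h _; rewrite le_eqVlt; apply/orP; left; apply/eqP; ring.
Qed.

Definition pow_rem (s t : R) i := s ^+ i - t ^+ i - (s - t) * (i%:R * t ^+ i.-1).

Lemma pow_remS s t i : pow_rem s t i.+1 = s * pow_rem s t i + (s - t) ^+ 2 * (i%:R * t ^+ i.-1).
Proof.
case: i => [|i]; first by rewrite /pow_rem /= !expr0 !expr1 !mul0r; ring.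
by rewrite /pow_rem /= -!natr1 !exprS; ring.
Qed.

(** Induction along [pow_remS]. In units of [rate^2 (s - t)^2 2^-i], the first term contributes
    [32 / 8 = 4] and the second at most 8, below the target [32 / 2 = 16]. *)
Lemma pow_rem_bound s t i : `|s| <= radius -> `|t| <= radius ->
  `|pow_rem s t i| * rate ^+ i <= 32 * rate ^+ 2 * (s - t) ^+ 2 * 2^-1 ^+ i.
Proof.
move=> sr tr; have r0 := rate_gt0; have h1 := rate_small sr; have h2 := rate_small tr.
have q0 : 0 <= rate ^+ 2 * (s - t) ^+ 2 by rewrite mulr_ge0 ?sqr_ge0.
elim: i => [|i IH].
  rewrite /pow_rem !expr0 mul0r mulr0 subrr subr0 normr0 mul0r !mulr1 -mulrA mulr_ge0//.
rewrite pow_remS.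
have a1 : `|s * pow_rem s t i + (s - t) ^+ 2 * (i%:R * t ^+ i.-1)| * rate ^+ i.+1 <=
    (`|s| * rate) * (`|pow_rem s t i| * rate ^+ i) +
    (s - t) ^+ 2 * rate ^+ 2 * (i%:R * (`|t| * rate) ^+ i.-1).
  have -> : (`|s| * rate) * (`|pow_rem s t i| * rate ^+ i) +
    (s - t) ^+ 2 * rate ^+ 2 * (i%:R * (`|t| * rate) ^+ i.-1) =
    (`|s| * `|pow_rem s t i| + (s - t) ^+ 2 * (i%:R * `|t| ^+ i.-1)) * rate ^+ i.+1.
    case: (i) => [|j]; first by rewrite /= !mul0r !mulr0 !addr0 expr0 expr1; ring.
    by rewrite /= [(`|t| * _) ^+ _]exprMn [rate ^+ j.+1]exprS [rate ^+ j.+2]exprS [rate ^+ j.+1]exprS; ring.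
  apply: ler_wpM2r; first by rewrite exprn_ge0// ltW.
  apply: le_trans (ler_normD _ _) _.
  by rewrite normrM (normrM (_ ^+ 2)) (normrM i%:R) !normrX normr_nat real_normK ?num_real.
apply: le_trans a1 _.
have a2 : (`|s| * rate) * (`|pow_rem s t i| * rate ^+ i) <=
    8^-1 * (32 * rate ^+ 2 * (s - t) ^+ 2 * 2^-1 ^+ i).
  by apply: ler_pM => //; rewrite mulr_ge0 ?exprn_ge0// ltW.
have a3 : i%:R * (`|t| * rate) ^+ i.-1 <= 8 * 2^-1 ^+ i.
  case: (i) => [|j]; first by rewrite mul0r mulr_ge0.
  apply: (@le_trans _ _ (2 ^+ j.+1 * 4^-1 ^+ j)).
    apply: ler_pM => //; first by rewrite exprn_ge0// mulr_ge0// ltW.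
      by rewrite -natrX ler_nat ltnW// ltn_expl.
    have p1 : 0 <= `|t| * rate by rewrite mulr_ge0// ltW.
    by apply: lerXn2r; rewrite ?nnegrE//; apply: le_trans h2 _; lra.
  have -> : (4^-1 : R) = 2^-1 * 2^-1 by field.
  rewrite exprMn exprS !mulrA -(mulrA 2) -exprMn mulfV ?pnatr_eq0// expr1n mulr1.
  by rewrite exprS mulrA ler_wpM2r ?exprn_ge0//; lra.
have a4 := ler_wpM2l q0 a3.
rewrite (mulrC ((s - t) ^+ 2)) exprS; move: a2 a4.
set q := rate ^+ 2 * (s - t) ^+ 2; set w := 2^-1 ^+ i.
rewrite -(mulrA 32 (rate ^+ 2)) -/q => a2 a4.
apply: le_trans (lerD a2 a4) _.
have : 0 <= q * w by rewrite mulr_ge0// exprn_ge0.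
rewrite (exprS _ i) -/w; clearbody q w.
rewrite (_ : _ + _ = 12 * (q * w)); last by field.
rewrite (_ : 32 * q * (2^-1 * w) = 16 * (q * w)); last by field.
by move: (q * w) => z z0; lra.
Qed.

Lemma psum_taylor s t n : `|s| <= radius -> `|t| <= radius ->
  N (psum s n - psum t n - (s - t) *: dpsum t n) <= 64 * A * rate ^+ 2 * (s - t) ^+ 2.
Proof.
move=> sr tr.
have -> : psum s n - psum t n - (s - t) *: dpsum t n = \sum_(i < n) (pow_rem s t i *: y i).
  rewrite /psum /dpsum scaler_sumr -!sumrB; apply: eq_bigr => i _.
  by rewrite scalerA -!scalerBl.
have dy i : dom E (pow_rem s t i *: y i) by exact/domZ/(taylor_bound i).1.
apply: le_trans (nrm_sum _ _ (fun i : 'I_n => dy i)) _.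
have b i : N (pow_rem s t i *: y i) <= 32 * A * rate ^+ 2 * (s - t) ^+ 2 * 2^-1 ^+ i.
  have [d bd] := taylor_bound i; rewrite nrmZ//.
  apply: le_trans (ler_wpM2l (normr_ge0 _) bd) _.
  have := ler_wpM2l (ltW A0) (pow_rem_bound i sr tr).
  by rewrite mulrCA; move/le_trans; apply; rewrite le_eqVlt; apply/orP; left; apply/eqP; ring.
have C0 : 0 <= 32 * A * rate ^+ 2 * (s - t) ^+ 2.
  by rewrite mulr_ge0 ?sqr_ge0// mulr_ge0 ?sqr_ge0// mulr_ge0// ltW.
have := @geom_sum_le R _ (fun i => N (pow_rem s t i *: y i)) 0 n C0 b.
rewrite big_mkord expr0 mulr1 => h; apply: le_trans h _.
by rewrite le_eqVlt; apply/orP; left; apply/eqP; ring.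
Qed.

(** The quadratic remainder estimate holds for partial sums with a constant independent of their
    length, so it survives the limit and takes the place of termwise differentiation. Limits are
    determined up to seminorm zero, whence the form of the initial condition. *)
Lemma power_series_solution : exists Y : R -> V,
  [/\ N (Y 0 - y0) = 0,
      forall t, `|t| <= radius -> dom E (Y t) /\ N (Y t) <= 2 * A &
      forall s t, `|s| <= radius -> `|t| <= radius ->
        N (Y s - Y t - (s - t) *: B (Y t) (Y t)) <= 64 * A * rate ^+ 2 * (s - t) ^+ 2].
Proof.
have ex t : exists z, `|t| <= radius ->
    dom E z /\ N (z - psum t n) @[n --> \oo] --> (0 : R).
  have [tr|tr] := boolP (`|t| <= radius); last by exists 0.
  have [z dz cz] := cE (ltW A0) (term_dom t) (fun n => term_bound1 n tr).
  by exists z.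
have [Y HY] := choice ex; exists Y.
have dY t : `|t| <= radius -> dom E (Y t) by move=> /HY[].
have dP := psum_dom; have dD := dpsum_dom.
have cY t e : `|t| <= radius -> 0 < e -> \forall n \near \oo, N (Y t - psum t n) <= e.
  move=> tr e0; have [_ /cvgrPdist_le/(_ _ e0)] := HY t tr; apply: filterS => n.
  by rewrite sub0r normrN; apply: le_trans; exact: ler_norm.
have NY t : `|t| <= radius -> N (Y t) <= 2 * A.
  move=> tr; apply/ler_addgt0Pr => e e0; near \oo => n.
  have h : N (Y t - psum t n) <= e by near: n; exact: cY.
  rewrite -[in leLHS](subrK (psum t n) (Y t)) addrC.
  by apply: le_trans (nrmD (dP t n) (domB (dY _ tr) (dP t n))) _; apply: lerD => //; exact: psum_bound.
have r00 : `|0 : R| <= radius by rewrite normr0 ltW// radius_gt0.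
split.
- apply/eqP; rewrite eq_le nrm_ge0 ?andbT; last by apply: domB => //; exact: dY.
  apply/ler_addgt0Pr => e e0; rewrite add0r; near \oo => n.
  have h : N (Y 0 - psum 0 n) <= e by near: n; exact: cY.
  have n0 : (0 < n)%N by near: n; exact: nbhs_infty_gt.
  suff -> : y0 = psum 0 n by [].
  rewrite /psum -(prednK n0) big_ord_recl expr0 scale1r big1 ?addr0// => i _.
  by rewrite expr0n/= scale0r.
- by move=> t tr; split; [exact: dY|exact: NY].
- move=> s t sr tr; apply/ler_addgt0Pr => e e0.
  (* Bounds the total coefficient of [e1] when [Y s] and [Y t] are replaced by partial sums within
     [e1]; [4 * A] stems from the norms of [Y t] and of its partial sum, each at most [2 * A]. *)
  pose K := `|s - t| * (beta * (4 * A + 1)) + 2 * `|s - t| + 2.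
  have K0 : 0 < K.
    by rewrite /K ltr_wpDl// addr_ge0 ?mulr_ge0 ?addr_ge0 ?mulr_ge0// ltW.
  pose e1 := Num.min 1 (e / K).
  have e10 : 0 < e1 by rewrite lt_min ltr01 divr_gt0.
  have eK : e1 * K <= e by rewrite -ler_pdivlMr// ge_min lexx orbT.
  have e1le : e1 <= 1 by rewrite ge_min lexx.
  near \oo => n.
  have hs : N (Y s - psum s n.+1) <= e1.
    by near: n; have [m _ Hm] := cY s e1 sr e10; exists m => // k mk; apply: Hm; exact: leqW.
  have ht : N (Y t - psum t n.+1) <= e1.
    by near: n; have [m _ Hm] := cY t e1 tr e10; exists m => // k mk; apply: Hm; exact: leqW.
  have ht' : N (Y t - psum t n) <= e1 by near: n; exact: cY.
  have hB : 4 * beta * A ^+ 2 * 2^-1 ^+ n <= e1.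
    near: n; have c : 4 * beta * A ^+ 2 * 2^-1 ^+ n @[n --> \oo] --> (4 * beta * A ^+ 2 * 0 : R).
      by apply: cvgM; [exact: cvg_cst|exact: epsn_cvg].
    rewrite mulr0 in c; move/cvgrPdist_le : c => /(_ _ e10); apply: filterS => n.
    by rewrite sub0r normrN; apply: le_trans; exact: ler_norm.
  have [dYs dYt] : dom E (Y s) /\ dom E (Y t) by split; exact: dY.
  pose Pn := psum t n; have dPn : dom E Pn := dP t n.
  have B1 : N (B (Y t) (Y t) - B Pn Pn) <= beta * (4 * A + 1) * e1.
    apply: le_trans (bil_dist bB dYt dPn dYt dPn) _; rewrite -mulrA; apply: ler_wpM2l; first exact: ltW.
    have p1 : N (Y t - Pn) * N (Y t) <= e1 * (2 * A).
      by apply: ler_pM => //; [exact/nrm_ge0/domB|exact: nrm_ge0|exact: NY].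
    have p2 : N Pn * N (Y t - Pn) <= (2 * A) * e1.
      by apply: ler_pM => //; [exact: nrm_ge0|exact/nrm_ge0/domB|exact: psum_bound].
    apply: le_trans (lerD p1 p2) _; rewrite [leLHS](_ : _ = 4 * A * e1); last by ring.
    by apply: ler_wpM2r; [exact: ltW|rewrite lerDl].
  have B2 := le_trans (dpsum_B n tr) hB.
  have dBY := bil_dom bB dYt dYt; have dBP := bil_dom bB dPn dPn.
  have T := psum_taylor n.+1 sr tr.
  have -> : Y s - Y t - (s - t) *: B (Y t) (Y t) =
     (psum s n.+1 - psum t n.+1 - (s - t) *: dpsum t n.+1) +
     ((Y s - psum s n.+1) - (Y t - psum t n.+1) -
      (s - t) *: ((B (Y t) (Y t) - B Pn Pn) + (B Pn Pn - dpsum t n.+1))).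
    rewrite (addrA _ (B Pn Pn)) subrK scalerBr.
    move: (Y s) (psum s n.+1) (Y t) (psum t n.+1) (_ *: B _ _) (_ *: dpsum _ _) => a b c d f g.
    have sA x z u v : (x - z) - (u - v) = (x - u) - (z - v) :> V.
      by rewrite !opprB addrACA [RHS]addrACA (addrC (- z)).
    by rewrite (sA a) (sA (a - c)) [RHS]addrC subrK.
  have dps := dP s n.+1; have dpt := dP t n.+1; have ddt := dD t n.+1.
  have D1 := domB dYs dps; have D2 := domB dYt dpt.
  have D3 := domB dBY dBP; have D4 := domB dBP ddt.
  have D5 := domZ (s - t) (domD D3 D4).
  have D6 := domB (domB D1 D2) D5.
  have D7 := domB (domB dps dpt) (domZ (s - t) ddt).
  apply: le_trans (nrmD D7 D6) _; apply: lerD => //.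
  apply: le_trans (nrmB (domB D1 D2) D5) _.
  have M1 := nrmB D1 D2; rewrite nrmZ; last exact: domD.
  have M2 := ler_wpM2l (normr_ge0 (s - t)) (le_trans (nrmD D3 D4) (lerD B1 B2)).
  apply: le_trans (lerD (le_trans M1 (lerD hs ht)) M2) _; apply: le_trans eK.
  have : 0 <= e1 * `|s - t| by rewrite mulr_ge0// ltW.
  rewrite /K (_ : e1 * (`|s - t| * (beta * (4 * A + 1)) + 2 * `|s - t| + 2) =
    e1 + e1 + `|s - t| * (beta * (4 * A + 1) * e1 + e1) + e1 * `|s - t|); last by ring.
  by rewrite lerDl.
Unshelve. all: by end_near. Qed.

End power_series.

(** * The system *)

Section product_space.
Context {R : realType} {U V : lmodType R} (E : seminormed U) (F : seminormed V).

Definition prod_seminormed : seminormed (U * V)%type.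
Proof.
apply: (@Seminormed R _ (fun x : U * V => dom E x.1 /\ dom F x.2) (fun x : U * V => nrm E x.1 + nrm F x.2)).
- by split; exact: dom0.
- by move=> x y [x1 x2] [y1 y2]; split; exact: domD.
- by move=> c x [x1 x2]; split; exact: domZ.
- by move=> x y [x1 x2] [y1 y2]; rewrite addrACA lerD// nrmD.
- by move=> c x [x1 x2]; rewrite !nrmZ// mulrDr.
Defined.

Lemma prod_complete : geom_complete E -> geom_complete F -> geom_complete prod_seminormed.
Proof.
move=> cE cF C x C0 dx bx.
have n1 n : nrm E (x n).1 <= C * 2^-1 ^+ n.
  by apply: le_trans (bx n); rewrite /= lerDl; exact: nrm_ge0 (dx n).2.
have n2 n : nrm F (x n).2 <= C * 2^-1 ^+ n.
  by apply: le_trans (bx n); rewrite /= lerDr; exact: nrm_ge0 (dx n).1.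
have [y1 d1 c1] := cE C _ C0 (fun n => (dx n).1) n1.
have [y2 d2 c2] := cF C _ C0 (fun n => (dx n).2) n2.
exists (y1, y2) => //; rewrite -(addr0 (0 : R)).
rewrite (_ : (fun n => _) = (fun n => nrm E (y1 - \sum_(i < n) (x i).1) +
  nrm F (y2 - \sum_(i < n) (x i).2))); first exact: cvgD.
apply/funext => n /=; congr (nrm E (_ - _) + nrm F (_ - _)).
  by elim: n => [|n IH]; rewrite ?big_ord0// !big_ord_recr/= IH.
by elim: n => [|n IH]; rewrite ?big_ord0// !big_ord_recr/= IH.
Qed.

Lemma deriv_fst D Y dY t : (forall s, D s -> dom prod_seminormed (Y s)) -> D t ->
  dom prod_seminormed dY ->
  deriv_at prod_seminormed D Y dY t -> deriv_at E D (fun s => (Y s).1) dY.1 t.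
Proof.
move=> HY Dt dd h e e0; near=> s.
have Ds : D s by near: s; exact: withinT.
have : nrm prod_seminormed (Y s - Y t - (s - t) *: dY) <= e * `|s - t| by near: s; exact: h.
apply: le_trans; rewrite /= lerDl.
have [ds1 ds2] := HY _ Ds; have [dt1 dt2] := HY _ Dt; have [dd1 dd2] := dd.
exact: nrm_ge0 (domB (domB ds2 dt2) (domZ _ dd2)).
Unshelve. all: by end_near. Qed.

Lemma deriv_snd D Y dY t : (forall s, D s -> dom prod_seminormed (Y s)) -> D t ->
  dom prod_seminormed dY ->
  deriv_at prod_seminormed D Y dY t -> deriv_at F D (fun s => (Y s).2) dY.2 t.
Proof.
move=> HY Dt dd h e e0; near=> s.
have Ds : D s by near: s; exact: withinT.
have : nrm prod_seminormed (Y s - Y t - (s - t) *: dY) <= e * `|s - t| by near: s; exact: h.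
apply: le_trans; rewrite /= lerDr.
have [ds1 ds2] := HY _ Ds; have [dt1 dt2] := HY _ Dt; have [dd1 dd2] := dd.
exact: nrm_ge0 (domB (domB ds1 dt1) (domZ _ dd1)).
Unshelve. all: by end_near. Qed.

Lemma deriv_pair D Y dY t : deriv_at E D (fun s => (Y s).1) dY.1 t ->
  deriv_at F D (fun s => (Y s).2) dY.2 t -> deriv_at prod_seminormed D Y dY t.
Proof.
move=> h1 h2 e e0; have e2 : 0 < e / 2 by rewrite divr_gt0.
near=> s; rewrite [e]splitr mulrDl; apply: lerD; near: s; [exact: h1|exact: h2].
Unshelve. all: by end_near. Qed.

End product_space.

(** * The system as a quadratic equation *)

Section system.
Context {R : realType}.
Implicit Types (f g h w p q : R -> R) (D : set R) (a b c s t : R).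
Local Notation mu := (@lebesgue_measure R).
Local Notation n2 := (nrm L2s).
Local Notation nH := (nrm H1s).
Local Notation S := (prod_seminormed H1s H1s).

(* [hilbert] is additive on products of [H1] functions at every point, not just almost
   everywhere, so that this is bilinear on representatives. *)
Definition sysB (x y : (R -> R) * (R -> R)) : (R -> R) * (R -> R) :=
  ((fun z => x.1 z * y.2 z) + (fun z => y.1 z * x.2 z), hilbert (fun z => x.1 z * y.1 z)).

Lemma mul_H1_bilin : bilin H1s H1s H1s (fun f g x => f x * g x) 6.
Proof.
split => //=.
- by move=> f g hf hg; case: (H1M hf hg).
- by move=> f f' g _ _ _; apply/funext => x; rewrite mulrDl.
- by move=> c f g _ _; apply/funext => x; exact: (esym (mulrA c (f x) (g x))).
- by move=> f g g' _ _ _; apply/funext => x; rewrite mulrDr.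
- by move=> c f g _ _; apply/funext => x; rewrite -[(c *: g) x]/(c * g x) mulrCA.
- by move=> f g hf hg; rewrite -mulrA; case: (H1M hf hg).
Qed.

Lemma sysB_sym x y : sysB x y = sysB y x.
Proof. by congr pair; [rewrite addrC|congr hilbert; apply/funext => z; rewrite mulrC]. Qed.

(** Each of the two products in the first component costs 6, and the second component costs [2 * 6],
    the norm of [hilbert] being at most 2. *)
Lemma sysB_bilin : bilin S S S sysB 12.
Proof.
have bM := mul_H1_bilin.
have L x x' y : dom S x -> dom S x' -> dom S y -> sysB (x + x') y = sysB x y + sysB x' y.
  move=> [x1 x2] [x1' x2'] [y1 y2]; congr pair => /=.
    by apply/funext => z; rewrite !fctE; ring.
  rewrite -(hilbert_add (W11M x1 y1) (W11M x1' y1)); congr hilbert.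
  by apply/funext => z; rewrite !fctE mulrDl.
have Z c x y : dom S x -> dom S y -> sysB (c *: x) y = c *: sysB x y.
  move=> [x1 x2] [y1 y2]; congr pair => /=.
    by apply/funext => z; rewrite -![_ *: _]/(fun z => c * _) !fctE; ring.
  rewrite -(hilbert_scale c (W11M x1 y1)); congr hilbert.
  by apply/funext => z; exact: (esym (mulrA c (x.1 z) (y.1 z))).
apply: Bilin.
- move=> x y [x1 x2] [y1 y2]; split.
    by apply: H1D; [case: (H1M x1 y2)|case: (H1M y1 x2)].
  by case: (hilbert_H1 (W11M x1 y1)).
- exact: L.
- exact: Z.
- move=> x y y' dx dy dy'.
  by rewrite sysB_sym (L _ _ _ dy dy' dx) (sysB_sym y) (sysB_sym y').
- by move=> c x y dx dy; rewrite sysB_sym (Z _ _ _ dy dx) (sysB_sym y).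
- exact: ler0n.
- move=> x y [x1 x2] [y1 y2].
  change (nH ((fun z => x.1 z * y.2 z) + (fun z => y.1 z * x.2 z)) + nH (hilbert (fun z => x.1 z * y.1 z)) <=
    12 * (nH x.1 + nH x.2) * (nH y.1 + nH y.2)).
  have [h1 _ b1] := H1M x1 y2; have [h2 _ b2] := H1M y1 x2; have [h3 _ b3] := H1M x1 y1.
  have b4 := (hilbert_H1 (W11M x1 y1)).2.
  have b5 := @nrmD _ _ H1s _ _ h1 h2.
  apply: le_trans (lerD (le_trans b5 (lerD b1 b2)) (le_trans b4 (ler_wpM2l _ b3))) _ => //.
  have q := mulr_ge0 (nH_ge0 x.2) (nH_ge0 y.2).
  have q1 := mulr_ge0 (nH_ge0 x.1) (nH_ge0 y.2).
  have q2 := mulr_ge0 (nH_ge0 y.1) (nH_ge0 x.2).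
  move: q q1 q2; move: (nH x.1) (nH x.2) (nH y.1) (nH y.2); clear => p1 p2 r1 r2 q q1 q2; nra.
Qed.

Lemma ip_bilin : bilin H1s H1s Rs (@ip R) 1.
Proof.
have L f g h : H1 f -> H1 g -> H1 h -> ip (f + g) h = ip f h + ip g h.
  by move=> hf hg hh; apply: ipDl; exact: H1_L2.
have Z c f h : H1 f -> H1 h -> ip (c *: f) h = c * ip f h.
  by move=> hf hh; apply: ipZl; exact: H1_L2.
split => //=.
- by move=> f g g' hf hg hg'; rewrite ipC L// !(ipC f).
- by move=> c f g hf hg; rewrite ipC Z// (ipC f).
- move=> f g hf hg; rewrite mul1r; apply: le_trans (ip_le (H1_L2 hf) (H1_L2 hg)) _.
  by apply: ler_pM; rewrite ?nrm2_ge0// n2_nH.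
Qed.

(** The bounded weight is the indicator of the complement of [[a, b]] in the support argument and
    the cut-off of [x - a] in the moments. *)
Definition wip (chi : R -> R) f g := ip (fun x => chi x * f x) g.

Lemma wip_bilin (chi : R -> R) c : measurable_fun setT chi -> (forall x, `|chi x| <= c) ->
  bilin H1s H1s Rs (wip chi) c.
Proof.
move=> mc bc; have c0 : 0 <= c := le_trans (normr_ge0 _) (bc 0).
have lc f : H1 f -> L2 (fun x => chi x * f x) by move=> /H1_L2; exact: L2_bdd.
have L f g h : H1 f -> H1 g -> H1 h -> wip chi (f + g) h = wip chi f h + wip chi g h.
  move=> hf hg hh; rewrite /wip -ipDl; [|exact: lc|exact: lc|exact: H1_L2].
  by congr ip; apply/funext => x; rewrite !fctE mulrDr.
have Z k f h : H1 f -> H1 h -> wip chi (k *: f) h = k * wip chi f h.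
  move=> hf hh; rewrite /wip -ipZl; [|exact: lc|exact: H1_L2].
  by congr ip; apply/funext => x; rewrite -[(k *: f) x]/(k * f x) mulrCA.
have C f g : wip chi f g = wip chi g f.
  by congr Int; apply/funext => x; rewrite mulrAC.
split => //=.
- by move=> f g g' hf hg hg'; rewrite C L// !(C f).
- by move=> k f g hf hg; rewrite C Z// (C f).
- move=> f g hf hg; apply: le_trans (ip_le (lc f hf) (H1_L2 hg)) _.
  apply: ler_pM; rewrite ?nrm2_ge0// ?n2_nH//.
  apply: le_trans (ler_wpM2l c0 (n2_nH hf)).
  apply: nrm2_le => //; [exact: lc|exact: H1_L2|].
  by apply: aeW => x; rewrite normrM ler_wpM2r.
Qed.

(** The set of times is arbitrary, so that solutions can be restricted to intervals and glued. *)
Definition sol D (Y : R -> (R -> R) * (R -> R)) := forall t, D t ->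
  dom S (Y t) /\ deriv_at S D Y (sysB (Y t) (Y t)) t.

Lemma sol_dom D Y t : sol D Y -> D t -> dom S (Y t).
Proof. by move=> sY /sY[]. Qed.

Lemma sol_dom' D Y t : sol D Y -> D t -> dom S (sysB (Y t) (Y t)).
Proof. by move=> sY /sY[d _]; exact: (bil_dom sysB_bilin d d). Qed.

Lemma sol_sub A D Y : A `<=` D -> sol D Y -> sol A Y.
Proof. by move=> AD sY t At; have [d h] := sY t (AD _ At); split => //; exact: deriv_at_sub h. Qed.

Lemma sol_bounded D Y t1 t2 : t1 <= t2 -> `[t1, t2] `<=` D -> sol D Y ->
  exists M : R, forall t, t1 <= t <= t2 -> nrm S (Y t) <= M.
Proof.
move=> t12 AD sY.
have cN : {within `[t1, t2], continuous (fun t => nrm S (Y t))}.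
  apply/subspace_continuousP => t tt; apply/cvgrPdist_le => e e0.
  have sA := sol_sub AD sY.
  have [d h] := sA t tt.
  have := deriv_cont (fun s As => sol_dom sA As) tt (sol_dom' sA tt) h e0.
  move=> H; near=> s; have As : `[t1, t2]%classic s by near: s; exact: withinT.
  have ds := sol_dom sA As; rewrite distrC; apply: le_trans (nrm_dist ds d) _.
  by near: s.
have [c _ hc] := EVT_max t12 cN; exists (nrm S (Y c)) => t tt.
by apply: hc; rewrite in_itv.
Unshelve. all: by end_near. Qed.

(** The product [exp (- K t) * f t] is nonincreasing and starts at 0. *)
Lemma gronwall D (f f' : R -> R) K t1 t2 : t1 <= t2 -> `[t1, t2] `<=` D ->
  (forall t, t1 <= t <= t2 -> deriv_at Rs D f (f' t) t /\ f' t <= K * f t) ->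
  f t1 = 0 -> f t2 <= 0.
Proof.
move=> t12 AD hf f0.
pose ex (t : R) : R := expR (- K * t).
have dex t : is_derive t (1 : R) ex (- K * ex t).
  have dl : is_derive t (1 : R) (fun t => - K * t) (- K).
    by apply: (@is_derive_quad _ _ _ _ 0) => h; rewrite (_ : _ - _ = 0) ?normr0 ?mul0r//; ring.
  have := @is_derive1_comp R expR (fun t => - K * t) t _ _ (is_derive_expR _) dl.
  by rewrite mulrC.
suff : - (ex t1 * f t1) <= - (ex t2 * f t2).
  by rewrite f0 mulr0 oppr0 oppr_ge0 pmulr_rle0// expR_gt0.
apply: (@deriv_nondecr R D (fun t => - (ex t * f t))
   (fun t => - (- K * ex t * f t + ex t * f' t)) t1 t2 t12 AD) => t tt.
have [h1 h2] := hf t tt; split; last first.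
  rewrite oppr_ge0 -subr_ge0 sub0r.
  rewrite [leRHS](_ : _ = ex t * (K * f t - f' t)); last by ring.
  by rewrite mulr_ge0 ?subr_ge0// expR_ge0.
have Dt : D t by apply: AD; rewrite /= in_itv.
have := deriv_bil (mul_bilin (R := R)) (fun _ _ => I) (fun _ _ => I) Dt I I (is_derive_deriv_at D (dex t)) h1.
move=> /(@deriv_at_scale _ _ Rs D _ _ t (-1) (fun _ _ => I) Dt I).
by rewrite scaleN1r (_ : (fun s => -1 *: _) = (fun t => - (ex t * f t)))//; apply/funext => s; rewrite scaleN1r.
Qed.

End system.

(** * Uniqueness and propagation of the support *)

Section uniqueness.
Context {R : realType}.
Implicit Types (f g h w p q : R -> R) (D : set R) (a b c s t x : R).
Local Notation mu := (@lebesgue_measure R).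
Local Notation n2 := (nrm L2s).
Local Notation nH := (nrm H1s).
Local Notation S := (prod_seminormed H1s H1s).

Lemma nrm_prod_fst (z : (R -> R) * (R -> R)) : nH z.1 <= nrm S z.
Proof. by rewrite -[nrm S z]/(nH z.1 + nH z.2) lerDl nH_ge0. Qed.

Lemma nrm_prod_snd (z : (R -> R) * (R -> R)) : nH z.2 <= nrm S z.
Proof. by rewrite -[nrm S z]/(nH z.1 + nH z.2) lerDr nH_ge0. Qed.

Lemma mul_n2 f g m : H1 f -> L2 g -> nH f <= m -> L2 (fun x => f x * g x) /\
  n2 (fun x => f x * g x) <= 2 * m * n2 g.
Proof.
move=> hf lg fm; have [l b] := L2_ae_bdd (L2_meas (H1_L2 hf)) (H1_sup hf) lg.
split => //; apply: le_trans (b _) _; first by rewrite mulr_ge0// nH_ge0.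
by rewrite ler_wpM2r ?nrm2_ge0// ler_wpM2l.
Qed.

(** An L^2 estimate: the [w]'s are bounded by [2 * m]. With [P] and [Q] the L^2 norms of [p] and
    [q], the terms add up to [m (2 P^2 + 6 P Q)], at most [5 m (P^2 + Q^2)]. *)
Lemma sysB_energy p q w1 w2 m : H1 p -> H1 q -> H1 w1 -> H1 w2 -> nH w1 <= m -> nH w2 <= m ->
  ip p (sysB (p, q) (w1, w2)).1 + ip q (sysB (p, q) (w1, w2)).2 <= 5 * m * (ip p p + ip q q).
Proof.
move=> hp hq hw1 hw2 m1 m2; have lp := H1_L2 hp; have lq := H1_L2 hq.
have m0 : 0 <= m := le_trans (nH_ge0 w1) m1.
have wW := W11M hp hw1.
have [lh _ bh] := hilbert_L2 wW.
have [l1 b1] := mul_n2 hw2 lp m2; have [l2 b2] := mul_n2 hw1 lq m1; have [l3 b3] := mul_n2 hw1 lp m1.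
have E1 : (fun z => p z * w2 z) = (fun z => w2 z * p z) by apply/funext => z; rewrite mulrC.
have E3 : (fun z => p z * w1 z) = (fun z => w1 z * p z) by apply/funext => z; rewrite mulrC.
change (ip p ((fun z => p z * w2 z) + (fun z => w1 z * q z)) + ip q (hilbert (fun z => p z * w1 z)) <=
  5 * m * (ip p p + ip q q)).
rewrite E3 in lh bh *; rewrite E1.
have g1 := le_trans (ler_norm _) (ip_le lp (L2D l1 l2)).
have g2 := le_trans (ler_norm _) (ip_le lq lh).
have g3 := @nrmD _ _ L2s _ _ l1 l2.
have k1 := ler_wpM2l (nrm2_ge0 p) (le_trans g3 (lerD b1 b2)).
have k2 := ler_wpM2l (nrm2_ge0 q) (le_trans bh (ler_wpM2l (ler0n R 2) b3)).
apply: le_trans (lerD (le_trans g1 k1) (le_trans g2 k2)) _.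
rewrite -(L2s_sq lp) -(L2s_sq lq).
have : 0 <= m * (n2 p - n2 q) ^+ 2 by rewrite mulr_ge0 ?sqr_ge0.
have : 0 <= m * n2 q ^+ 2 by rewrite mulr_ge0 ?sqr_ge0.
move: (n2 p) (n2 q); clear => P Q h1 h2.
rewrite -subr_ge0.
rewrite [leRHS](_ : _ = 3 * (m * (P - Q) ^+ 2) + 2 * (m * Q ^+ 2)); last by ring.
by rewrite addr_ge0// mulr_ge0.
Qed.

(** The weak derivative depends on the class only, so a null function is also null in [H^1]; this
    upgrades uniqueness from L^2 to [H^1]. *)
Lemma nH_of_ip f : H1 f -> ip f f = 0 -> nH f = 0.
Proof.
move=> hf; rewrite -(L2s_sq (H1_L2 hf)) => /eqP; rewrite sqrf_eq0 => /eqP h.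
by rewrite (nH_ae hf H1_0 (nrm2_eq0 (H1_L2 hf) h)) nrm0.
Qed.

Lemma ip_of_nH f : H1 f -> nH f = 0 -> ip f f = 0.
Proof.
move=> hf h; rewrite -(L2s_sq (H1_L2 hf)).
have : n2 f <= 0 by rewrite -h n2_nH.
by rewrite le_eqVlt ltNge nrm2_ge0 orbF => /eqP->; rewrite expr0n.
Qed.

(** Since [sysB] is symmetric, the difference [X] of the solutions solves the linear equation
    [X' = sysB X (Y + Z)], and its squared L^2 norm satisfies a Gronwall inequality. *)
Lemma sol_unique D Y Z t1 t2 M : t1 <= t2 -> `[t1, t2] `<=` D -> sol D Y -> sol D Z ->
  (forall t, t1 <= t <= t2 -> nrm S (Y t) <= M /\ nrm S (Z t) <= M) ->
  nrm S (Y t1 - Z t1) = 0 -> nrm S (Y t2 - Z t2) = 0.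
Proof.
move=> t12 AD sY sZ bYZ z1.
pose X t := Y t - Z t.
have dY t : D t -> dom S (Y t) by exact: sol_dom.
have dZ t : D t -> dom S (Z t) by exact: sol_dom.
have dX t : D t -> dom S (X t) by move=> Dt; apply: domB; [exact: dY|exact: dZ].
have AD' t : t1 <= t <= t2 -> D t by move=> tt; apply: AD; rewrite /= in_itv.
pose dXt t := sysB (X t) (Y t + Z t).
have dX't t : D t -> dom S (dXt t).
  by move=> Dt; apply: (bil_dom sysB_bilin (dX t Dt)); apply: domD; [exact: dY|exact: dZ].
have derX t : D t -> deriv_at S D X (dXt t) t.
  move=> Dt; have [d1 h1] := sY t Dt; have [d2 h2] := sZ t Dt.
  have e1 := sol_dom' sY Dt; have e2 := sol_dom' sZ Dt.
  have := deriv_at_add dY (fun s Ds => domZ (-1) (dZ s Ds)) Dt e1 (domZ (-1) e2) h1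
    (@deriv_at_scale _ _ S D _ _ t (-1) dZ Dt e2 h2).
  rewrite (_ : (fun s => Y s + -1 *: Z s) = X); last by apply/funext => s; rewrite scaleN1r.
  rewrite scaleN1r (_ : _ - _ = dXt t)// /dXt /X.
  rewrite (bilBl sysB_bilin d1 d2 (domD d1 d2)) (bilDr sysB_bilin d1 d1 d2) (bilDr sysB_bilin d2 d1 d2).
  rewrite (sysB_sym (Z t) (Y t)).
  move: (sysB (Y t) (Y t)) (sysB (Z t) (Z t)) (sysB (Y t) (Z t)) => P Q A.
  by rewrite opprD addrA addrK.
pose En t := ip (X t).1 (X t).1 + ip (X t).2 (X t).2.
pose En' t := 2 * (ip (X t).1 (dXt t).1 + ip (X t).2 (dXt t).2).
have derE t : D t -> deriv_at Rs D En (En' t) t.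
  move=> Dt; have hX := derX t Dt.
  have f1 := deriv_fst dX Dt (dX't _ Dt) hX.
  have f2 := deriv_snd dX Dt (dX't _ Dt) hX.
  have c1 s : D s -> H1 (X s).1 by move=> /dX[].
  have c2 s : D s -> H1 (X s).2 by move=> /dX[].
  have [k1 k2] := dX't _ Dt.
  have g1 := deriv_bil (ip_bilin (R := R)) c1 c1 Dt k1 k1 f1 f1.
  have g2 := deriv_bil (ip_bilin (R := R)) c2 c2 Dt k2 k2 f2 f2.
  have := @deriv_at_add _ _ Rs D _ _ _ _ t (fun _ _ => I) (fun _ _ => I) Dt I I g1 g2.
  congr (deriv_at Rs D _ _ t); rewrite /En' (ipC (dXt t).1) (ipC (dXt t).2).
  by move: (ip _ _) (ip _ _) => r1 r2; ring.
have E0 : En t1 = 0.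
  have D1 : D t1 by apply: AD'; rewrite lexx.
  have [h1 h2] := dX _ D1.
  have p1 : nH (X t1).1 = 0.
    by apply/eqP; rewrite eq_le nH_ge0 andbT -z1; exact: nrm_prod_fst.
  have p2 : nH (X t1).2 = 0.
    by apply/eqP; rewrite eq_le nH_ge0 andbT -z1; exact: nrm_prod_snd.
  by rewrite /En (ip_of_nH h1 p1) (ip_of_nH h2 p2) addr0.
have le0 : En t2 <= 0.
  (* The constant is 2 from differentiating a square, times 5 from [sysB_energy], times 2 from the
     bound [2 * M] on [Y + Z]. *)
  apply: (@gronwall R D En En' (20 * M) t1 t2 t12 AD _ E0) => t tt.
  have Dt := AD' t tt; split; first exact: derE.
  have [h1 h2] := dX _ Dt; have [bY bZ] := bYZ t tt.
  have dW := domD (dY _ Dt) (dZ _ Dt).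
  have bW : nrm S (Y t + Z t) <= 2 * M.
    by apply: le_trans (nrmD (dY _ Dt) (dZ _ Dt)) _; rewrite mulr_natl mulr2n; exact: lerD.
  have := sysB_energy h1 h2 dW.1 dW.2 (le_trans (nrm_prod_fst _) bW) (le_trans (nrm_prod_snd _) bW).
  rewrite -!surjective_pairing -/(dXt t) => h.
  rewrite /En' /En (_ : 20 * M = 2 * (5 * (2 * M))); last by ring.
  by rewrite -mulrA ler_pM2l.
have D2 : D t2 by apply: AD'; rewrite t12 lexx.
have [h1 h2] := dX _ D2.
have i1 := ip_ge0 (H1_L2 h1); have i2 := ip_ge0 (H1_L2 h2).
have [z2 z3] : ip (X t2).1 (X t2).1 = 0 /\ ip (X t2).2 (X t2).2 = 0.
  by move: le0 i1 i2; rewrite /En; move: (ip _ _) (ip _ _) => r1 r2 *; split; lra.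
by rewrite -[nrm S _]/(nH (X t2).1 + nH (X t2).2) (nH_of_ip h1 z2) (nH_of_ip h2 z3) addr0.
Qed.

(** For an indicator [chi], the integral of [chi u^2] has derivative [4 \int chi u^2 v], at most
    [8 * M] times itself because [|v| <= 2 * M] almost everywhere; it stays 0. *)
Lemma sol_support D Y t1 t2 (chi : R -> R) : t1 <= t2 -> `[t1, t2] `<=` D -> sol D Y ->
  measurable_fun setT chi -> (forall x, chi x = 0 \/ chi x = 1) ->
  wip chi (Y t1).1 (Y t1).1 = 0 -> aeeq (fun x => chi x * (Y t2).1 x) (cst 0).
Proof.
move=> t12 AD sY mc c01 z1.
have [M bM] := sol_bounded t12 AD sY.
have cb x : `|chi x| <= 1 by case: (c01 x) => ->; rewrite ?normr0 ?normr1.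
have bw := wip_bilin mc cb.
have AD' t : t1 <= t <= t2 -> D t by move=> tt; apply: AD; rewrite /= in_itv.
have dY t : D t -> dom S (Y t) by exact: sol_dom.
have c1 s : D s -> H1 (Y s).1 by move=> /dY[].
pose En t := wip chi (Y t).1 (Y t).1.
pose En' t := wip chi (sysB (Y t) (Y t)).1 (Y t).1 + wip chi (Y t).1 (sysB (Y t) (Y t)).1.
have lc f : L2 f -> L2 (fun x => chi x * f x) by exact: L2_bdd.
have EnE t : D t -> En t = n2 (fun x => chi x * (Y t).1 x) ^+ 2.
  move=> Dt; rewrite L2s_sq; last exact/lc/H1_L2/c1.
  by congr Int; apply/funext => x; case: (c01 x) => ->; rewrite ?mul0r ?mul1r.
have le0 : En t2 <= 0.
  apply: (@gronwall R D En En' (8 * M) t1 t2 t12 AD _ z1) => t tt.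
  have Dt := AD' t tt; have [d h] := sY t Dt.
  have [k1 k2] := sol_dom' sY Dt.
  have f1 := deriv_fst dY Dt (sol_dom' sY Dt) h.
  split; first exact: (deriv_bil bw c1 c1 Dt k1 k1 f1 f1).
  have [h1 h2] := d.
  have lu := H1_L2 h1; have lcu := lc _ lu.
  have bv : nH (Y t).2 <= M := le_trans (nrm_prod_snd _) (bM _ tt).
  have [l b] := mul_n2 h2 lcu bv.
  have EE : En' t = 4 * ip (fun x => chi x * (Y t).1 x) (fun x => (Y t).2 x * (chi x * (Y t).1 x)).
    have e1 : wip chi (Y t).1 (sysB (Y t) (Y t)).1 =
       2 * ip (fun x => chi x * (Y t).1 x) (fun x => (Y t).2 x * (chi x * (Y t).1 x)).
      rewrite /wip /ip -IntZ; last exact: L2_L1.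
      congr Int; apply/funext => x.
      rewrite -[(sysB _ _).1 x]/((Y t).1 x * (Y t).2 x + (Y t).1 x * (Y t).2 x).
      by case: (c01 x) => ->; rewrite ?mul0r ?mulr0//; ring.
    have e2 : wip chi (sysB (Y t) (Y t)).1 (Y t).1 = wip chi (Y t).1 (sysB (Y t) (Y t)).1.
      by congr Int; apply/funext => x; rewrite mulrAC.
    by rewrite /En' e2 e1; move: (ip _ _) => r; ring.
  rewrite EE (EnE _ Dt); have := le_trans (ler_norm _) (ip_le lcu l).
  move=> /le_trans; have := ler_wpM2l (nrm2_ge0 (fun x => chi x * (Y t).1 x)) b.
  move=> b' /(_ _ b'); move: (ip _ _) (n2 (fun x => chi x * _)); clear => r P hr.
  rewrite (_ : 8 * M * P ^+ 2 = 4 * (P * (2 * M * P))); last by ring.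
  by rewrite ler_pM2l.
have D2 : D t2 by apply: AD'; rewrite t12 lexx.
apply: nrm2_eq0; first exact/lc/H1_L2/c1.
apply/eqP; rewrite -sqrf_eq0 -(EnE _ D2) eq_le le0 (EnE _ D2) sqr_ge0//.
Qed.

Lemma ae_zero_near_cont (F : R -> R) x : continuous F ->
  (exists2 V, nbhs x V & {ae mu, forall y, V y -> F y = 0}) -> F x = 0.
Proof.
move=> cF [V nV aV]; apply/eqP/negP => /negP Fx.
have [r /= r0 Hr] : nbhs x (V `&` [set y | F y != 0]).
  apply: filterI => //; have := cF x; move/cvgrPdist_lt.
  have p : 0 < `|F x| by rewrite normr_gt0.
  move=> /(_ _ p); apply: filterS => y; rewrite /=; apply: contraTneq => ->.
  by rewrite subr0 ltxx.
have neg : mu.-negligible `]x - r, x + r[%classic.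
  have [A [mA A0 sA]] := aV; exists A; split => // y yr; apply: sA => /= h.
  have [Vy] : (V `&` [set y | F y != 0]) y.
    by apply: Hr; rewrite /= distrC ltr_norml; move: yr; rewrite /= in_itv/= => /andP[? ?]; apply/andP; split; lra.
  by rewrite /= => /eqP; apply; exact: h.
have : mu `]x - r, x + r[%classic = 0%E by apply/negligibleP.
rewrite lebesgue_measure_itv/= lte_fin ifT; last by lra.
by move=> /eqP; rewrite -EFinD eqe => /eqP; lra.
Qed.

(** The continuous representative vanishes at every single point outside the essential support; this
    takes the place of a countable covering by neighbourhoods. *)
Lemma ess_support_zero f a b : H1 f -> ess_support f `<=` `]a, b[ ->
  {ae mu, forall x, ~~ (a < x < b) -> f x = 0}.
Proof.
move=> hf sf; have [F [_ fF ACF _]] := H1_rep hf; have cF := AC_cont ACF.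
move: (fF); apply: ae_imp => x fFx xab; rewrite fFx; apply: ae_zero_near_cont => //.
have : ~ ess_support f x by move=> /sf /=; rewrite in_itv/=; exact/negP.
move=> /contrapT[V nV aV]; exists V => //.
by move: fF aV; apply: ae_imp2 => y -> h /h.
Qed.

End uniqueness.

(** * Blow-up *)

Section comparison.
Context {R : realType}.
Implicit Types (D : set R) (s t x y z : R).
Local Notation mu := (@lebesgue_measure R).

(** The absolute value keeps the radicand positive for all real [y], so that the primitive is
    differentiable on the whole line; only [y >= 0] matters for the bound. *)
Definition cubic y : R := (Num.sqrt (`|y| ^+ 3 + 1))^-1.

Lemma cubic_den y : 0 < Num.sqrt (`|y| ^+ 3 + 1).
Proof. by rewrite sqrtr_gt0 ltr_wpDl// exprn_ge0. Qed.

Lemma cubic_gt0 y : 0 < cubic y. Proof. by rewrite invr_gt0 cubic_den. Qed.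

Lemma continuous_cubic : continuous cubic.
Proof.
move=> y; apply: cvgV; first by rewrite gt_eqF// cubic_den.
apply: (cvg_comp _ Num.sqrt); last exact: sqrt_continuous.
apply: cvgD; last exact: cvg_cst.
have h : `|z| @[z --> y] --> `|y| by exact: norm_continuous.
by rewrite !exprS expr0 mulr1; apply: cvgM => //; apply: cvgM.
Qed.

(** Squaring reduces it to [4 (y^3 + 1) - (1 + y)^3 = 3 (1 + y) (1 - y)^2]. The majorant has the
    bounded antiderivative [- 4 / sqrt (1 + y)]. *)
Lemma cubic_le y : 0 <= y -> cubic y <= 2 * ((1 + y)^-1 * (Num.sqrt (1 + y))^-1).
Proof.
move=> y0; have y1 : 0 < 1 + y by lra.
have s0 : 0 < Num.sqrt (1 + y) by rewrite sqrtr_gt0.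
rewrite /cubic (ger0_norm y0) -invfM.
have den : 0 < (1 + y) * Num.sqrt (1 + y) by exact: mulr_gt0.
have den2 : 0 < Num.sqrt (y ^+ 3 + 1) by have := cubic_den y; rewrite ger0_norm.
rewrite ler_pdivlMr// mulrC ler_pdivrMr//.
rewrite -(@ler_pXn2r _ 2)// ?nnegrE ?mulr_ge0 ?sqrtr_ge0// ?(ltW y1)//.
have y3 : 0 <= y ^+ 3 by rewrite exprn_ge0.
rewrite !exprMn !sqr_sqrtr; [|lra|lra].
rewrite -subr_ge0 (_ : _ - _ = 3 * ((1 + y) * (1 - y) ^+ 2)); last by ring.
by rewrite mulr_ge0// mulr_ge0 ?sqr_ge0// ltW.
Qed.

Lemma cubic_L1 : L1 (fun y => \1_(`[0, +oo[) y * cubic y).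
Proof.
pose f y := (1 + y)^-1 * (Num.sqrt (1 + y))^-1.
pose F y := - 2 * (Num.sqrt (1 + y))^-1.
have s0 y : 0 <= y -> 0 < Num.sqrt (1 + y) by move=> y0; rewrite sqrtr_gt0; lra.
have f0 y : 0 <= y -> 0 <= f y.
  by move=> y0; rewrite mulr_ge0// invr_ge0 ?sqrtr_ge0//; lra.
have cS : continuous (fun y => Num.sqrt (1 + y) : R).
  move=> y; apply: (cvg_comp _ Num.sqrt); last exact: sqrt_continuous.
  by apply: cvgD; [exact: cvg_cst|exact: cvg_id].
have dF y : 0 < y -> is_derive y (1 : R) F (f y).
  move=> y0; have y1 : 0 < 1 + y by lra.
  have sy := s0 y (ltW y0).
  have dl : is_derive y (1 : R) (fun y => 1 + y) 1.
    by apply: (@is_derive_quad _ _ _ _ 0) => h; rewrite (_ : _ - _ = 0) ?normr0 ?mul0r//; ring.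
  have d1 := @is_derive1_comp R Num.sqrt (fun y => 1 + y) y _ _ (is_derive1_sqrt y1) dl.
  have d2 := @is_deriveV R (Num.sqrt \o (fun y => 1 + y)) y _ 1 (lt0r_neq0 sy) d1.
  have d3 := is_deriveZ (-2) d2.
  refine (is_derive_eq d3 _).
  rewrite -![_ *: _]/(_ * _) /f /=.
  have e : 1 + y = Num.sqrt (1 + y) ^+ 2 by rewrite sqr_sqrtr// ltW.
  rewrite [X in _ = X^-1 * _]e; move: sy; move: (Num.sqrt (1 + y)) => q q0.
  by field; rewrite gt_eqF.
have int : (\int[mu]_(y in `[0%R, +oo[) (f y)%:E = 0%:E - (F 0)%:E)%E.
  apply: ge0_continuous_FTC2y => //.
  - apply: continuous_in_subspaceT => y /set_mem /=; rewrite in_itv/= andbT => y0.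
    apply: cvgM; apply: cvgV; [by rewrite gt_eqF//; lra| |by rewrite gt_eqF// s0|exact: cS].
    by apply: cvgD; [exact: cvg_cst|exact: cvg_id].
  - apply/cvgrPdist_le => e e0; near=> y.
    have y0 : 0 <= y by near: y; exact: nbhs_pinfty_ge (num_real _).
    have ye : (2 / e) ^+ 2 <= y by near: y; exact: nbhs_pinfty_ge (num_real _).
    rewrite sub0r normrN normrM normrN normfV (gtr0_norm (s0 y y0)) ger0_norm//.
    rewrite ler_pdivrMr ?s0// -ler_pdivrMl// mulrC.
    rewrite -(ger0_norm (_ : 0 <= 2 / e)); last by rewrite divr_ge0// ltW.
    by rewrite -sqrtr_sqr; apply: ler_wsqrtr; lra.
  - by move=> y y0; case: (dF y y0).
  - apply: cvg_at_right_filter; apply: cvgM; first exact: cvg_cst.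
    by apply: cvgV; [by rewrite gt_eqF// s0|exact: cS].
  - move=> y; rewrite in_itv/= andbT => y0; rewrite derive1E; case: (dF y y0) => _ <-//.
have mI : measurable (`[0%R, +oo[%classic : set R) by exact: measurable_itv.
have mcub : measurable_fun setT cubic by apply: continuous_meas; exact: continuous_cubic.
apply/L1_indicP => //; apply/integrableP; split.
  by apply: measurable_funTS; apply/measurable_EFinP.
apply: (@le_lt_trans _ _ (\int[mu]_(y in `[0%R, +oo[) (2 * f y)%:E)%E).
  apply: ge0_le_integral => //.
  - apply: measurableT_comp => //; apply: measurable_funTS; exact/measurable_EFinP.
  - apply/measurable_EFinP; apply: measurable_funM => //.
    apply: measurable_funM; apply: (measurableT_comp (f := fun s : R => s^-1)); try exact: measurable_inv.
      by apply: measurable_funD.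
    by apply: measurable_funTS; apply: continuous_meas; exact: cS.
  - move=> y /=; rewrite in_itv/= andbT => y0.
    by rewrite lee_fin ger0_norm ?cubic_le// ltW// cubic_gt0.
rewrite (_ : (\int[mu]_(y in _) _)%E = 2%:E * \int[mu]_(y in `[0%R, +oo[) (f y)%:E)%E.
  by rewrite int -EFinB -EFinM ltry.
rewrite -ge0_integralZl//.
- apply/measurable_EFinP; apply: measurable_funM; apply: (measurableT_comp (f := fun s : R => s^-1)); try exact: measurable_inv.
    by apply: measurable_funD.
  by apply: measurable_funTS; apply: continuous_meas; exact: cS.
- by move=> y /=; rewrite in_itv/= andbT => y0; rewrite lee_fin f0.
Unshelve. all: by end_near. Qed.

Definition Icubic : R := \int[mu]_(y in `[0, +oo[) (Num.sqrt (y ^+ 3 + 1))^-1.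

Lemma IcubicE : Icubic = Int (fun y => \1_(`[0, +oo[) y * cubic y).
Proof.
rewrite Int_indic; apply: eq_Rintegral => y /set_mem /=; rewrite in_itv/= andbT => y0.
by rewrite /cubic ger0_norm.
Qed.

Lemma prim_cubic_le z : 0 <= z -> prim cubic z <= Icubic.
Proof.
move=> z0; have lc := locL1_cont continuous_cubic.
rewrite /prim (itg0 _ z0) subr0 IcubicE; apply: Int_le; [exact: lc|exact: cubic_L1|].
move=> y; rewrite indic_oc indicE; have := cubic_gt0 y; case: ifPn => [/andP[y0 _]|_] c0.
  by rewrite mem_set//= in_itv/= andbT ltW.
by rewrite mul0r mulr_ge0// ltW.
Qed.

(* The quantity [prim cubic (lambda * (G - G 0))] grows at least at unit speed (after scaling),
   and it is bounded by [Icubic]. *)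
Lemma blowup_time (T : \bar R) (G C dC : R -> R) k t :
  0 < k -> 0 < C 0 -> times T t ->
  (forall s, times T s -> deriv_at Rs (times T) G (C s) s) ->
  (forall s, times T s -> deriv_at Rs (times T) C (dC s) s) ->
  (forall s, times T s -> 0 <= G s) ->
  (forall s, times T s -> 3 / 2 * k * G s ^+ 2 <= dC s) ->
  t <= (k * C 0) `^ (- 3^-1) * Icubic.
Proof.
move=> k0 C00 Tt hG hC G0 dCG.
have t0 : 0 <= t by case: Tt.
have TT s : 0 <= s -> s <= t -> times T s.
  move=> s0 st; split => //; case: Tt => _; apply: le_lt_trans; by rewrite lee_fin.
have sub s1 s2 : 0 <= s1 -> s2 <= t -> `[s1, s2] `<=` times T.
  move=> h1 h2 s /=; rewrite in_itv/= => /andP[a1 a2]; apply: TT; lra.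
have dC0 s : 0 <= s -> s <= t -> 0 <= dC s.
  move=> a1 a2; apply: le_trans (dCG s (TT s a1 a2)).
  by rewrite mulr_ge0 ?sqr_ge0// mulr_ge0// ltW.
have Cge s : 0 <= s -> s <= t -> C 0 <= C s.
  move=> s0 st; apply: (@deriv_nondecr R (times T) C dC 0 s s0 (sub 0 s (lexx _) st)).
  move=> r /andP[r0 rs]; have rt := le_trans rs st.
  by split; [exact/hC/TT|exact: dC0].
have Gge s : 0 <= s -> s <= t -> G 0 <= G s.
  move=> s0 st; apply: (@deriv_nondecr R (times T) G C 0 s s0 (sub 0 s (lexx _) st)).
  move=> r /andP[r0 rs]; have rt := le_trans rs st.
  split; [exact/hG/TT|exact: le_trans (ltW C00) (Cge r r0 rt)].
pose H s := G s - G 0.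
have trI (P : R -> Prop) (f : R -> R) : forall s, P s -> dom Rs (f s) by [].
have dH s : times T s -> deriv_at Rs (times T) H (C s) s.
  move=> Ts; have := @deriv_at_comp R (times T) G (fun z => z - G 0) (C s) 1 s Ts (hG s Ts).
  rewrite mul1r; apply.
  by apply: (@is_derive_quad _ _ _ _ 0) => h; rewrite (_ : _ - _ = 0) ?normr0 ?mul0r//; ring.
have isd_pow n z : is_derive z (1 : R) (fun z : R => z ^+ n.+1) (n.+1%:R * z ^+ n).
  rewrite (_ : (fun z : R => z ^+ n.+1) = (id : R -> R) ^+ n.+1); last first.
    by apply/funext => y; rewrite exprfctE.
  by apply: is_derive_eq; rewrite -[_ *: 1]/(_ * 1) mulr1.
(* The derivative of [C^2 - k H^3] is [2 C (dC - 3 / 2 k H^2)], nonnegative because [0 <= H <= G].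
   As [H] starts at 0, the initial value is exactly [C 0 ^+ 2]. *)
have energy s : 0 <= s -> s <= t -> C 0 ^+ 2 + k * H s ^+ 3 <= C s ^+ 2.
  move=> s0 st.
  have : C 0 ^+ 2 + - k * H 0 ^+ 3 <= C s ^+ 2 + - k * H s ^+ 3.
    apply: (@deriv_nondecr R (times T) (fun s => C s ^+ 2 + - k * H s ^+ 3)
      (fun s => 2 * C s * dC s + - k * (3 * H s ^+ 2 * C s)) 0 s s0 (sub 0 s (lexx _) st)).
    move=> r /andP[r0 rs]; have rt := le_trans rs st; have Tr := TT r r0 rt.
    split.
      have h1 := @deriv_at_comp R (times T) C (fun z => z ^+ 2) (dC r) _ r Tr (hC r Tr) (isd_pow 1%N _).
      have h2 := @deriv_at_comp R (times T) H (fun z => z ^+ 3) (C r) _ r Tr (dH r Tr) (isd_pow 2%N _).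
      have h3 := @deriv_at_scale R _ Rs (times T) _ _ r (- k) (trI _ _) Tr I h2.
      exact: (@deriv_at_add R _ Rs (times T) _ _ _ _ r (trI _ _) (trI _ _) Tr I I h1 h3).
    have Cr : 0 < C r := lt_le_trans C00 (Cge r r0 rt).
    have HG : H r ^+ 2 <= G r ^+ 2.
      have g1 := Gge r r0 rt; have g2 := G0 0 (TT 0 (lexx _) t0).
      by rewrite lerXn2r ?nnegrE /H ?subr_ge0 ?G0 ?gerBl.
    have := dCG r Tr; rewrite -subr_ge0 => q.
    have g1 := mulr_ge0 (mulr_ge0 (ler0n R 2) (ltW Cr)) q.
    have g2 : 0 <= 3 * k * C r * (G r ^+ 2 - H r ^+ 2).
      by rewrite mulr_ge0 ?subr_ge0// mulr_ge0 ?(ltW Cr)// mulr_ge0// ltW.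
    rewrite (_ : _ + _ = 2 * C r * (dC r - 3 / 2 * k * G r ^+ 2) + 3 * k * C r * (G r ^+ 2 - H r ^+ 2)).
      exact: addr_ge0.
    by field.
  by rewrite /H subrr expr0n/= mulr0 addr0; lra.
(* The scaling satisfies [lam^3 = k / (C 0)^2], so [(C 0)^2 + k H^3 = (C 0)^2 (1 + (lam H)^3)], and
   [lam * C = m * (C / C 0)]. Hence [Phi (lam * H)] grows at speed at least [m]. *)
pose m := (k * C 0) `^ 3^-1.
have kC : 0 < k * C 0 by exact: mulr_gt0.
have m0 : 0 < m by exact: powR_gt0.
have m3 : m ^+ 3 = k * C 0.
  by rewrite /m -powR_mulrn ?powR_ge0// -powRrM mulVf ?pnatr_eq0// powRr1// ltW.
pose lam := m / C 0.
have lam0 : 0 < lam by exact: divr_gt0.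
pose Phi := prim cubic.
have dPhi z : is_derive z (1 : R) Phi (cubic z).
  by apply: AC_deriv; [exact/AC_prim/locL1_cont/continuous_cubic|exact: continuous_cubic].
have : Phi (lam * H 0) + - m * 0 <= Phi (lam * H t) + - m * t.
  apply: (@deriv_nondecr R (times T) (fun s => Phi (lam * H s) + - m * s)
    (fun s => cubic (lam * H s) * (lam * C s) + - m) 0 t t0 (sub 0 t (lexx _) (lexx _))).
  move=> s /andP[s0 st]; have Ts := TT s s0 st; split.
    have h1 := @deriv_at_scale R _ Rs (times T) _ _ s lam (trI _ _) Ts I (dH s Ts).
    have h2 := @deriv_at_comp R (times T) (fun s => lam * H s) Phi (lam * C s) _ s Ts h1 (dPhi _).
    have h3 : deriv_at Rs (times T) (fun s => - m * s) (- m) s.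
      apply: is_derive_deriv_at.
      by apply: (@is_derive_quad _ _ _ _ 0) => h; rewrite (_ : _ - _ = 0) ?normr0 ?mul0r//; ring.
    exact: (@deriv_at_add R _ Rs (times T) _ _ _ _ s (trI _ _) (trI _ _) Ts I I h2 h3).
  have Cs : 0 < C s := lt_le_trans C00 (Cge s s0 st).
  have Hs : 0 <= lam * H s by rewrite mulr_ge0 ?(ltW lam0)// subr_ge0 Gge.
  rewrite subr_ge0 /cubic (ger0_norm Hs).
  have den2 : 0 < Num.sqrt ((lam * H s) ^+ 3 + 1) by have := cubic_den (lam * H s); rewrite ger0_norm.
  rewrite mulrC ler_pdivlMr// (_ : lam * C s = m * (C s / C 0)); last by rewrite /lam; ring.
  rewrite ler_pM2l// ler_pdivlMr//.
  rewrite -[leRHS](ger0_norm (ltW Cs)) -sqrtr_sqr -[in leLHS](ger0_norm (ltW C00)) -sqrtr_sqr.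
  rewrite -sqrtrM; last by rewrite addr_ge0// exprn_ge0.
  apply: ler_wsqrtr.
  apply: le_trans (energy s s0 st).
  rewrite le_eqVlt; apply/orP; left; apply/eqP.
  by rewrite (exprMn _ lam) /lam expr_div_n m3; field; rewrite gt_eqF.
rewrite /H subrr !mulr0 addr0 => h.
have P0 : Phi 0 = 0 by rewrite /Phi /prim itg0// subrr.
have P1 : Phi (lam * (G t - G 0)) <= Icubic.
  by apply: prim_cubic_le; rewrite mulr_ge0 ?(ltW lam0)// subr_ge0 Gge.
rewrite powRN -/m mulrC ler_pdivlMr//.
by move: h P1; rewrite P0; move: (Phi _) => q; rewrite mulrC; lra.
Qed.

End comparison.

(** * Comparison of the two notions of solution, and continuation *)

Section continuation.
Context {R : realType}.
Implicit Types (f g h w p q : R -> R) (D : set R) (a b c s t : R).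
Local Notation mu := (@lebesgue_measure R).
Local Notation n2 := (nrm L2s).
Local Notation nH := (nrm H1s).
Local Notation S := (prod_seminormed H1s H1s).

Lemma nrm_subrr {V : lmodType R} (E : seminormed V) (x : V) : nrm E (x - x) = 0.
Proof. by rewrite subrr nrm0. Qed.

(** Derivatives are insensitive to changes of seminorm zero. This absorbs both the almost everywhere
    equalities in [is_solution] and the null discrepancy between glued pieces. *)
Lemma deriv_at_equiv {V : lmodType R} (E : seminormed V) D (y y' : R -> V) dy dy' t :
  (forall s, D s -> dom E (y s)) -> (forall s, D s -> dom E (y' s)) -> D t ->
  dom E dy -> dom E dy' -> (forall s, D s -> nrm E (y s - y' s) = 0) -> nrm E (dy - dy') = 0 ->
  deriv_at E D y dy t -> deriv_at E D y' dy' t.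
Proof.
move=> Dy Dy' Dt dd dd' yy' dd0 h e e0; near=> s.
have Ds : D s by near: s; exact: withinT.
have q : nrm E (y s - y t - (s - t) *: dy) <= e * `|s - t| by near: s; exact: h.
apply: le_trans q.
have d1 := domB (Dy _ Ds) (Dy' _ Ds); have d2 := domB (Dy _ Dt) (Dy' _ Dt).
have d3 := domZ (s - t) (domB dd dd').
have d4 := domB (domB (Dy _ Ds) (Dy _ Dt)) (domZ (s - t) dd).
have sA (x z u v : V) : (x - z) - (u - v) = (x - u) - (z - v).
  by rewrite !opprB addrACA [RHS]addrACA (addrC (- z)).
have -> : y' s - y' t - (s - t) *: dy' = (y s - y t - (s - t) *: dy) -
   ((y s - y' s) - (y t - y' t) - (s - t) *: (dy - dy')).
  rewrite (sA (y s)) scalerBr (sA (y s - y t)).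
  by rewrite !subKr.
apply: le_trans (nrmB d4 (domB (domB d1 d2) d3)) _.
rewrite gerDl; apply: le_trans (nrmB (domB d1 d2) d3) _.
rewrite nrmZ; last exact: domB.
by rewrite dd0 mulr0 addr0; apply: le_trans (nrmB d1 d2) _; rewrite !yy'// addr0.
Unshelve. all: by end_near. Qed.

Lemma deriv_at_local {V : lmodType R} (E : seminormed V) A D (y : R -> V) dy t :
  nbhs t A -> deriv_at E (D `&` A) y dy t -> deriv_at E D y dy t.
Proof.
move=> tA h e e0; have := h e e0; rewrite !near_withinE; move: tA.
by apply: filterS2 => s As hs Ds; exact: hs.
Qed.

Lemma C1_H1_deriv T (u du : R -> R -> R) t : C1_H1 T u du -> times T t ->
  deriv_at H1s (times T) u (du t) t.
Proof.
move=> hu Tt e e0; have [h1 h2 /cvgrPdist_le/(_ _ e0) c _] := hu t Tt.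
move: c; rewrite !near_withinE; apply: filterS => s hs Ts.
have [->|st] := eqVneq s t.
  by rewrite !subrr scale0r subr0 nrm0 normr0 mulr0.
have hus : H1 (u s) by case: (hu s Ts).
have st0 : s - t != 0 by rewrite subr_eq0.
have hf : H1 ((s - t)^-1 *: (u s - u t) - du t) by apply: H1B => //; apply/H1Z/H1B.
have := hs (conj Ts (elimN eqP st)); rewrite sub0r normrN.
rewrite (_ : (fun x => _) = (s - t)^-1 *: (u s - u t) - du t); last first.
  by apply/funext => x; rewrite mulrC.
rewrite H1normE// (ger0_norm (nH_ge0 _)) => hq.
rewrite (_ : u s - u t - (s - t) *: du t = (s - t) *: ((s - t)^-1 *: (u s - u t) - du t)).
  by rewrite nrmZ// mulrC ler_wpM2r.
by rewrite scalerBr scalerA divff// scale1r.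
Qed.

Lemma deriv_C1_H1 D (u : R -> R -> R) du t : (forall s, D s -> H1 (u s)) -> D t -> H1 du ->
  deriv_at H1s D u du t ->
  H1norm (fun x => (u s x - u t x) / (s - t) - du x) @[s --> within (D `\ t) (nbhs t)] --> (0 : R).
Proof.
move=> hu Dt hd h; apply/cvgrPdist_le => e e0; have := h e e0.
rewrite !near_withinE; apply: filterS => s hs [Ds /eqP st].
have {}hs := hs Ds; have hus := hu s Ds; have hut := hu t Dt.
have st0 : s - t != 0 by rewrite subr_eq0.
have hf : H1 ((s - t)^-1 *: (u s - u t) - du) by apply: H1B => //; apply/H1Z/H1B.
rewrite (_ : (fun x => _) = (s - t)^-1 *: (u s - u t) - du); last first.
  by apply/funext => x; rewrite mulrC.
rewrite H1normE// sub0r normrN (ger0_norm (nH_ge0 _)).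
have sp : 0 < `|s - t| by rewrite normr_gt0.
rewrite -(ler_pM2l sp) -(@nrmZ _ _ H1s _ _ hf) scalerBr scalerA divff// scale1r mulrC; exact: hs.
Qed.

Lemma aeeq_nH f g : H1 f -> H1 g -> aeeq f g -> nH (f - g) = 0.
Proof.
move=> hf hg e; rewrite (nH_ae (H1B hf hg) H1_0) ?nrm0//.
by move: e; apply: ae_imp => x h; rewrite !fctE h subrr.
Qed.

Lemma solution_sol u0 v0 T (u v : R -> R -> R) : is_solution u0 v0 T u v ->
  sol (times T) (fun t => (u t, v t)).
Proof.
move=> [du [dv [[hu hv] eu ev _ _]]] t Tt.
have Hu s : times T s -> H1 (u s) by move=> /hu[].
have Hv s : times T s -> H1 (v s) by move=> /hv[].
have Hdu : H1 (du t) by case: (hu t Tt). have Hdv : H1 (dv t) by case: (hv t Tt).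
have dY s : times T s -> dom S (u s, v s) by move=> Ts; split; [exact: Hu|exact: Hv].
split; first exact: dY.
have [k1 k2] : dom S (sysB (u t, v t) (u t, v t)) by exact: (bil_dom sysB_bilin (dY t Tt) (dY t Tt)).
apply: deriv_pair.
  apply: (@deriv_at_equiv _ H1s (times T) u u (du t) _ t Hu Hu Tt Hdu k1 _ _ (C1_H1_deriv hu Tt)).
    by move=> s _; rewrite subrr nrm0.
  apply: aeeq_nH => //; have /aeeqE := eu t Tt; apply: ae_imp => x ->.
  by rewrite -[RHS]/(u t x * v t x + u t x * v t x); ring.
apply: (@deriv_at_equiv _ H1s (times T) v v (dv t) _ t Hv Hv Tt Hdv k2 _ _ (C1_H1_deriv hv Tt)).
  by move=> s _; rewrite subrr nrm0.
apply: aeeq_nH => //; have /aeeqE := ev t Tt; apply: ae_imp => x ->.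
by congr hilbert; apply/funext => z; rewrite expr2.
Qed.

Lemma sol_solution u0 v0 T Z : sol (times T) Z -> aeeq (Z 0).1 u0 -> aeeq (Z 0).2 v0 ->
  is_solution u0 v0 T (fun t => (Z t).1) (fun t => (Z t).2).
Proof.
move=> sZ e1 e2.
exists (fun t => (sysB (Z t) (Z t)).1), (fun t => (sysB (Z t) (Z t)).2).
have dZ s : times T s -> dom S (Z s) by exact: sol_dom.
have Hu s : times T s -> H1 (Z s).1 by move=> /dZ[].
have Hv s : times T s -> H1 (Z s).2 by move=> /dZ[].
(* The derivative is [sysB (Z t) (Z t)], so its continuity in time is inherited from [Z] through the
   bound on [sysB]. *)
have cB t e : times T t -> 0 < e -> \forall s \near within (times T) (nbhs t),
    nrm S (sysB (Z s) (Z s) - sysB (Z t) (Z t)) <= e.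
  move=> Tt e0; have [d h] := sZ t Tt; have d' := sol_dom' sZ Tt.
  have N0 := nrm_ge0 d; pose K := 12 * (2 * nrm S (Z t) + 1).
  have K0 : 0 < K by rewrite mulr_gt0// ltr_wpDl// mulr_ge0.
  have c1 := deriv_cont dZ Tt d' h (ltr01 : 0 < 1 :> R).
  have c2 := deriv_cont dZ Tt d' h (divr_gt0 e0 K0).
  near=> s; have Ts : times T s by near: s; exact: withinT.
  have ds := dZ s Ts.
  have q1 : nrm S (Z s - Z t) <= 1 by near: s.
  have q2 : nrm S (Z s - Z t) <= e / K by near: s.
  have q0 := nrm_ge0 (domB ds d).
  have q3 : nrm S (Z s) <= nrm S (Z t) + 1.
    rewrite -[in leLHS](subrK (Z t) (Z s)) addrC.
    by apply: le_trans (nrmD d (domB ds d)) _; rewrite lerD2l.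
  apply: le_trans (bil_dist sysB_bilin ds d ds d) _.
  have q4 := ler_wpM2l q0 q3; have q5 := ler_wpM2r N0 q2; have q6 := ler_wpM2r (ltW K0) q2.
  rewrite divfK ?gt_eqF// in q6; apply: le_trans q6.
  rewrite /K mulrCA; apply: ler_wpM2l => //.
  apply: le_trans (lerD q4 (lexx _)) _.
  by rewrite le_eqVlt; apply/orP; left; apply/eqP; ring.
split.
- split=> t Tt; have [d h] := sZ t Tt; have [k1 k2] := sol_dom' sZ Tt; split.
  + exact: Hu.
  + exact: k1.
  + apply: deriv_C1_H1 => //; exact: (deriv_fst dZ Tt (sol_dom' sZ Tt) h).
  + apply/cvgrPdist_le => e e0; have c := cB t e Tt e0; near=> s.
    have Ts : times T s by near: s; exact: withinT.
    have [l1 l2] := sol_dom' sZ Ts.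
    rewrite sub0r normrN H1normE; last exact: (H1B l1 k1).
    rewrite ger0_norm ?nH_ge0//.
    apply: (@le_trans _ _ (nrm S (sysB (Z s) (Z s) - sysB (Z t) (Z t)))); last by near: s.
    exact: (nrm_prod_fst (sysB (Z s) (Z s) - sysB (Z t) (Z t))).
  + exact: Hv.
  + exact: k2.
  + apply: deriv_C1_H1 => //; exact: (deriv_snd dZ Tt (sol_dom' sZ Tt) h).
  + apply/cvgrPdist_le => e e0; have c := cB t e Tt e0; near=> s.
    have Ts : times T s by near: s; exact: withinT.
    have [l1 l2] := sol_dom' sZ Ts.
    rewrite sub0r normrN H1normE; last exact: (H1B l2 k2).
    rewrite ger0_norm ?nH_ge0//.
    apply: (@le_trans _ _ (nrm S (sysB (Z s) (Z s) - sysB (Z t) (Z t)))); last by near: s.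
    exact: (nrm_prod_snd (sysB (Z s) (Z s) - sysB (Z t) (Z t))).
- move=> t _; apply/aeeqE; apply: aeW => x.
  by rewrite -[LHS]/((Z t).1 x * (Z t).2 x + (Z t).1 x * (Z t).2 x); ring.
- move=> t _; apply/aeeqE; apply: aeW => x.
  by congr hilbert; apply/funext => z; rewrite expr2.
- exact/aeeqE.
- exact/aeeqE.
Unshelve. all: by end_near. Qed.

Lemma S_complete : geom_complete (S : seminormed ((R -> R) * (R -> R))%type).
Proof. by apply: prod_complete; exact: H1_complete. Qed.

(* Bounded solutions can be restarted close to [T], for a time that depends on the bound only. *)
Lemma sol_extend (T M : R) Y : 0 < T -> sol (times T%:E) Y ->
  (forall t, times T%:E t -> nrm S (Y t) <= M) ->
  exists T' Z, [/\ T < T', sol (times T'%:E) Z & forall t, t < T -> Z t = Y t].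
Proof.
move=> T0 sY bY.
have TE s : times T%:E s <-> 0 <= s < T.
  by rewrite /times /= lte_fin; split => [[-> ->]//|/andP[]].
have dY s : times T%:E s -> dom S (Y s) by exact: sol_dom.
have t00 : times T%:E 0 by apply/TE; rewrite lexx.
have M0 : 0 <= M := le_trans (nrm_ge0 (dY _ t00)) (bY _ t00).
pose A := M + 1; have A0 : 0 < A by rewrite /A; lra.
have twelve : 0 < 12 :> R by [].
pose d := radius 12 A; have d0 : 0 < d := radius_gt0 twelve A0.
(* The restart takes place at most [d / 2] before [T], so a solution on the times within [d] of [t0]
   reaches [T + d / 2], beyond the new end [T + d / 4]. *)
pose t0 := Num.max 0 (T - d / 2).
have t0ge : 0 <= t0 by rewrite le_max lexx.
have t0d : T - d / 2 <= t0 by rewrite le_max lexx orbT.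
have t0T : t0 < T by rewrite gt_max T0/=; lra.
have Tt0 : times T%:E t0 by apply/TE; rewrite t0ge.
have NA : nrm S (Y t0) <= A by apply: le_trans (bY _ Tt0) _; rewrite lerDl.
have [W [W0 bW hW]] := power_series_solution S_complete sysB_bilin twelve A0 (dY _ Tt0) NA.
rewrite -/d in bW hW; set K := 64 * A * _ in hW.
have K0 : 0 <= K by rewrite /K mulr_ge0 ?sqr_ge0// mulr_ge0// ltW.
pose D1 := [set t : R | `|t - t0| <= d].
pose W' t := W (t - t0).
have sW : sol D1 W'.
  move=> t Dt; have [dWt _] := bW _ Dt; split => // e e0.
  near=> s; have Ds : D1 s by near: s; exact: withinT.
  have := hW _ _ Ds Dt; rewrite (_ : s - t0 - (t - t0) = s - t); last by ring.
  move=> /le_trans; apply.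
  rewrite -(real_normK (num_real _)) expr2 mulrA; apply: ler_wpM2r => //.
  apply: (@le_trans _ _ ((K + 1) * `|s - t|)); first by rewrite ler_wpM2r// lerDl.
  rewrite -ler_pdivlMl; last by lra.
  rewrite mulrC distrC; near: s; apply: cvg_within.
  by apply: (@cvgr_dist_le _ _ _ _ _ id t cvg_id); rewrite divr_gt0//; lra.
(* Both curves solve the equation on [[t0, t]] with bound [2 * A]; uniqueness identifies them up to
   seminorm zero only. *)
have agree t : t0 < t -> t < T -> nrm S (Y t - W' t) = 0.
  move=> h1 h2.
  have sub1 : `[t0, t] `<=` times T%:E.
    by move=> s /=; rewrite in_itv/= => /andP[a1 a2]; apply/TE; apply/andP; split; lra.
  have sub2 : `[t0, t] `<=` D1.
    by move=> s /=; rewrite in_itv/= => /andP[a1 a2]; rewrite /D1 /= ger0_norm; lra.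
  apply: (@sol_unique R `[t0, t]%classic Y W' t0 t (2 * A)).
  - exact: ltW.
  - by [].
  - exact: sol_sub sub1 sY.
  - exact: sol_sub sub2 sW.
  - move=> s ss; split; last by apply: (bW _ _).2; apply: sub2; rewrite /= in_itv.
    apply: le_trans (bY _ _) _; first by apply: sub1; rewrite /= in_itv.
    by rewrite /A; lra.
  - have c0 : `|0 : R| <= d by rewrite normr0 ltW.
    by rewrite /W' subrr nrm_distC//; [exact: dY|exact: (bW _ c0).1].
pose T' := T + d / 4.
pose Z t := if t < T then Y t else W' t.
exists T', Z; split; first by rewrite /T'; lra.
  move=> t; rewrite /times /= lte_fin => -[t1 t2].
  have dZ s : 0 <= s -> s < T' -> dom S (Z s).
    move=> s0 sT'; rewrite /Z; case: ltP => sT; first by apply/dY/TE; rewrite s0.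
    by apply: (bW _ _).1; rewrite ger0_norm; rewrite /T' in sT'; lra.
  split; first exact: dZ.
  case: (ltP t T) => tT.
    have Tt : times T%:E t by apply/TE; rewrite t1.
    have n1 : nbhs t [set s | s < T] by exact: lt_nbhsl.
    apply: (deriv_at_local n1).
    have Zt : Z t = Y t by rewrite /Z tT.
    rewrite Zt; have [dt ht] := sY t Tt.
    have sub : times T'%:E `&` [set s | s < T] `<=` times T%:E.
      by move=> s [[s0 _] /= sT]; apply/TE; rewrite s0.
    apply: (deriv_at_equiv _ _ _ _ _ _ _ (deriv_at_sub sub ht)).
    - by move=> s /sub; exact: dY.
    - by move=> s [[s0]]; rewrite lte_fin => sT' _; exact: dZ.
    - by split => //; split => //; rewrite lte_fin.
    - exact: sol_dom' sY Tt.
    - exact: sol_dom' sY Tt.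
    - move=> s [_ sT]; have -> : Z s = Y s by rewrite /Z (sT : s < T).
      exact: nrm_subrr.
    - exact: nrm_subrr.
  (* From [T] on, [t] has a neighbourhood to the right of [t0], where the glued curve is [W'] up to
     seminorm zero, by [agree] on the overlap. *)
  have n1 : nbhs t [set s | t0 < s] by apply: lt_nbhsr; lra.
  apply: (deriv_at_local n1).
  have Zt : Z t = W' t by rewrite /Z ltNge tT.
  have sub : times T'%:E `&` [set s | t0 < s] `<=` D1.
    move=> s [[s0]]; rewrite lte_fin => sT' /= ts.
    by rewrite /D1 /= ger0_norm; rewrite /T' in sT'; lra.
  have Dt : (times T'%:E `&` [set s | t0 < s]) t.
    by split; [split => //; rewrite lte_fin|rewrite /=; lra].
  rewrite Zt; have [dt ht] := sW t (sub t Dt).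
  have dW s : (times T'%:E `&` [set s | t0 < s]) s -> dom S (W' s).
    by move=> /sub h; exact: sol_dom sW h.
  have dZ' s : (times T'%:E `&` [set s | t0 < s]) s -> dom S (Z s).
    by move=> [[s0]]; rewrite lte_fin => sT' _; exact: dZ.
  apply: (deriv_at_equiv dW dZ' Dt _ _ _ _ (deriv_at_sub sub ht)).
  - exact: sol_dom' sW (sub t Dt).
  - exact: sol_dom' sW (sub t Dt).
  - move=> s Ds; rewrite /Z; case: ltP => sT; last exact: nrm_subrr.
    have [[s0 _] ts] := Ds.
    rewrite nrm_distC; [exact: agree|exact: dW|].
    by apply/dY/TE; rewrite s0.
  - exact: nrm_subrr.
by move=> t tT; rewrite /Z tT.
Unshelve. all: by end_near. Qed.

End continuation.

(** * The weighted moments along a solution *)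

Section moments.
Context {R : realType}.
Implicit Types (f g h w p q u v : R -> R) (D : set R) (s t : R).
Local Notation mu := (@lebesgue_measure R).
Local Notation n2 := (nrm L2s).
Local Notation nH := (nrm H1s).
Local Notation S := (prod_seminormed H1s H1s).
Variables (a b : R) (ab : a < b).

Definition outside x : R := 1 - \1_(`[a, b]) x.
(** Cut off to [[a, b]] the weight [x - a] is bounded, so that [wip_bilin] applies, and nothing
    changes on the support of [u]. *)
Definition moment x : R := \1_(`[a, b]) x * (x - a).

Lemma in_indic x : \1_(`[a, b]) x = (if (a <= x) && (x <= b) then 1 else 0) :> R.
Proof. by rewrite indicE mem_setE in_itv/=; case: ifP. Qed.

Lemma measurable_indic_cc : measurable_fun setT (\1_(`[a, b]) : R -> R).
Proof. by apply: measurable_indic; exact: measurable_itv. Qed.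

Lemma measurable_outside : measurable_fun setT outside.
Proof. by apply: measurable_funB => //; exact: measurable_indic_cc. Qed.

Lemma measurable_moment : measurable_fun setT moment.
Proof. by apply: measurable_funM; [exact: measurable_indic_cc|exact: measurable_funB]. Qed.

Lemma outside01 x : outside x = 0 \/ outside x = 1.
Proof. by rewrite /outside in_indic; case: ifP => _; [left; rewrite subrr|right; rewrite subr0]. Qed.

Lemma moment_ge0 x : 0 <= moment x.
Proof. by rewrite /moment in_indic; case: ifPn => [/andP[ax _]|_]; rewrite ?mul0r// mul1r subr_ge0. Qed.

Lemma moment_le x : moment x <= b - a.
Proof.
rewrite /moment in_indic; case: ifPn => [/andP[_ xb]|_]; first by rewrite mul1r lerB.
by rewrite mul0r subr_ge0 ltW.
Qed.

Lemma moment_norm x : `|moment x| <= b - a.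
Proof. by rewrite ger0_norm ?moment_ge0// moment_le. Qed.

Definition supported u := aeeq (fun x => outside x * u x) (cst 0).

(** On the support the weight is [x - a]; the constant part contributes [a \int w Hw = 0], which
    leaves the first moment. *)
Lemma moment_hilbert u : H1 u -> supported u ->
  wip moment (fun x => u x * u x) (hilbert (fun x => u x * u x)) =
  (Int (fun x => u x * u x)) ^+ 2 / (2 * pi).
Proof.
move=> hu su; pose w x := u x * u x; have wW : W11 w := W11M hu hu.
have [hw lw _] := wW; have l2w := H1_L2 hw.
have mw := L1_meas lw.
have e : aeeq (fun x => moment x * w x + a * w x) (fun x => x * w x).
  move: su; apply: ae_imp => x; rewrite /moment /outside /w in_indic /=; case: ifP => _.
    by move=> _; ring.
  by rewrite subr0 mul1r => ->; ring.
have mxw : measurable_fun setT (fun x : R => x * w x) by exact: measurable_funM.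
have lm1 : L1 (fun x => moment x * w x) := L1_bdd measurable_moment moment_norm lw.
have lm2 : L2 (fun x => moment x * w x) := L2_bdd measurable_moment moment_norm l2w.
have l1x : L1 (fun x => x * w x) by apply: L1_ae e (L1D lm1 (L1Z a lw)).
have l2x : L2 (fun x => x * w x) by apply: L2_ae e (L2D lm2 (L2Z a l2w)).
have [lH _ _] := hilbert_L2 wW.
have -> : wip moment w (hilbert w) = ip (fun x => x * w x) (hilbert w) - a * ip w (hilbert w).
  have h := ip_ae (L2D lm2 (L2Z a l2w)) l2x lH lH e (aeeq_refl _).
  rewrite -h ipDl//; last exact: L2Z.
  by rewrite ipZl// addrK.
by rewrite ip_hilbert_self// mulr0 subr0 ip_moment_hilbert.
Qed.

Lemma moment_bound u : H1 u -> 0 <= wip moment u u <= (b - a) * Int (fun x => u x * u x).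
Proof.
move=> hu; have lu := H1_L2 hu; have luu := L2_L1 lu lu; apply/andP; split.
  by apply: Int_ge0 => x; rewrite -mulrA mulr_ge0 ?moment_ge0// -expr2 sqr_ge0.
rewrite -IntZ//; apply: Int_le; [|exact: L1Z|].
  by apply: L2_L1 => //; exact: L2_bdd measurable_moment moment_norm lu.
by move=> x; rewrite -mulrA ler_wpM2r ?moment_le// -expr2 sqr_ge0.
Qed.

Lemma sol_time_bound T Y : sol (times T) Y ->
  (forall t, times T t -> supported (Y t).1) ->
  0 < 4 * wip moment (fun x => (Y 0).1 x * (Y 0).1 x) (Y 0).2 ->
  forall t, times T t ->
  t <= (4 / (3 * pi * (b - a) ^+ 2) *
        (4 * wip moment (fun x => (Y 0).1 x * (Y 0).1 x) (Y 0).2)) `^ (- 3^-1) * Icubic.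
Proof.
move=> sY supp C0 t Tt.
have dY s : times T s -> dom S (Y s) by exact: sol_dom.
have Hu s : times T s -> H1 (Y s).1 by move=> /dY[].
have Hv s : times T s -> H1 (Y s).2 by move=> /dY[].
pose w s x := (Y s).1 x * (Y s).1 x.
have Hw s : times T s -> H1 (w s) by move=> Ts; exact: (bil_dom mul_H1_bilin (Hu s Ts) (Hu s Ts)).
have bw := wip_bilin measurable_moment moment_norm.
have ba : 0 < b - a by rewrite subr_gt0.
have pi0 : 0 < pi :> R := pi_gt0 R.
pose G s := wip moment (Y s).1 (Y s).1.
pose C s := 4 * wip moment (w s) (Y s).2.
pose du s := (sysB (Y s) (Y s)).1.
pose dw s : R -> R := (fun x => du s x * (Y s).1 x) + (fun x => (Y s).1 x * du s x).
pose dC s := 4 * (wip moment (dw s) (Y s).2 + wip moment (w s) (hilbert (w s))).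
have duE s x : du s x = 2 * ((Y s).1 x * (Y s).2 x).
  by rewrite -[du s x]/((Y s).1 x * (Y s).2 x + (Y s).1 x * (Y s).2 x); ring.
have k0 : 0 < 4 / (3 * pi * (b - a) ^+ 2) :> R by rewrite divr_gt0// !mulr_gt0// exprn_gt0.
apply: (@blowup_time R T G C dC _ t k0 C0 Tt).
- move=> s Ts; have [d h] := sY s Ts; have [k1 k2] := sol_dom' sY Ts.
  have f1 := deriv_fst dY Ts (sol_dom' sY Ts) h.
  have := deriv_bil bw Hu Hu Ts k1 k1 f1 f1; congr (deriv_at Rs _ _ _ s).
  have l1 : L1 (fun x => moment x * w s x * (Y s).2 x).
    apply: L2_L1; last exact/H1_L2/Hv.
    by apply: L2_bdd measurable_moment moment_norm _; exact/H1_L2/Hw.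
  have e1 : wip moment (du s) (Y s).1 = 2 * wip moment (w s) (Y s).2.
    by rewrite /wip /ip -IntZ//; congr Int; apply/funext => x; rewrite duE /w; ring.
  have e2 : wip moment (Y s).1 (du s) = 2 * wip moment (w s) (Y s).2.
    by rewrite /wip /ip -IntZ//; congr Int; apply/funext => x; rewrite duE /w; ring.
  by rewrite e1 e2 /C; ring.
- move=> s Ts; have [d h] := sY s Ts; have [k1 k2] := sol_dom' sY Ts.
  have f1 := deriv_fst dY Ts (sol_dom' sY Ts) h.
  have f2 := deriv_snd dY Ts (sol_dom' sY Ts) h.
  have f3 := deriv_bil (mul_H1_bilin (R := R)) Hu Hu Ts k1 k1 f1 f1.
  have k3 : H1 (dw s).
    apply: H1D; first exact: (bil_dom mul_H1_bilin k1 (Hu s Ts)).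
    exact: (bil_dom mul_H1_bilin (Hu s Ts) k1).
  have f4 := deriv_bil bw Hw Hv Ts k3 k2 f3 f2.
  exact: (@deriv_at_scale R _ Rs (times T) _ _ s 4 (fun _ _ => I) Ts I f4).
- by move=> s Ts; have /andP[] := moment_bound (Hu s Ts).
- move=> s Ts; have /andP[G0 G1] := moment_bound (Hu s Ts).
  rewrite /dC moment_hilbert//; [|exact: Hu|exact: supp].
  (* Both factors [u] of [w] are differentiated, which produces the integrand
     [moment * (2 u v)^2]. *)
  have p0 : 0 <= wip moment (dw s) (Y s).2.
    apply: Int_ge0 => x.
    rewrite -[dw s x]/(du s x * (Y s).1 x + (Y s).1 x * du s x) duE.
    rewrite (_ : _ * _ = moment x * (2 * ((Y s).1 x * (Y s).2 x)) ^+ 2); last by ring.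
    by rewrite mulr_ge0 ?moment_ge0 ?sqr_ge0.
  rewrite -/(G s) in G0 G1 *; move: G0 G1 p0; rewrite -/(w s).
  move: (G s) (Int _) (wip _ _ _) => g I p g0 gI p0.
  have gg : g ^+ 2 <= ((b - a) * I) ^+ 2 by rewrite lerXn2r// nnegrE// (le_trans g0).
  apply: (@le_trans _ _ (4 * (I ^+ 2 / (2 * pi)))); last by rewrite ler_pM2l// lerDr.
  rewrite (_ : 3 / 2 * _ * g ^+ 2 = 2 / pi / (b - a) ^+ 2 * g ^+ 2); last first.
    move: (lt0r_neq0 pi0) (lt0r_neq0 ba); move: (@pi R) (b - a) => q d q0 d0.
    by field; rewrite q0 d0.
  apply: le_trans (ler_wpM2l _ gg) _; first by rewrite !divr_ge0// ?sqr_ge0// ltW.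
  rewrite le_eqVlt; apply/orP; left; apply/eqP.
  move: (lt0r_neq0 pi0) (lt0r_neq0 ba); move: (@pi R) (b - a) => q d q0 d0.
  by field; rewrite q0 d0.
Qed.

End moments.

Theorem theorem1p1 (R : realType) (a b : R) (u0 v0 : R -> R)
    (hab : a < b) (hu0 : H1 u0) (hv0 : H1 v0)
    (hsupp : ess_support u0 `<=` `]a, b[) :
  let phi := fun x : R => x - a in
  let C : R := 4 * \int[leb]_(x in `[a, b]) (phi x * u0 x ^+ 2 * v0 x) in
  let Iinf : R := \int[leb]_(y in `[0, +oo[) (Num.sqrt (y ^+ 3 + 1))^-1 in
  let Tstar : R :=
    (4 * C / (3 * pi * (b - a) ^+ 2)) `^ (- 3^-1) * Iinf in
  0 < C ->
  forall (Tmax : \bar R) (u v : R -> R -> R),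
    is_maximal_solution u0 v0 Tmax u v ->
    (Tmax <= Tstar%:E)%E /\
    (forall M : R, exists t : R,
       times Tmax t /\ M < H1norm (u t) + H1norm (v t)).
Proof.
move=> phi C Iinf Tstar C0 Tmax u v [T0 isol hmax].
pose Y t := (u t, v t).
have sY : sol (times Tmax) Y := solution_sol isol.
have t00 : times Tmax 0 by split.
have [eu ev] : aeeq (Y 0).1 u0 /\ aeeq (Y 0).2 v0.
  by case: isol => du [dv [_ _ _ /aeeqE ? /aeeqE ?]].
have dY t : times Tmax t -> dom (prod_seminormed H1s H1s) (Y t) by exact: sol_dom.
have [hu00 hv00] := dY 0 t00.
have sub t : times Tmax t -> `[0, t] `<=` times Tmax.
  move=> [t0 tT] s /=; rewrite in_itv/= => /andP[s0 st]; split => //.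
  by apply: le_lt_trans tT; rewrite lee_fin.
have supp t : times Tmax t -> supported a b (Y t).1.
  move=> Tt; have [t0 _] := Tt.
  apply: (sol_support t0 (sub t Tt) sY (measurable_outside a b) (outside01 a b)).
  have z : aeeq (fun x => outside a b x * (Y 0).1 x) (cst 0).
    have := ess_support_zero hu0 hsupp; move: eu; apply: ae_imp2 => x -> h.
    rewrite /outside in_indic; case: ifPn => [_|nab]; first by rewrite subrr mul0r.
    rewrite h ?mulr0//; apply: contra nab => /andP[h1 h2]; by rewrite !ltW.
  transitivity (Int (fun _ : R => 0 : R)); last exact: Int0.
  apply: Int_ae.
  - apply: measurable_funM; last exact: L2_meas (H1_L2 hu00).
    by apply: measurable_funM; [exact: measurable_outside|exact: L2_meas (H1_L2 hu00)].
  - by [].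
  - by move: z; apply: ae_imp => x /= ->; rewrite mul0r.
(* The constant is defined from the data, with which [u 0] and [v 0] agree only almost everywhere,
   and with the weight not yet cut off. *)
have CE : C = 4 * wip (moment a b) (fun x => (Y 0).1 x * (Y 0).1 x) (Y 0).2.
  rewrite /C -Int_indic; congr (_ * _); apply: Int_ae.
  - apply: measurable_funM; first exact: measurable_indic_cc.
    apply: measurable_funM; last exact: L2_meas (H1_L2 hv0).
    apply: measurable_funM; first exact: measurable_funB.
    by apply: measurable_funX; exact: L2_meas (H1_L2 hu0).
  - apply: measurable_funM; last exact: L2_meas (H1_L2 hv00).
    apply: measurable_funM; first exact: measurable_moment.
    by apply: measurable_funM; exact: L2_meas (H1_L2 hu00).
  - by move: eu ev; apply: ae_imp2 => x -> ->; rewrite /moment /phi; ring.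
have bound t : times Tmax t -> t <= Tstar.
  move=> Tt; rewrite CE in C0; have := sol_time_bound hab sY supp C0 Tt.
  by rewrite -CE /Tstar (_ : 4 / _ * C = 4 * C / (3 * pi * (b - a) ^+ 2))//; ring.
(* A longer lifespan would contain a time beyond [Tstar]: the midpoint of [Tstar] and [Tmax] if
   [Tmax] is finite, [Tstar + 1] otherwise. *)
have Tle : (Tmax <= Tstar%:E)%E.
  rewrite leNgt; apply/negP; have Ts0 := bound 0 t00.
  case: (Tmax) bound => [r| |] bd; last by rewrite ltNge leNye.
    rewrite lte_fin => lt; have /bd : times r%:E ((Tstar + r) / 2).
      by split; [lra|rewrite lte_fin; lra].
    lra.
  move=> _; have /bd : times +oo%E (Tstar + 1) by split; [lra|exact: ltry].
  lra.
(* If the norms never exceeded [M], then [sol_extend] would continue the solution past [Tmax],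
   finite by [Tle], against maximality. *)
split=> // M; apply: contrapT => hM.
have bY t : times Tmax t -> nrm (prod_seminormed H1s H1s) (Y t) <= M.
  move=> Tt; rewrite leNgt; apply/negP => lt; apply: hM; exists t; split => //.
  by have [h1 h2] := dY t Tt; rewrite !H1normE.
case: Tmax Tle T0 sY bY hmax {bound isol t00 sub supp hM dY} => [T| |]//=.
move=> _; rewrite lte_fin => T0 sY bY hmax.
have [T' [Z [TT' sZ ZY]]] := sol_extend T0 sY bY.
apply: (hmax T'%:E (fun t => (Z t).1) (fun t => (Z t).2)).
- by rewrite lte_fin.
- by apply: sol_solution => //; rewrite ZY.
- move=> t [_]; rewrite lte_fin => tT; rewrite ZY//.
  by split; apply/aeeqE; exact: aeeq_refl.
Qed.
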